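(* Let $\mathbb X$ and $\mathbb Y$ be flow spaces admitting expansions $(X_i,f_i,p_i)$ about $x_\bullet$ and $(Y_i,g_i,q_i)$ about $y_\bullet$ respectively. Then there is a flow equivalence $h\colon\mathbb X\to\mathbb Y$ with $h(x_\bullet)=y_\bullet$ if and only if the inverse sequences $\Pi((X_i,f_i))$ and $\Pi((Y_i,g_i))$ are isomorphic inverse sequences in $\mathcal P_F$. (Equivalently, $\overline{\pi_1^+}(\mathbb X,x_\bullet)=\overline{\pi_1^+}(\mathbb Y,y_\bullet)$, where $\overline{\pi_1^+}(\mathbb X,x_\bullet)$ denotes the isomorphism class of $\Pi$ of any expansion of $\mathbb X$ about $x_\bullet$.)
   Context: Flow space: compact metrizable space of topological dimension one with a continuous $\mathbb R$-action without fixed points. Flow equivalence: homeomorphism mapping orbits onto orbits preserving flow orientation. Expansion of $\mathbb X$ about $x_\bullet$: oriented wedges of circles $X_i$ with wedge points $x_i$, positive maps $f_i\colon X_{i+1}\to X_i$ (continuous surjections, wedge point to wedge point, orientation preserving on each circle, locally injective away from the wedge point), projections $p_i\colon\mathbb X\to X_i$ (continuous surjections, locally injective and orientation preserving along orbits) with $p_i(x_\bullet)=x_i$, $p_n=f_n\circ\cdots\circ f_{m-1}\circ p_m$ for $m>n$, and $x\mapsto(p_i(x))_i$ a homeomorphism onto $\varprojlim(X_i,f_i)$. $\mathcal P_F$: objects are pairs $(F,\mathcal G)$, $F$ a free group of finite rank and $\mathcal G$ a chosen free basis (positive generators); morphisms are positive homomorphisms, i.e. homomorphisms mapping the semigroup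 generated by the source basis into the semigroup generated by the target basis. $\Pi((X_i,f_i))$ is the inverse sequence $\big((\pi_1(X_i,x_i),\mathcal G_i),\pi_1(f_i)\big)$, where $\mathcal G_i$ consists of the homotopy classes of loops going once around a single circle of $X_i$ in its positive direction. Two inverse sequences $(G_i,\sigma_i)$, $(H_i,\tau_i)$ in $\mathcal P_F$ are isomorphic if there are increasing $m_k$, $n_k$ and positive homomorphisms $d_k\colon G_{m_k}\to H_{n_k}$, $u_k\colon H_{n_{k+1}}\to G_{m_k}$ with $u_kd_{k+1}=\sigma_{m_k}\circ\cdots\circ\sigma_{m_{k+1}-1}$ and $d_ku_k=\tau_{n_k}\circ\cdots\circ\tau_{n_{k+1}-1}$ for all $k$. *)

(* Defs.v *)
From HB Require Import structures.
From mathcomp Require Import all_boot all_order all_algebra.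
From mathcomp Require Import all_classical all_reals all_analysis.
From mathcomp Require Import Rstruct Rstruct_topology.
Import Order.TTheory GRing.Theory Num.Theory.

Set Implicit Arguments.
Unset Strict Implicit.
Unset Printing Implicit Defensive.

Local Open Scope classical_set_scope.
Local Open Scope ring_scope.

Notation R := Rdefinitions.R.

Definition metrizable (X : topologicalType) : Prop :=
  exists d : X -> X -> R,
    [/\ (forall x y, 0 <= d x y),
        (forall x y, d x y = 0 <-> x = y),
        (forall x y, d x y = d y x),
        (forall x y z, d x z <= d x y + d y z) &
        (forall (x : X) (A : set X),
            nbhs x A <-> exists2 e : R, 0 < e & [set y | d x y < e] `<=` A)].

(** Covering dimension <= n: every finite open cover has a finite open
    refinement (covering X) of order <= n+1, i.e. each point lies in at most
    n+1 members.  (For compact spaces finite covers suffice.) *)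
Definition covdim_le (X : topologicalType) (n : nat) : Prop :=
  forall (I : finType) (U : I -> set X),
    (forall i, open (U i)) -> \bigcup_i U i = [set: X] ->
    exists (J : finType) (V : J -> set X),
      [/\ (forall j, open (V j)),
          \bigcup_j V j = [set: X],
          (forall j, exists i, V j `<=` U i) &
          (forall x, (#|[set j | `[< V j x >]]| <= n.+1)%N)].

Definition topdim_one (X : topologicalType) : Prop :=
  covdim_le X 1 /\ ~ covdim_le X 0.

Definition is_flow (X : topologicalType) (phi : R -> X -> X) : Prop :=
  [/\ (forall x, phi 0 x = x),
      (forall s t x, phi (s + t) x = phi s (phi t x)) &
      continuous (fun q : R * X => phi q.1 q.2)].

Definition flow_space (X : topologicalType) (phi : R -> X -> X) : Prop :=
  [/\ compact [set: X], metrizable X, topdim_one X, is_flow phi &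
      (forall x, exists t, phi t x <> x)].

(** Flow equivalence: a homeomorphism h mapping each orbit onto an orbit,
    preserving the flow orientation: along the orbit of x, h is given by an
    increasing reparametrisation tau of time, which is onto R. *)
Definition flow_equivalence (X Y : topologicalType)
    (phi : R -> X -> X) (psi : R -> Y -> Y) (h : X -> Y) : Prop :=
  (exists g : Y -> X, [/\ cancel h g, cancel g h, continuous h & continuous g])
  /\ forall x : X, exists tau : R -> R,
       [/\ continuous tau,
           (forall s t, s < t -> tau s < tau t),
           (forall u, exists t, tau t = u) &
           (forall t, h (phi t x) = psi (tau t) (h x))].

(** The j-th circle of the wedge: centre (j+1, 0), radius j+1; all circles
    pass through the origin (the wedge point) and meet only there.
    [petal j th] is the point at "angle parameter" th (period 1), th = 0
    being the wedge point; increasing th is the positive orientation. *)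
Definition petal (j : nat) (th : R) : R * R :=
  let r : R := (j.+1)%:R in
  (r - r * cos (2 * pi * th), r * sin (2 * pi * th)).

Definition wedge_pt : R * R := (0, 0).

Definition Wedge (k : nat) : set (R * R) :=
  [set z | exists (j : 'I_k) (th : R), z = petal j th].

Definition loc_inj_at (c : R -> R * R) (t : R) : Prop :=
  exists2 e : R, 0 < e &
    forall s1 s2, `|s1 - t| < e -> `|s2 - t| < e -> c s1 = c s2 -> s1 = s2.

Definition pos_at (k : nat) (c : R -> R * R) (t : R) : Prop :=
  exists2 e : R, 0 < e &
  exists (j1 j2 : 'I_k) (th1 th2 : R -> R),
    [/\ (forall s, t - e <= s <= t -> c s = petal j1 (th1 s)),
        (forall s, t <= s <= t + e -> c s = petal j2 (th2 s)),
        {within [set s | t - e <= s <= t], continuous th1},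
        {within [set s | t <= s <= t + e], continuous th2} &
        (forall s1 s2, t - e <= s1 -> s1 < s2 -> s2 <= t -> th1 s1 < th1 s2) /\
        (forall s1 s2, t <= s1 -> s1 < s2 -> s2 <= t + e -> th2 s1 < th2 s2)].

Definition positive_map (k' k : nat) (f : R * R -> R * R) : Prop :=
  [/\ {within Wedge k', continuous f},
      (forall z, Wedge k' z -> Wedge k (f z)),
      (forall w, Wedge k w -> exists2 z, Wedge k' z & f z = w),
      f wedge_pt = wedge_pt &
      (forall (j : 'I_k') (s : R), 0 < s < 1 ->
         loc_inj_at (fun th => f (petal j th)) s /\
         pos_at k (fun th => f (petal j th)) s)].

Fixpoint fcomp (f : nat -> R * R -> R * R) (n d : nat) : R * R -> R * R :=
  match d with
  | 0 => id
  | d'.+1 => fcomp f n d' \o f (n + d')%N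
  end.

Definition expansion (X : topologicalType) (phi : R -> X -> X) (xb : X)
    (kk : nat -> nat) (f : nat -> R * R -> R * R) (p : nat -> X -> R * R)
    : Prop :=
  [/\ (forall i, positive_map (kk i.+1) (kk i) (f i)),
      (forall i, continuous (p i)) /\
      (forall i x, Wedge (kk i) (p i x)) /\
      (forall i w, Wedge (kk i) w -> exists x, p i x = w),
      (forall i x, loc_inj_at (fun t => p i (phi t x)) 0 /\
                   pos_at (kk i) (fun t => p i (phi t x)) 0),
      (forall i, p i xb = wedge_pt) /\
      (forall n m x, (n < m)%N -> p n x = fcomp f n (m - n) (p m x)) &
      (* x |-> (p i x)_i is a homeomorphism onto the inverse limit *)
      [/\ (forall x y, (forall i, p i x = p i y) -> x = y),
          (forall z : nat -> R * R,
             (forall i, Wedge (kk i) (z i)) ->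
             (forall i, z i = f i (z i.+1)) ->
             exists x, forall i, p i x = z i) &
          (forall (x : X) (U : set X), nbhs x U ->
             exists (N : nat) (e : R), 0 < e /\
               forall y, (forall i, (i <= N)%N ->
                           `|(p i y).1 - (p i x).1| < e /\
                           `|(p i y).2 - (p i x).2| < e) -> U y)]].

Definition unit_I : set R := [set s | 0 <= s <= 1].

Definition wloop (k : nat) (g : R -> R * R) : Prop :=
  [/\ {within unit_I, continuous g},
      (forall t, unit_I t -> Wedge k (g t)),
      g 0 = wedge_pt & g 1 = wedge_pt].

Definition whtp (k : nat) (g1 g2 : R -> R * R) : Prop :=
  exists H : R -> R -> R * R,
    [/\ {within unit_I `*` unit_I, continuous (fun q : R * R => H q.1 q.2)},
        (forall s t, unit_I s -> unit_I t -> Wedge k (H s t)),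
        (forall t, unit_I t -> H 0 t = g1 t /\ H 1 t = g2 t) &
        (forall s, unit_I s -> H s 0 = wedge_pt /\ H s 1 = wedge_pt)].

Definition lconcat (g1 g2 : R -> R * R) : R -> R * R :=
  fun t => if t <= 2^-1 then g1 (2 * t) else g2 (2 * t - 1).

Definition wgen (j : nat) : R -> R * R := fun t => petal j t.

Fixpoint word_loop (j : nat) (s : seq nat) : R -> R * R :=
  match s with
  | [::] => wgen j
  | j' :: s' => lconcat (wgen j) (word_loop j' s')
  end.

(** The class of g lies in the semigroup generated by the positive
    generators of pi_1(wedge of k circles). *)
Definition positive_class (k : nat) (g : R -> R * R) : Prop :=
  exists (j : 'I_k) (s : seq 'I_k),
    whtp k g (word_loop j [seq nat_of_ord i | i <- s]).

(** D : loops -> loops represents a group homomorphism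
    pi_1(W_a, pt) -> pi_1(W_b, pt) (by its action on representatives). *)
Definition is_pi1_hom (a b : nat) (D : (R -> R * R) -> (R -> R * R)) : Prop :=
  [/\ (forall g, wloop a g -> wloop b (D g)),
      (forall g1 g2, wloop a g1 -> wloop a g2 -> whtp a g1 g2 ->
                     whtp b (D g1) (D g2)) &
      (forall g1 g2, wloop a g1 -> wloop a g2 ->
                     whtp b (D (lconcat g1 g2)) (lconcat (D g1) (D g2)))].

Definition is_pos_hom (a b : nat) (D : (R -> R * R) -> (R -> R * R)) : Prop :=
  is_pi1_hom a b D /\
  (forall g, wloop a g -> positive_class a g -> positive_class b (D g)).

(** Pi((X_i, f_i)) and Pi((Y_i, g_i)) are isomorphic inverse sequences in
    P_F.  The bonding homomorphism pi_1(f_n o ... o f_(m-1)) acts on loops by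
    post-composition. *)
Definition Pi_isomorphic (kx : nat -> nat) (f : nat -> R * R -> R * R)
    (ky : nat -> nat) (g : nat -> R * R -> R * R) : Prop :=
  exists (m n : nat -> nat)
         (d u : nat -> (R -> R * R) -> (R -> R * R)),
    [/\ (forall k, (m k < m k.+1)%N) /\ (forall k, (n k < n k.+1)%N),
        (forall k, is_pos_hom (kx (m k)) (ky (n k)) (d k)),
        (forall k, is_pos_hom (ky (n k.+1)) (kx (m k)) (u k)),
        (forall k c, wloop (kx (m k.+1)) c ->
           whtp (kx (m k)) (u k (d k.+1 c))
                (fcomp f (m k) (m k.+1 - m k) \o c)) &
        (forall k c, wloop (ky (n k.+1)) c ->
           whtp (ky (n k)) (d k (u k c))
                (fcomp g (n k) (n k.+1 - n k) \o c))].

(* Main.v *)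
Require Import Defs.
From HB Require Import structures.
From mathcomp Require Import all_boot all_order all_algebra.
From mathcomp Require Import all_classical all_reals all_analysis.
From mathcomp Require Import Rstruct Rstruct_topology.
From mathcomp Require Import ring lra zify.
Import Order.TTheory GRing.Theory Num.Theory.
Import numFieldNormedType.Exports.

(** A positive loop in a wedge of circles is, up to reparametrization, the
    path spelling a word, and a positive map is given, up to a
    reparametrization of each petal, by the word spelled by each petal.
    Positive words are distinguished by homotopy: the holonomy sending the
    [j]-th generator to the affine map [x |-> b x + (j + 1)] reads a word as a
    numeral in base [b].  Hence an isomorphism of the inverse sequences in P_F is
    the same thing as a ladder of words.

    From words to a flow equivalence: positive maps with the same words differ by
    a reparametrization of the source, so the ladder of words is realized by
    positive maps that commute exactly, not just up to homotopy.  These induce a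
    homeomorphism [h] of the inverse limits fixing the base points.  Away from
    the base point, an orbit is determined by its angle at level 0, since
    beyond some level it stays in one petal for a short time; at the base point
    one passes to the limit.  Hence [h] maps orbits to reparametrized orbits.

    From a flow equivalence [h] to words: both [p_m] and [q_n o h] are observed
    along the orbits of [X].  For [m] large compared to [n], two points with the
    same [p_m] have nearly equal [q_n o h], so the sequence of midpoints crossed by
    [q_n o h] while [p_m] runs through the [j]-th petal depends only on [j].  This is
    the word of the [j]-th generator, and reading words is compatible with
    composition as soon as the levels are chosen far enough apart. *)

Set Implicit Arguments.
Unset Strict Implicit.
Unset Printing Implicit Defensive.

Local Open Scope classical_set_scope.
Local Open Scope ring_scope.

(** Letters are counted at the midpoints of petals and not at the wedge point, because close points
    near the wedge point may lie in different petals, whereas close points near a midpoint share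
    their petal. This makes the count stable under perturbation, both along a homotopy and between
    two nearby observations of an orbit. A homotopy may backtrack, so a letter has to act by an
    invertible map; affine maps of the line are invertible and still contain a free semigroup. While
    [p_m] runs through a petal, [q_n o h] starts and ends near the wedge point, but in general not
    at it. Two tolerances therefore alternate in the choice of levels: one bounds the variation of
    an observation over a fibre of the next, the other ensures that points this near the wedge point
    stay away from the midpoints of the coarser observation. Moving the ends of a passage to the
    wedge point then changes no letter. Angles are lifted to the real line, where a lift of an orbit
    is injective in time; this pins down time changes even on periodic orbits. *)

(** * Continuity in epsilon-delta form and induction on a segment *)

Lemma within_epsdelta (V W : normedModType R) (A : set V) (f : V -> W) :
  {within A, continuous f} <->
  forall x, A x -> forall e, 0 < e -> exists2 d, 0 < d &
    forall y, A y -> `|y - x| < d -> `|f y - f x| < e.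
Proof.
split.
- move=> /subspace_continuousP cf x Ax e e0.
  have := cf x Ax => /(_ (ball (f x) e)) /=.
  move=> /(_ (nbhsx_ballx _ _ e0)).
  rewrite /nbhs/= /within/= => /nbhs_ballP[d /= d0 dH]; exists d => // y Ay yx.
  have := dH y; rewrite -!ball_normE/= distrC => /(_ yx Ay).
  by rewrite distrC.
- move=> H; apply/subspace_continuousP => x Ax B /nbhs_ballP[e /= e0 eB].
  have [d d0 dH] := H x Ax e e0.
  rewrite /nbhs/= /within/=; apply/nbhs_ballP; exists d => //= y.
  rewrite -ball_normE/= distrC => yx Ay; apply: eB.
  by rewrite -ball_normE/= distrC; exact: dH.
Qed.

Lemma continuous_epsdelta (V W : normedModType R) (f : V -> W) :
  continuous f <->
  forall x e, 0 < e -> exists2 d, 0 < d &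
    forall y, `|y - x| < d -> `|f y - f x| < e.
Proof.
split.
- move=> cf x e e0.
  have : {within setT, continuous f} by apply: continuous_subspaceT.
  by move=> /within_epsdelta/(_ x I e e0)[d d0 dH]; exists d => // y; exact: dH.
- move=> H; apply/continuous_subspace_setT/within_epsdelta => x _ e e0.
  by have [d d0 dH] := H x e e0; exists d => // y _; exact: dH.
Qed.

Lemma prod_norm_lt (z : R * R) e : (`|z| < e) = (`|z.1| < e) && (`|z.2| < e).
Proof. by rewrite prod_normE /= gt_max. Qed.

Lemma IVT_le (f : R -> R) a b v : a <= b -> {within `[a, b], continuous f} ->
  f a <= v <= f b -> exists2 c, a <= c <= b & f c = v.
Proof.
move=> ab cf fv.
have [|c] := @IVT _ f a b v ab cf.
  have le : f a <= f b by lra.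
  by rewrite ge_min le_max; apply/andP; split; apply/orP; [left|right]; lra.
by rewrite in_itv/= => cab fc; exists c.
Qed.

(** Induction on a segment, by the supremum of the points reached from [a]. It replaces finite
    subdivisions wherever a local construction is patched: lifts, moduli of continuity, arcs of one
    orbit. *)
Lemma cousin (P : R -> R -> Prop) (a b : R) : a <= b ->
  (forall t, a <= t <= b -> exists2 e, 0 < e &
     forall u v, a <= u <= t -> t <= v <= b -> t - e < u -> v < t + e -> P u v) ->
  (forall u v w, a <= u <= v -> v <= w <= b -> P u v -> P v w -> P u w) ->
  P a b.
Proof.
move=> ab loc add.
pose S : set R := [set t | a <= t <= b /\ P a t].
have Sa : S a.
  split; first lra.
  have [|e e0 H] := loc a; first lra.
  by apply: H; lra.
have Sb : has_sup S by split; [exists a | exists b => t [? _]; lra].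
pose s := sup S.
have as_ : a <= s by apply: ub_le_sup => //; exact: Sb.2.
have sb : s <= b by apply: ge_sup; [exists a | move=> t [? _]; lra].
have [|e e0 H] := loc s; first lra.
have supS x : S x -> x <= s by move=> Sx; apply: ub_le_sup => //; exact: Sb.2.
have [t [tab Pt] ts] : exists2 t, S t & s - e < t.
  by apply: sup_gt; [exists a|rewrite -/s; lra].
have ts' : t <= s by exact: supS.
clearbody s.
pose v := Num.min b (s + e / 2).
have vb : v <= b by rewrite /v ge_min lexx.
have sv : s <= v by rewrite /v le_min; apply/andP; split; lra.
have vs : v < s + e by rewrite /v gt_min; apply/orP; right; lra.
have Pv : P a v.
  apply: (@add a t v) => //; try lra.
  by apply: H; lra.
have Sv : S v by split; [lra|].
have vs' : v <= s by exact: supS.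
suff -> : b = v by [].
move: vs'; rewrite /v ge_min => /orP[bs|]; last lra.
by rewrite minEle ifT //; lra.
Qed.

Lemma continuousRP (f : R -> R) : continuous f <->
  forall x e, 0 < e -> exists2 d, 0 < d &
    forall y, `|y - x| < d -> `|f y - f x| < e.
Proof. exact: (@continuous_epsdelta R^o R^o f). Qed.

Lemma withinRP (A : set R) (f : R -> R) : {within A, continuous f} <->
  forall x, A x -> forall e, 0 < e -> exists2 d, 0 < d &
    forall y, A y -> `|y - x| < d -> `|f y - f x| < e.
Proof. exact: (@within_epsdelta R^o R^o A f). Qed.

Lemma continuousR2P (f : R -> R * R) : continuous f <->
  forall x e, 0 < e -> exists2 d, 0 < d &
    forall y, `|y - x| < d -> `|f y - f x| < e.
Proof. exact: (@continuous_epsdelta R^o (R^o * R^o)%type f). Qed.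

Lemma withinR2P (A : set R) (f : R -> R * R) : {within A, continuous f} <->
  forall x, A x -> forall e, 0 < e -> exists2 d, 0 < d &
    forall y, A y -> `|y - x| < d -> `|f y - f x| < e.
Proof. exact: (@within_epsdelta R^o (R^o * R^o)%type A f). Qed.

Lemma within22P (A : set (R * R)) (f : R * R -> R * R) :
  {within A, continuous f} <->
  forall x, A x -> forall e, 0 < e -> exists2 d, 0 < d &
    forall y, A y -> `|y - x| < d -> `|f y - f x| < e.
Proof. exact: (@within_epsdelta (R^o * R^o)%type (R^o * R^o)%type A f). Qed.

(** * The petals and the paths running through them *)

Lemma floor_eqP (x : R) (m : int) : m%:~R <= x < m%:~R + 1 -> Num.floor x = m.
Proof. by move=> H; apply: floor_def; rewrite intrD. Qed.

Lemma floor_bounds (x : R) : (Num.floor x)%:~R <= x < (Num.floor x)%:~R + 1.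
Proof. by have := floor_itv x; rewrite intrD. Qed.

Lemma cos_int (m : int) : cos (2 * pi * m%:~R) = 1 :> R.
Proof.
have H n : cos (2 * pi * n%:R) = 1 :> R.
  rewrite mulr_natr -[_ *+ n]add0r periodicn ?cos0 // => u.
  by rewrite mulr_natl cosD2pi.
by case: m => n; rewrite ?NegzE ?mulrNz ?mulrN ?cosN -?pmulrn H.
Qed.

Lemma sin_int (m : int) : sin (2 * pi * m%:~R) = 0 :> R.
Proof. by apply: cos1sin0; rewrite cos_int normr1. Qed.

Lemma petalDint j t (m : int) : petal j (t + m%:~R) = petal j t.
Proof. by rewrite /petal mulrDr trigo.cosD trigo.sinD cos_int sin_int; congr (_, _); ring. Qed.

Lemma petal0 j : petal j 0 = wedge_pt.
Proof. by rewrite /petal mulr0 cos0 sin0 !mulr1 mulr0 subrr. Qed.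

Lemma petal_int j (m : int) : petal j m%:~R = wedge_pt.
Proof. by rewrite -[_%:~R]add0r petalDint petal0. Qed.

Lemma cos_eq1 (u : R) : cos (2 * pi * u) = 1 -> u \is a Num.int.
Proof.
move=> cu; have := floor_bounds u; set m := Num.floor u => um.
have pi0 := pi_gt0 R.
pose v := u - m%:~R.
have uE : u = v + m%:~R by rewrite /v; ring.
have cv : cos (2 * pi * v) = 1.
  have : cos (2 * pi * (v + m%:~R)) = 1 by rewrite -uE.
  by rewrite mulrDr trigo.cosD cos_int sin_int mulr1 mulr0 subr0.
suff -> : u = m%:~R by exact: intr_int.
suff v0 : v = 0 by rewrite uE v0 add0r.
have [v2|v2] := leP v (1/2).
  have : 2 * pi * v = 0.
    apply: cos_inj; rewrite ?cos0 // ?in_itv/=; apply/andP; split; rewrite /v in v2 *; nra.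
  by move/eqP; rewrite !mulf_eq0 pnatr_eq0 /= gt_eqF //= => /eqP.
have : 2 * pi - 2 * pi * v = 0.
  apply: cos_inj; rewrite ?cos0 // ?in_itv/=.
  - apply/andP; split; rewrite /v in v2 *; nra.
  - by apply/andP; split; lra.
  - by have := cos_int 1; have := sin_int 1; rewrite mulr1 cosB cv => -> ->; ring.
move=> H; have : 2 * pi * (1 - v) = 0 by rewrite -H; ring.
move/eqP; rewrite !mulf_eq0 pnatr_eq0 /= gt_eqF //= => /eqP.
by rewrite /v; lra.
Qed.

(** A point with coordinates x, y on the circle of radius r satisfies x^2 + y^2 = 2 r x, so a common
    point of two circles has (r - r') x = 0. Off the wedge point the radii agree, and cosine and
    sine then give the angle modulo 1. *)
Lemma petal_eq j j' s t : petal j s = petal j' t ->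
  s - t \is a Num.int /\ (s \isn't a Num.int -> j = j').
Proof.
rewrite /petal; set r : R := j.+1%:R; set r' : R := j'.+1%:R.
have r0 : 0 < r by rewrite ltr0n.
have r'0 : 0 < r' by rewrite ltr0n.
have c1 := cos2Dsin2 (2 * pi * s); have c2 := cos2Dsin2 (2 * pi * t).
move=> [].
set c := cos _ in c1 *; set c' := cos _ in c2 *.
set d := sin _ in c1 *; set d' := sin _ in c2 * => e1 e2.
have e3 : r * (r - r * c) = r' * (r' - r' * c').
  have : (r - r * c) ^+ 2 + (r * d) ^+ 2 = (r' - r' * c') ^+ 2 + (r' * d') ^+ 2.
    by rewrite e1 e2.
  have -> : (r - r * c) ^+ 2 + (r * d) ^+ 2 = r ^+ 2 * (1 - 2 * c + (c ^+ 2 + d ^+ 2)) by ring.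
  have -> : (r' - r' * c') ^+ 2 + (r' * d') ^+ 2 = r' ^+ 2 * (1 - 2 * c' + (c' ^+ 2 + d' ^+ 2)) by ring.
  by rewrite c1 c2; lra.
have [cE|cN] := eqVneq c 1.
  have sI : s \is a Num.int by exact: cos_eq1.
  have tI : t \is a Num.int.
    apply: cos_eq1; rewrite -/c'; rewrite cE mulr1 subrr in e1.
    apply/eqP; rewrite eq_sym -subr_eq0.
    have : r' * (1 - c') = 0 by rewrite e1; ring.
    by move/eqP; rewrite mulf_eq0 gt_eqF.
  by split; [rewrite rpredB|rewrite sI].
have rr' : r = r'.
  have : (r - r') * (r * (1 - c)) = 0.
    have -> : (r - r') * (r * (1 - c)) = r * (r - r * c) - r' * (r - r * c) by ring.
    by rewrite e3 e1 subrr.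
  move/eqP; rewrite !mulf_eq0 (gt_eqF r0) /= !subr_eq0 => /orP[/eqP //|].
  by rewrite eq_sym (negbTE cN).
have jj : j = j' by have /eqP := rr'; rewrite /r /r' eqr_nat => /eqP[].
split=> //; apply: cos_eq1.
rewrite mulrBr cosB -/c -/c' -/d -/d'.
have cc : c = c'.
  by apply: (mulfI (lt0r_neq0 r'0)); move: e1; rewrite rr' => e; lra.
have dd : d = d'.
  by apply: (mulfI (lt0r_neq0 r'0)); rewrite -e2 rr'.
by rewrite -c1 -cc -dd; ring.
Qed.

Lemma petal_wedge j s : petal j s = wedge_pt <-> s \is a Num.int.
Proof.
split=> [|/intrP[m ->]]; last exact: petal_int.
by rewrite -(petal0 j) => /petal_eq[]; rewrite subr0.
Qed.

Lemma sin_lip (a b : R) : `|sin a - sin b| <= `|a - b|.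
Proof.
wlog ab : a b / a <= b.
  by move=> H; have [/H //|/ltW/H] := leP a b; rewrite distrC (distrC b).
have [|c _ E] := @MVT_segment R sin cos a b ab.
- by apply: continuous_subspaceT => x; exact: continuous_sin.
- by rewrite distrC E normrM (distrC a) ler_piMl // cos_max.
Qed.

Lemma cos_lip (a b : R) : `|cos a - cos b| <= `|a - b|.
Proof.
rewrite -!sinDpihalf; apply: le_trans (sin_lip _ _) _.
by rewrite le_eqVlt; apply/orP; left; apply/eqP; congr `|_|; ring.
Qed.

Lemma petal_lip j k s t : (j < k)%N ->
  `|petal j s - petal j t| <= 2 * pi * k%:R * `|s - t|.
Proof.
move=> jk; have pi0 := pi_gt0 R.
have jk' : (j.+1%:R : R) <= k%:R by rewrite ler_nat.
have j0 : 0 < (j.+1%:R : R) by rewrite ltr0n.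
have b0 : 0 <= `|s - t| by [].
have E : `|2 * pi * s - 2 * pi * t| = 2 * pi * `|s - t|.
  by rewrite -mulrBr normrM gtr0_norm //; lra.
have fin : j.+1%:R * (2 * pi * `|s - t|) <= 2 * pi * k%:R * `|s - t|.
  rewrite mulrA ler_wpM2r // mulrC ler_wpM2l // mulr_ge0 //; exact: ltW.
rewrite prod_normE /= ge_max /petal /=; apply/andP; split.
- have -> : j.+1%:R - j.+1%:R * cos (2 * pi * s) - (j.+1%:R - j.+1%:R * cos (2 * pi * t))
     = j.+1%:R * (cos (2 * pi * t) - cos (2 * pi * s)) :> R by ring.
  rewrite normrM gtr0_norm // distrC.
  have := cos_lip (2 * pi * s) (2 * pi * t); rewrite E => H.
  exact: le_trans (ler_wpM2l (ltW j0) H) fin.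
- have -> : j.+1%:R * sin (2 * pi * s) - j.+1%:R * sin (2 * pi * t)
     = j.+1%:R * (sin (2 * pi * s) - sin (2 * pi * t)) :> R by ring.
  rewrite normrM gtr0_norm //.
  have := sin_lip (2 * pi * s) (2 * pi * t); rewrite E => H.
  exact: le_trans (ler_wpM2l (ltW j0) H) fin.
Qed.

(* [petal] has period 1 in the angle, so [r] is used unreduced: between the
   times [n] and [n + 1] the path runs once around the petal [w n]. *)
Definition W (w : int -> nat) (r : R) : R * R := petal (w (Num.floor r)) r.

Lemma W_wedge w r : W w r = wedge_pt <-> r \is a Num.int.
Proof. exact: petal_wedge. Qed.

Lemma W_petal w r (m : int) : m%:~R <= r <= m%:~R + 1 -> W w r = petal (w m) r.
Proof.
move=> rm; have [rE|rN] := eqVneq r (m%:~R + 1).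
  have rI : r \is a Num.int by rewrite rE rpredD ?intr_int ?rpred1.
  by rewrite ((W_wedge w r).2 rI) ((petal_wedge (w m) r).2 rI).
by rewrite /W (@floor_eqP r m) //; move/eqP: rN => rN; lra.
Qed.

Lemma W_eq w w' r r' : W w r = W w' r' -> r - r' \is a Num.int /\
  (r \isn't a Num.int -> w (Num.floor r) = w' (Num.floor r')).
Proof. exact: petal_eq. Qed.

Lemma W_shift w r (m : int) : W w (r + m%:~R) = W (fun i => w (i + m)) r.
Proof. by rewrite /W petalDint floorDrz ?intr_int // intrKfloor. Qed.

(** Within one turn this is the Lipschitz bound of a petal of radius at most k. Otherwise the path
    meets the origin after [r] and again before [s], and the distances of the two points to the
    origin add up. *)
Lemma W_lip w k r s : (forall i, (w i < k)%N) ->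
  `|W w r - W w s| <= 2 * pi * k%:R * `|r - s|.
Proof.
move=> wk; wlog rs : r s / r <= s.
  by move=> H; have [/H //|/ltW/H] := leP r s; rewrite distrC (distrC s).
have pi0 := pi_gt0 R; have k0 : 0 <= (k%:R : R) by [].
have br := floor_bounds r; have bs := floor_bounds s.
have [fE|fN] := eqVneq (Num.floor r) (Num.floor s).
  by rewrite /W fE; exact: petal_lip.
have fl : Num.floor r + 1 <= Num.floor s.
  by have := le_floor rs; move/eqP: fN; lia.
have fl' : (Num.floor r)%:~R + 1 <= (Num.floor s)%:~R :> R by rewrite -(intrD R _ 1) ler_int.
have d1 : `|W w r| <= 2 * pi * k%:R * ((Num.floor r)%:~R + 1 - r).
  have := petal_lip r (Num.floor r + 1)%:~R (wk (Num.floor r)).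
  rewrite petal_int subr0 intrD distrC ger0_norm // subr_ge0; lra.
have d2 : `|W w s| <= 2 * pi * k%:R * (s - (Num.floor s)%:~R).
  have := petal_lip s (Num.floor s)%:~R (wk (Num.floor s)).
  by rewrite petal_int subr0 ger0_norm // subr_ge0; lra.
apply: le_trans (ler_normB _ _) _.
rewrite distrC ger0_norm; last lra.
apply: le_trans (lerD d1 d2) _.
by rewrite -mulrDr ler_wpM2l //; [rewrite !mulr_ge0 // ltW|lra].
Qed.

Lemma Wedge_petal k j r : (j < k)%N -> Wedge k (petal j r).
Proof. by move=> jk; exists (Ordinal jk), r. Qed.

Lemma WedgeP k z : Wedge k z -> exists2 j, (j < k)%N &
  exists2 t, 0 <= t < 1 & z = petal j t.
Proof.
move=> [j [t ->]]; exists j => //; exists (t - (Num.floor t)%:~R).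
  by have := floor_bounds t; lra.
by rewrite -(petalDint j (t - _) (Num.floor t)) subrK.
Qed.

Lemma W_cont w k : (forall i, (w i < k)%N) -> continuous (W w).
Proof.
move=> wk; apply/continuousR2P => x e e0.
have C0 : 0 < 2 * pi * k%:R + 1 :> R.
  by rewrite ltr_wpDl // !mulr_ge0 // ltW // pi_gt0.
exists (e / (2 * pi * k%:R + 1)); first by rewrite divr_gt0.
move=> y; rewrite ltr_pdivlMr // => H.
apply: le_lt_trans (W_lip _ _ wk) _; apply: le_lt_trans H.
by rewrite mulrC ler_wpM2l // ler_wpDr.
Qed.

(** * Increasing homeomorphisms of the line *)

(** Continuity follows from the two clauses ([ihomeo_continuous]), so inverses and glued maps need
    only monotonicity and surjectivity. *)
Definition ihomeo (f : R -> R) : Prop :=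
  (forall s t, s < t -> f s < f t) /\ (forall u, exists t, f t = u).

Lemma ihomeo_lt f s t : ihomeo f -> (f s < f t) = (s < t).
Proof.
move=> [fi _]; have [st|ts|->] := ltgtP s t; [exact: fi| |by rewrite ltxx].
by apply/negbTE; rewrite -leNgt ltW // fi.
Qed.

Lemma ihomeo_le f s t : ihomeo f -> (f s <= f t) = (s <= t).
Proof. by move=> fi; rewrite !leNgt ihomeo_lt. Qed.

Lemma ihomeo_inj f : ihomeo f -> injective f.
Proof.
by move=> fi s t e; apply/eqP; rewrite eq_le -(ihomeo_le s t fi) -(ihomeo_le t s fi) e lexx.
Qed.

Lemma ihomeo_continuous f : ihomeo f -> continuous f.
Proof.
move=> fi; apply/continuousRP => x e e0.
have [a fa] := fi.2 (f x - e); have [b fb] := fi.2 (f x + e).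
have ax : a < x by rewrite -(ihomeo_lt _ _ fi) fa; lra.
have xb : x < b by rewrite -(ihomeo_lt _ _ fi) fb; lra.
exists (Num.min (x - a) (b - x)); first by rewrite lt_min; apply/andP; split; lra.
move=> y; rewrite lt_min !ltr_norml => /andP[/andP[y1 _] /andP[_ y2]].
have : f a < f y by rewrite (ihomeo_lt _ _ fi); lra.
have : f y < f b by rewrite (ihomeo_lt _ _ fi); lra.
by rewrite fa fb => *; apply/andP; split; lra.
Qed.

Lemma ihomeo_id : ihomeo id.
Proof. by split=> // u; exists u. Qed.

Lemma ihomeo_comp f g : ihomeo f -> ihomeo g -> ihomeo (f \o g).
Proof.
move=> fi gi; split=> [s t st|u] /=; first by rewrite !ihomeo_lt.
by have [v <-] := fi.2 u; have [t <-] := gi.2 v; exists t.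
Qed.

Lemma ihomeo_affine a b : 0 < a -> ihomeo (fun t => a * t + b).
Proof.
move=> a0; split=> [s t st|u]; first by rewrite ltrD2r ltr_pM2l.
by exists ((u - b) / a); rewrite mulrC divfK ?gt_eqF // subrK.
Qed.

Lemma ihomeo_shift f c d : ihomeo f -> ihomeo (fun t => f (t + c) + d).
Proof.
move=> fi; split=> [s t st|u]; first by rewrite ltrD2r ihomeo_lt // ltrD2r.
by have [v vE] := fi.2 (u - d); exists (v - c); rewrite subrK vE subrK.
Qed.

Lemma ihomeo_inv f : ihomeo f ->
  exists g, [/\ ihomeo g, cancel f g & cancel g f].
Proof.
move=> fi; have [g gP] := choice fi.2.
have fg : cancel f g by move=> t; apply: (ihomeo_inj fi); rewrite gP.
exists g; split=> //; split=> [s t st|u]; last by exists (f u).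
by rewrite -(ihomeo_lt _ _ fi) !gP.
Qed.

Lemma ihomeo_glue a f g : ihomeo f -> ihomeo g -> f a = g a ->
  ihomeo (fun t => if t <= a then f t else g t).
Proof.
move=> fi gi fga; split=> [s t st|u].
- case: ifP => sa; case: ifP => ta; rewrite ?ihomeo_lt //.
  + apply: (@le_lt_trans _ _ (f a)); first by rewrite ihomeo_le.
    by rewrite fga ihomeo_lt // ltNge ta.
  + by move: sa ta; lra.
- have [ua|ua] := leP u (f a).
  + by have [t tu] := fi.2 u; exists t; rewrite ifT // -(ihomeo_le _ _ fi) tu.
  + have [t tu] := gi.2 u; exists t; rewrite ifF //.
    by apply/negbTE; rewrite -ltNge -(ihomeo_lt _ _ gi) tu -fga.
Qed.

(** * Integer-valued differences and uniqueness of real lifts *)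

Lemma within_itv (f : R -> R) a b : continuous f -> {within `[a, b], continuous f}.
Proof. exact: continuous_subspaceT. Qed.

Lemma within_itvW (f : R -> R) a b c d : a <= c -> d <= b ->
  {within `[a, b], continuous f} -> {within `[c, d], continuous f}.
Proof.
move=> ac db; apply: continuous_subspaceW => t /=.
by rewrite !in_itv/= => /andP[? ?]; apply/andP; split; lra.
Qed.

Lemma withinN (A : set R) (f : R -> R) : {within A, continuous f} ->
  {within A, continuous (fun t => - f t)}.
Proof.
move=> /withinRP cf; apply/withinRP => x Ax e /(cf x Ax)[d d0 dH].
by exists d => // y Ay yx; rewrite -opprD normrN; exact: dH.
Qed.

Lemma withinD (A : set R) (f g : R -> R) : {within A, continuous f} ->
  {within A, continuous g} -> {within A, continuous (fun t => f t + g t)}.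
Proof.
move=> /withinRP cf /withinRP cg; apply/withinRP => x Ax e e0.
have [|d d0 dH] := cf x Ax (e / 2); first lra.
have [|d' d'0 d'H] := cg x Ax (e / 2); first lra.
exists (Num.min d d'); first by rewrite lt_min d0.
move=> y Ay; rewrite lt_min => /andP[/(dH y Ay) h1 /(d'H y Ay) h2].
have -> : f y + g y - (f x + g x) = f y - f x + (g y - g x) by ring.
by apply: le_lt_trans (ler_normD _ _) _; lra.
Qed.

Lemma int_lt_gap (x y : R) : x \is a Num.int -> y \is a Num.int -> x < y -> x + 1 <= y.
Proof.
move=> /intrP[m ->] /intrP[n ->]; rewrite ltr_int -(intrD R m 1) ler_int; lia.
Qed.

Lemma int_half (x : R) : x \is a Num.int -> x + 1/2 \isn't a Num.int.
Proof.
move=> xI; apply/negP => /int_lt_gap - /(_ (x + 1)) H.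
have : x + 1/2 + 1 <= x + 1 by apply: H; [rewrite rpredD ?rpred1|lra].
by lra.
Qed.

Lemma continuous_int_const (f : R -> R) a b : a <= b ->
  {within `[a, b], continuous f} ->
  (forall t, a <= t <= b -> f t \is a Num.int) -> f a = f b.
Proof.
wlog: f / f a <= f b.
  move=> H ab cf fI; have [|/ltW] := leP (f a) (f b); first by move/H; apply.
  move=> ba; apply: oppr_inj; apply: (H (fun t => - f t)) => //.
  - by rewrite lerN2.
  - exact: withinN.
  - by move=> t tab; rewrite rpredN fI.
move=> fab ab cf fI; apply/eqP; rewrite eq_le fab /= leNgt; apply/negP => fab'.
have ge1 : f a + 1 <= f b by apply: int_lt_gap => //; apply: fI; lra.
have [|c cab fc] := @IVT_le f a b (f a + 1/2) ab cf; first lra.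
have : f c \is a Num.int by exact: fI.
by rewrite fc; apply/negP/int_half/fI; lra.
Qed.

Lemma lift_unique (f g : R -> R) a b : a <= b ->
  {within `[a, b], continuous f} -> {within `[a, b], continuous g} ->
  (forall t, a <= t <= b -> f t - g t \is a Num.int) -> f b - f a = g b - g a.
Proof.
move=> ab cf cg fgI.
have := @continuous_int_const (fun t => f t - g t) a b ab _ fgI.
have -> : (f b - f a = g b - g a) <-> (f a - g a = f b - g b) by split; lra.
by apply; apply: withinD => //; exact: withinN.
Qed.

Lemma floor_const (f : R -> R) a b : a <= b -> {within `[a, b], continuous f} ->
  (forall t, a <= t <= b -> f t \isn't a Num.int) ->
  Num.floor (f a) = Num.floor (f b).
Proof.
wlog: f / f a <= f b.
  move=> H ab cf fI; have [|/ltW] := leP (f a) (f b); first by move/H; apply.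
  move=> ba.
  pose g t := - f t.
  have gI t : a <= t <= b -> g t \isn't a Num.int by move=> tab; rewrite /g rpredN fI.
  have gE : Num.floor (g a) = Num.floor (g b).
    apply: H => //; first by rewrite lerN2.
    exact: withinN.
  have h (x : R) : x \isn't a Num.int -> Num.floor x = - Num.floor (- x) - 1 :> int.
    move=> xI; apply: floor_eqP; have := floor_bounds (- x).
    set m := Num.floor _; rewrite intrB intrN => H1.
    have : x != - m%:~R by apply: contraNneq xI => ->; rewrite rpredN intr_int.
    by move/eqP => H2; lra.
  rewrite (h (f a)) ?(h (f b)); first by move: gE; rewrite /g => ->.
    by apply: fI; lra.
  by apply: fI; lra.
move=> fab ab cf fI; apply/eqP; rewrite eq_le le_floor //= leNgt; apply/negP => lt.
have b1 := floor_bounds (f a); have b2 := floor_bounds (f b).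
have : (Num.floor (f a) + 1)%:~R <= (Num.floor (f b))%:~R :> R by rewrite ler_int; lia.
rewrite intrD => H.
have [|c cab fc] := @IVT_le f a b (Num.floor (f b))%:~R ab cf; first lra.
by have := fI c cab; rewrite fc intr_int.
Qed.

Lemma ihomeo_of_unbounded (f : R -> R) : (forall s t, s < t -> f s < f t) ->
  continuous f -> (forall M, exists t, M <= f t) -> (forall M, exists t, f t <= M) ->
  ihomeo f.
Proof.
move=> fi fc fp fm; split=> // u; have [a fa] := fm u; have [b fb] := fp u.
have ab : a <= b.
  by rewrite leNgt; apply/negP => /fi; lra.
have [|c _ <-] := @IVT_le f a b u ab (within_itv fc); first lra.
by exists c.
Qed.

(** * Lifting positive paths *)

Lemma between_int (x : R) (i : int) : i%:~R < x < i%:~R + 1 -> x \isn't a Num.int.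
Proof.
move=> xi; apply/negP => /intrP[q qE].
have : (i < q)%R by rewrite -(ltr_int R) -qE; lra.
have : (q < i + 1)%R by rewrite -(ltr_int R) -qE intrD; lra.
by lia.
Qed.

Definition lifted (k : nat) (c : R -> R * R) (a b : R) (w : int -> nat) (u : R -> R) :=
  [/\ (forall i, (w i < k)%N),
      (forall s t, a <= s -> s < t -> t <= b -> u s < u t),
      {within `[a, b], continuous u} &
      (forall t, a <= t <= b -> c t = W w (u t))].

Lemma within_itv_eq (T : topologicalType) (f g : R -> T) a b : (forall t, a <= t <= b -> f t = g t) ->
  {within `[a, b], continuous f} -> {within `[a, b], continuous g}.
Proof.
move=> fg; apply: subspace_eq_continuous => t; rewrite inE /= in_itv /=.
exact: fg.
Qed.

Lemma within_glue (T : topologicalType) (f g : R -> T) a b c : a <= b -> b <= c ->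
  {within `[a, b], continuous f} -> {within `[b, c], continuous g} -> f b = g b ->
  {within `[a, c], continuous (fun t => if t <= b then f t else g t)}.
Proof.
move=> ab bc cf cg fgb.
have -> : `[a, c]%classic = `[a, b]%classic `|` `[b, c]%classic :> set R.
  apply/seteqP; split=> t /=; rewrite !in_itv /=.
    move=> /andP[at_ tc]; have [tb|bt] := leP t b; [left|right]; apply/andP; split=> //; exact: ltW.
  by move=> [|] /andP[? ?]; apply/andP; split; lra.
apply: withinU_continuous; [exact: interval_closed|exact: interval_closed| |].
- by apply: within_itv_eq cf => t tab; rewrite ifT //; lra.
- apply: within_itv_eq cg => t tab; case: ifP => // tb.
  by have -> : t = b by lra.
Qed.

Lemma liftedW k c a b a' b' w u : a <= a' -> b' <= b ->
  lifted k c a b w u -> lifted k c a' b' w u.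
Proof.
move=> aa bb [wk ui uc cE]; split=> //.
- by move=> s t *; apply: ui; lra.
- exact: within_itvW uc.
- by move=> t *; apply: cE; lra.
Qed.

Lemma lifted_shift k c a b w u (m : int) : lifted k c a b w u ->
  lifted k c a b (fun i => w (i + m)) (fun t => u t - m%:~R).
Proof.
move=> [wk ui uc cE]; split=> //.
- by move=> s t *; rewrite ltrD2r; exact: ui.
- apply: withinD => //; apply: within_itv; exact: cst_continuous.
- by move=> t tab; rewrite -W_shift subrK cE.
Qed.

Lemma lifted_le k c a b w u s t : lifted k c a b w u ->
  a <= s -> s <= t -> t <= b -> u s <= u t.
Proof.
move=> [_ ui _ _] as_ + tb; rewrite le_eqVlt => /orP[/eqP -> //|st].
by apply: ltW; exact: ui.
Qed.

(** An integer shift makes the two angles agree at [b]. If the common angle is not an integer, both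
    lifts are inside the same turn and their labels agree there; if it is one, the path is at the
    wedge point and the label may change. *)
Lemma lifted_cat k c a b d w u w' u' : a <= b -> b <= d ->
  lifted k c a b w u -> lifted k c b d w' u' -> exists w'' u'', lifted k c a d w'' u''.
Proof.
move=> ab bd L L'.
have E : W w (u b) = W w' (u' b).
  by case: L => _ _ _ <-; [case: L' => _ _ _ <- //|]; lra.
have [/intrP[m mE] _] := W_eq E.
have {m mE}[w2 [u2 [L2 ub]]] : exists w2 u2, lifted k c b d w2 u2 /\ u2 b = u b.
  exists (fun i => w' (i - m)), (fun t => u' t - (- m)%:~R); split.
    exact: lifted_shift.
  by move: mE; rewrite intrN; lra.
move=> {w' u' L' E}.
have E : W w (u b) = W w2 (u2 b).
  by case: L => _ _ _ <-; [case: L2 => _ _ _ <- //|]; lra.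
have [_ lab] := W_eq E.
(* Turns starting before [u b] keep the labels of the first lift; with the ceiling, an integer [u b]
   separates the two families of labels. *)
pose K := Num.ceil (u b).
have Kb : u b <= K%:~R by exact: ceil_ge.
have Kb' : K%:~R - 1 < u b by have := ceilB1_lt (u b); rewrite intrB.
exists (fun i => if i < K then w i else w2 i), (fun t => if t <= b then u t else u2 t).
have ule := lifted_le L; have ule2 := lifted_le L2.
case: L => wk ui uc cE; case: L2 => wk2 ui2 uc2 cE2; split.
- by move=> i; case: ifP.
- move=> s t as_ st td; case: (leP s b) => sb; case: (leP t b) => tb.
  + exact: ui.
  + apply: (@le_lt_trans _ _ (u b)); first by apply: ule; lra.
    by rewrite -ub; apply: ui2; lra.
  + by move: sb tb st; lra.
  + by apply: ui2; lra.
- by apply: within_glue.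
- move=> t tad; case: (leP t b) => tb.
  + rewrite cE; last lra.
    have tK : u t <= K%:~R by apply: le_trans Kb; apply: ule; lra.
    rewrite (@W_petal w (u t) (Num.floor (u t))); last by have := floor_bounds (u t); lra.
    have [E1|E1] := eqVneq (u t) K%:~R.
      by rewrite E1 petal_int (W_wedge _ _).2 // intr_int.
    rewrite /W ifT // floor_lt_int; move/eqP: E1 => E1; lra.
  + rewrite cE2; last lra.
    have bt : u2 b < u2 t by apply: ui2; lra.
    rewrite /W; case: ifP => // fK; congr petal.
    have tK : u2 t < K%:~R by rewrite -floor_lt_int.
    have fb : Num.floor (u b) = K - 1 by apply: floor_eqP; rewrite intrB; lra.
    have ft : Num.floor (u2 t) = K - 1 by apply: floor_eqP; rewrite intrB; lra.
    rewrite ft; rewrite ub fb in lab; rewrite lab //.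
    by apply: (@between_int _ (K - 1)); rewrite intrB; lra.
Qed.

Lemma lifted_petal k j c a b th : (j < k)%N ->
  {within [set s | a <= s <= b], continuous th} ->
  (forall s1 s2, a <= s1 -> s1 < s2 -> s2 <= b -> th s1 < th s2) ->
  (forall s, a <= s <= b -> c s = petal j (th s)) -> lifted k c a b (fun=> j) th.
Proof.
move=> jk thc thi cE; split=> //.
Qed.

Lemma pos_at_lifted k c t : pos_at k c t -> exists2 e, 0 < e &
  exists w u, lifted k c (t - e) (t + e) w u.
Proof.
move=> [e e0 [j1 [j2 [th1 [th2 [c1 c2 th1c th2c [i1 i2]]]]]]].
exists e => //; apply: (@lifted_cat _ _ _ t _ (fun=> j1 : nat) th1 (fun=> j2 : nat) th2); try lra.
- exact: lifted_petal.
- exact: lifted_petal.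
Qed.

Lemma lifted_segment k c a b : a <= b ->
  (forall t, a <= t <= b -> pos_at k c t) -> exists w u, lifted k c a b w u.
Proof.
move=> ab H.
pose P u v := u <= v -> exists w x, lifted k c u v w x.
suff : P a b by apply.
apply: cousin => //.
- move=> t tab; have [e e0 [w [x L]]] := pos_at_lifted (H t tab).
  exists e => // u v ut tv eu ve uv; exists w, x; apply: liftedW L; lra.
- move=> u v w uv vw Puv Pvw uw.
  have [|? [? L]] := Puv; first lra.
  have [|? [? L']] := Pvw; first lra.
  by apply: lifted_cat L L'; lra.
Qed.

Lemma lifted_unique k c a b w u w' u' : a <= b ->
  lifted k c a b w u -> lifted k c a b w' u' -> u b - u a = u' b - u' a.
Proof.
move=> ab [_ _ uc cE] [_ _ uc' cE']; apply: lift_unique => // t tab.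
by have [] := @W_eq w w' (u t) (u' t); rewrite // -cE // -cE'.
Qed.

(* A lift on an exhausted open interval is patched from the lifts on the
   segments [[a n, b n]], normalized to agree at [x0]. *)
Lemma lifted_union k c (a b : nat -> R) x0 :
  (forall n, a n <= x0 <= b n) ->
  (forall n m, (n <= m)%N -> a m <= a n /\ b n <= b m) ->
  (forall n t, a n <= t <= b n -> pos_at k c t) ->
  exists w u, forall n, lifted k c (a n) (b n) w u.
Proof.
move=> x0n nest pc.
have seg n : exists L : (int -> nat) * (R -> R), lifted k c (a n) (b n) L.1 L.2.
  have [||w [u L]] := @lifted_segment k c (a n) (b n); last by exists (w, u).
  - by have := x0n n; lra.
  - exact: pc.
have [L0 L0P] := seg 0%N.
have norm n : exists L : (int -> nat) * (R -> R), lifted k c (a n) (b n) L.1 L.2 /\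
    L.2 x0 = L0.2 x0.
  have [[w u] /= L] := seg n.
  have : W w (u x0) = W L0.1 (L0.2 x0).
    by case: L => _ _ _ <- //; case: L0P => _ _ _ <-.
  move=> /W_eq[/intrP[m mE] _].
  exists (fun i => w (i + m), fun t => u t - m%:~R) => /=; split; first exact: lifted_shift.
  by rewrite -mE; ring.
have [L LP] := choice norm.
have agree n m t : a n <= t <= b n -> a m <= t <= b m -> (L n).2 t = (L m).2 t.
  move=> tn tm; have [Ln n0] := LP n; have [Lm m0] := LP m.
  have x0n' := x0n n; have x0m' := x0n m.
  have [tx|xt] := leP t x0.
  - have h1 : lifted k c t x0 (L n).1 (L n).2 by apply: liftedW Ln; lra.
    have h2 : lifted k c t x0 (L m).1 (L m).2 by apply: liftedW Lm; lra.
    by have := lifted_unique tx h1 h2; rewrite n0 m0; lra.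
  - have h1 : lifted k c x0 t (L n).1 (L n).2 by apply: liftedW Ln; lra.
    have h2 : lifted k c x0 t (L m).1 (L m).2 by apply: liftedW Lm; lra.
    by have := lifted_unique (ltW xt) h1 h2; rewrite n0 m0; lra.
pose J t n := a n <= t <= b n.
have /choice[N NP] : forall t, exists n, forall m, J t m -> J t n.
  move=> t; have [[n tn]|nt] := pselect (exists n, J t n); first by exists n.
  by exists 0%N => m tm; case: nt; exists m.
pose u t := (L (N t)).2 t.
have uE n t : J t n -> u t = (L n).2 t.
  by move=> tn; apply: agree => //; exact: NP tn.
(* The label of a turn is taken from any segment visiting it, two choices being compared inside a
   larger segment. A turn that is never visited gets an arbitrary label below [k]. *)
have lab (i : int) : exists j, (j < k)%N /\ forall n t, J t n ->
    i%:~R < u t < i%:~R + 1 -> c t = petal j (u t).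
  have [[t0 [n0 [tn0 ti]]]|none] := pselect (exists t n, J t n /\ i%:~R < u t < i%:~R + 1).
  - exists ((L n0).1 i); split; first by have [[]] := LP n0.
    move=> n t tn tni.
    pose m := maxn n0 n.
    have sub p s : (p <= m)%N -> J s p -> J s m.
      by move=> pm; have := nest p m pm; rewrite /J; lra.
    have tm : J t m by apply: sub tn; rewrite leq_maxr.
    have t0m : J t0 m by apply: sub tn0; rewrite leq_maxl.
    have [[_ _ _ cm] _] := LP m; have [[_ _ _ cn] _] := LP n0.
    have labi : (L m).1 i = (L n0).1 i.
      have /W_eq[_ H] : W (L m).1 (u t0) = W (L n0).1 (u t0).
        by rewrite {1}(uE m) // (uE n0) // -cm // -cn.
      have fi : Num.floor (u t0) = i by apply: floor_eqP; lra.
      rewrite fi in H; apply: H; exact: between_int ti.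
    rewrite cm // -(uE m) // (@W_petal _ _ i) ?labi //; lra.
  - exists ((L 0%N).1 0); split; first by have [[]] := LP 0%N.
    by move=> n t tn ti; case: none; exists t, n.
have [w wP] := choice lab.
exists w, u => n; have [[wk ui uc cE] _] := LP n; split.
- by move=> i; have [] := wP i.
- by move=> s t as_ st tb; rewrite !(uE n) /J; [exact: ui| |]; lra.
- by apply: within_itv_eq uc => t tn; rewrite (uE n).
- move=> t tn; have fb := floor_bounds (u t).
  have [tI|tI] := eqVneq (u t) (Num.floor (u t))%:~R.
    rewrite cE // -(uE n) // /W; rewrite tI; by rewrite !petal_int.
  by apply: (wP (Num.floor (u t))).2 tn _; move/eqP: tI => tI; lra.
Qed.

Lemma pos_at_lift k c : (forall t, pos_at k c t) -> exists w u,
  [/\ (forall i, (w i < k)%N), (forall s t, s < t -> u s < u t), continuous u &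
      (forall t, c t = W w (u t))].
Proof.
move=> pc.
have [||//|w [u L]] := @lifted_union k c (fun n => - n%:R) (fun n => n%:R) 0.
- by move=> n; rewrite oppr_le0 ler0n.
- by move=> n m nm; rewrite lerN2 !ler_nat.
have big (s t : R) : exists n : nat, - n%:R < s < n%:R /\ - n%:R < t < n%:R.
  exists (Num.bound (`|s| + `|t|)).
  have := archi_boundP (addr_ge0 (normr_ge0 s) (normr_ge0 t)).
  set n := Num.bound _; move=> H.
  have := ler_norm s; have := ler_norm t; have := ler_norm (- s); have := ler_norm (- t).
  by rewrite !normrN; have := normr_ge0 s; have := normr_ge0 t; lra.
exists w, u; split.
- by have [] := L 0%N.
- move=> s t st; have [n nP] := big s t; have [_ + _ _] := L n; apply; lra.
- apply/continuousRP => x e e0; have [n nP] := big x x; have [_ _ /withinRP uc _] := L n.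
  have [|d d0 dH] := uc x _ e e0; first by rewrite /= in_itv/=; lra.
  exists (Num.min d (Num.min (x + n%:R) (n%:R - x))).
    by rewrite !lt_min; apply/andP; split=> //; apply/andP; split; lra.
  move=> y; rewrite !lt_min => /andP[yd yn]; rewrite !ltr_norml in yn.
  have ynn : `[- n%:R, n%:R]%classic y by rewrite /= in_itv/=; lra.
  exact: dH.
- by move=> t; have [n nP] := big t t; have [_ _ _] := L n; apply; lra.
Qed.

(** * Maps of wedges spelling words *)

Definition nthw (s : seq nat) (i : int) : nat := nth 0%N s `|i|%N.

Definition substw (u : nat -> seq nat) (s : seq nat) : seq nat := flatten (map u s).

Definition segw (w : int -> nat) (m : int) (n : nat) : seq nat :=
  mkseq (fun i => w (m + i%:Z)) n.

Lemma nthw_lt k s i : (0 < k)%N -> all (ltn^~ k) s -> (nthw s i < k)%N.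
Proof.
move=> k0 /allP sk; rewrite /nthw; have [h|h] := leqP (size s) `|i|%N.
  by rewrite nth_default.
by apply: sk; exact: mem_nth.
Qed.

Lemma all_lt_gt0 k (s : seq nat) : s <> [::] -> all (ltn^~ k) s -> (0 < k)%N.
Proof. by case: s => //= j s _ /andP[/(leq_trans _) -> //]. Qed.

Lemma floor_nat (r : R) (n : nat) : 0 <= r < n%:R -> exists2 i : nat,
  (i < n)%N & Num.floor r = i.
Proof.
move=> /andP[r0 rn]; exists `|Num.floor r|%N; last by rewrite gez0_abs // floor_ge0.
have : (Num.floor r < n)%R by rewrite floor_lt_int.
have : (0 <= Num.floor r)%R by rewrite floor_ge0.
by lia.
Qed.

Lemma W_ext (w w' : int -> nat) (r : R) (n : nat) : 0 <= r <= n%:R ->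
  (forall i : nat, (i < n)%N -> w i = w' i) -> W w r = W w' r.
Proof.
move=> rn ww; have [->|rN] := eqVneq r n%:R.
  by rewrite /W !(petal_int _ n).
have [|i inn fi] := @floor_nat r n; first by move/eqP: rN; lra.
by rewrite /W fi ww.
Qed.

Lemma W_segw w m n (r : R) : 0 <= r <= n%:R ->
  W (nthw (segw w m n)) r = W w (r + m%:~R).
Proof.
move=> rn; rewrite W_shift; apply: W_ext rn _ => i inn.
by rewrite /nthw nth_mkseq //= addrC.
Qed.

Lemma W_catl s1 s2 (r : R) : 0 <= r <= (size s1)%:R -> W (nthw (s1 ++ s2)) r = W (nthw s1) r.
Proof. by move=> rn; apply: W_ext rn _ => i inn; rewrite /nthw nth_cat inn. Qed.

Lemma W_catr s1 s2 (r : R) : 0 <= r -> W (nthw (s1 ++ s2)) (r + (size s1)%:R) = W (nthw s2) r.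
Proof.
move=> r0; rewrite -[(size s1)%:R]/((size s1)%:~R) W_shift /W.
have [|i _ ->] := @floor_nat r (Num.bound r); first by rewrite r0 archi_boundP.
by rewrite /nthw /= nth_cat ltnNge leq_addl /= addnK.
Qed.

Lemma size_segw w m n : size (segw w m n) = n.
Proof. exact: size_mkseq. Qed.

Lemma segw_add w m n1 n2 : segw w m (n1 + n2) = segw w m n1 ++ segw w (m + n1) n2.
Proof.
rewrite /segw /mkseq iotaD map_cat; congr (_ ++ _).
rewrite add0n -{1}(addn0 n1) iotaDl -map_comp; apply: eq_map => i /=.
by rewrite PoszD addrA.
Qed.

Lemma all_segw k w m n : (forall i, (w i < k)%N) -> all (ltn^~ k) (segw w m n).
Proof. by move=> wk; apply/allP => j /mapP[i _ ->]; exact: wk. Qed.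

Lemma substw_cat u s1 s2 : substw u (s1 ++ s2) = substw u s1 ++ substw u s2.
Proof. by rewrite /substw map_cat flatten_cat. Qed.

(** Only the values of [h] on [0, 1] describe the path, but a homeomorphism of the whole line can be
    inverted, composed and shifted without tracking domains. *)
Definition rose_data (b : nat) (s : seq nat) (h : R -> R) :=
  [/\ s <> [::], all (ltn^~ b) s, ihomeo h, h 0 = 0 & h 1 = (size s)%:R].

(* [F] maps the wedge of [a] circles to the wedge of [b] circles, spelling
   the word [u j] along the [j]-th petal without ever stopping or backtracking. *)
Definition rose (a b : nat) (F : R * R -> R * R) (u : nat -> seq nat) :=
  F wedge_pt = wedge_pt /\
  forall j, (j < a)%N -> exists2 h, rose_data b (u j) h &
    forall t, 0 <= t <= 1 -> F (petal j t) = W (nthw (u j)) (h t).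

Lemma rose_data_itv b s h t : rose_data b s h -> 0 <= t <= 1 -> 0 <= h t <= (size s)%:R.
Proof.
move=> [_ _ hi h0 h1] /andP[t0 t1].
by rewrite -h1 ihomeo_le // t1 andbT -h0 ihomeo_le.
Qed.

Lemma rose_neq0 a b F u j : rose a b F u -> (j < a)%N -> u j <> [::].
Proof. by move=> [_ H] /H[h []]. Qed.

Lemma rose_all a b F u j : rose a b F u -> (j < a)%N -> all (ltn^~ b) (u j).
Proof. by move=> [_ H] /H[h []]. Qed.

Lemma all_substw a b u s : (forall j, (j < a)%N -> all (ltn^~ b) (u j)) ->
  all (ltn^~ a) s -> all (ltn^~ b) (substw u s).
Proof.
move=> ub; elim: s => //= j s IH /andP[ja sa].
by rewrite /substw /= all_cat ub // IH.
Qed.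

Lemma rose_word a b F u s : rose a b F u -> all (ltn^~ a) s -> exists h,
  [/\ ihomeo h, h 0 = 0, h (size s)%:R = (size (substw u s))%:R &
    forall t, 0 <= t <= (size s)%:R ->
      F (W (nthw s) t) = W (nthw (substw u s)) (h t)].
Proof.
move=> [F0 Fu]; elim: s => [_|j s IH /= /andP[ja sa]].
  exists id; split=> //=; first exact: ihomeo_id.
  move=> t t0; have -> : t = 0%:~R by rewrite mulr0z; lra.
  by rewrite /W !petal_int.
have [h [hi h0 h1 hF]] := IH sa; have [g gd gF] := Fu j ja.
have [_ _ gi g0 g1] := gd.
pose n := size (u j).
exists (fun t => if t <= 1 then g t else h (t - 1) + n%:R); split.
- by apply: ihomeo_glue => //; [exact: (@ihomeo_shift h (-1) n%:R)|rewrite g1 subrr h0 add0r].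
- by rewrite ifT.
- rewrite -natr1; case: ifP => s0.
    have -> : s = [::] by apply/size0nil/eqP; rewrite -leqn0 -(ler_nat R); lra.
    by rewrite /= add0r /substw /= cats0.
  by rewrite addrK h1 /substw /= size_cat natrD addrC.
- move=> t; rewrite -natr1 => ts; case: ifP => t1.
    rewrite (@W_petal _ _ 0) ?mulr0z /=; last lra.
    rewrite -[nthw (j :: s) 0]/j gF; last lra.
    by rewrite /substw /= W_catl //; apply: (rose_data_itv gd); lra.
  have := @W_catr [:: j] s (t - 1); rewrite subrK /= => -> ; last by move: t1; lra.
  have h0' : 0 <= h (t - 1) by rewrite -h0 ihomeo_le // subr_ge0; move: t1; lra.
  rewrite hF; first by rewrite /substw /= W_catr.
  by move: t1; lra.
Qed.

Lemma rose_comp a b c F G u v : rose a b F u -> rose b c G v ->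
  rose a c (G \o F) (fun j => substw v (u j)).
Proof.
move=> [F0 Fu] Gv; have [G0 _] := Gv; split=> [|j ja]; first by rewrite /= F0.
have [h hd hF] := Fu j ja; have [un ub hi h0 h1] := hd.
have [g [gi g0 g1 gG]] := rose_word Gv ub.
exists (g \o h).
  split; [| |exact: ihomeo_comp|by rewrite /= h0|by rewrite /= h1].
  - case: (u j) un ub => //= i s _ /andP[ib _]; rewrite /substw /=.
    by have := rose_neq0 Gv ib; case: (v i).
  - by apply: all_substw ub => i; exact: rose_all Gv.
by move=> t t01 /=; rewrite hF // gG //; exact: rose_data_itv hd _.
Qed.

(** The prescription is consistent: a point off the wedge point has one petal and one angle in the
    open unit interval, and both ends of every petal are sent to integer angles, hence to the wedge
    point. Outside the wedge of circles the default value is [wedge_pt]. *)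
Lemma rose_exists a b (u : nat -> seq nat) (h : nat -> R -> R) :
  (forall j, (j < a)%N -> rose_data b (u j) (h j)) ->
  exists2 F, rose a b F u &
    forall j t, (j < a)%N -> 0 <= t <= 1 -> F (petal j t) = W (nthw (u j)) (h j t).
Proof.
move=> hd.
have w01 j (t : R) : (j < a)%N -> 0 <= t <= 1 -> t \is a Num.int ->
    W (nthw (u j)) (h j t) = wedge_pt.
  move=> /hd[_ _ _ h0 h1] t01 tI; rewrite (W_wedge _ _).2 //.
  have [->|t0] := eqVneq t 0; first by rewrite h0 int_num0.
  suff -> : t = 1 by rewrite h1.
  have : 0 + 1 <= t by apply: int_lt_gap => //; move/eqP: t0; lra.
  by lra.
have : forall z, exists y, (z = wedge_pt -> y = wedge_pt) /\
    forall j t, (j < a)%N -> 0 <= t <= 1 -> z = petal j t -> y = W (nthw (u j)) (h j t).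
  move=> z; have [zw|zw] := pselect (z = wedge_pt).
    exists wedge_pt; split=> // j t ja t01; rewrite zw => /esym/petal_wedge tI.
    by rewrite w01.
  have [[j [t [ja t01 zE]]]|none] := pselect (exists j t, [/\ (j < a)%N, 0 <= t <= 1 & z = petal j t]).
    exists (W (nthw (u j)) (h j t)); split=> // j' t' ja' t01' zE'.
    have tI : t \isn't a Num.int by apply/negP => tI; apply: zw; rewrite zE; apply/petal_wedge.
    have tI' : t' \isn't a Num.int by apply/negP => tI'; apply: zw; rewrite zE'; apply/petal_wedge.
    have ne (t0 : R) : t0 \isn't a Num.int -> t0 <> 0 /\ t0 <> 1.
      by move=> N; split=> E; move: N; rewrite E ?int_num0 ?int_num1.
    have [n0 n1] := ne _ tI; have [n0' n1'] := ne _ tI'.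
    have [d] : t - t' \is a Num.int /\ (t \isn't a Num.int -> j = j').
      by apply: petal_eq; rewrite -zE -zE'.
    move=> /(_ tI) <-; suff -> : t = t' by [].
    apply/eqP; rewrite -subr_eq0; apply/negPn/negP => nz.
    have [l|l] := ltP 0 (t - t').
      by have := int_lt_gap (int_num0 _) d l; lra.
    have : t - t' < 0 by rewrite lt_neqAle nz l.
    by move=> /(int_lt_gap d (int_num0 _)); lra.
  by exists wedge_pt; split=> // j t ja t01 zE; case: none; exists j, t.
move=> /choice[F FP].
have FE j t : (j < a)%N -> 0 <= t <= 1 -> F (petal j t) = W (nthw (u j)) (h j t).
  by move=> ja t01; apply: (FP _).2.
exists F => //; split; first exact: (FP _).1.
by move=> j ja; exists (h j) => [|t]; [exact: hd|exact: FE].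
Qed.

(* A rose map [G] factors exactly through [D] as soon as its words do: the
   factor traverses [v j] at the speed imposed by [G]. *)
Lemma rose_factor a b c D d G v : rose a b D d ->
  rose c b G (fun j => substw d (v j)) ->
  (forall j, (j < c)%N -> v j <> [::] /\ all (ltn^~ a) (v j)) ->
  exists2 U, rose c a U v & forall z, Wedge c z -> D (U z) = G z.
Proof.
move=> Dd [G0 Gv] va.
have : forall j, exists h, (j < c)%N -> rose_data a (v j) h /\
    forall t, 0 <= t <= 1 -> D (W (nthw (v j)) (h t)) = G (petal j t).
  move=> j; have [jc|] := boolP (j < c)%N; last by exists id.
  have [vn va'] := va j jc.
  have [k [ki k0 k1 kD]] := rose_word Dd va'.
  have [g gd gG] := Gv j jc; have [_ _ gi g0 g1] := gd.
  have [k' [k'i kk' k'k]] := ihomeo_inv ki.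
  have hd : rose_data a (v j) (k' \o g).
    split=> //=; first exact: ihomeo_comp.
      by rewrite g0 -k0 kk'.
    by rewrite g1 -k1 kk'.
  exists (k' \o g) => _; split=> // t t01.
  by rewrite kD /=; [rewrite k'k gG|exact: (rose_data_itv hd)].
move=> /choice[h hP].
have [U Uv UE] := rose_exists (fun j jc => (hP j jc).1).
exists U => // z /WedgeP[j jc [t t01 ->]].
by rewrite UE //; [apply: (hP j jc).2|]; lra.
Qed.

Lemma rose_Wedge a b F u z : rose a b F u -> Wedge a z -> Wedge b (F z).
Proof.
move=> [_ Fu] /WedgeP[j ja [t t01 ->]]; have [h [un ub _ _ _] ->] := Fu j ja; last lra.
by apply: Wedge_petal; apply: nthw_lt => //; exact: all_lt_gt0 un ub.
Qed.

Lemma rose_id a : rose a a id (fun j => [:: j]).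
Proof.
split=> // j ja; exists id; first by split=> //=; [rewrite ja|exact: ihomeo_id].
by move=> t t01; rewrite (@W_petal _ _ 0) ?mulr0z //; lra.
Qed.

Fixpoint fcompw (u : nat -> nat -> seq nat) (n d : nat) (j : nat) : seq nat :=
  if d is d'.+1 then substw (fcompw u n d') (u (n + d')%N j) else [:: j].

Lemma rose_fcomp kk f u n d : (forall i, rose (kk i.+1) (kk i) (f i) (u i)) ->
  rose (kk (n + d)%N) (kk n) (fcomp f n d) (fcompw u n d).
Proof.
move=> fu; elim: d => [|d IH]; first by rewrite addn0; exact: rose_id.
by rewrite addnS /=; exact: rose_comp.
Qed.

Lemma fcomp_add f n d e z : fcomp f n (d + e) z = fcomp f n d (fcomp f (n + d) e z).
Proof.
by elim: e z => [|e IH] z; rewrite ?addn0 // addnS /= IH addnA.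
Qed.

(** * The word spelled by a petal under a positive map *)

Lemma cos_half (m : int) : cos (2 * pi * (m%:~R + 1/2)) = -1 :> R.
Proof.
rewrite mulrDr trigo.cosD cos_int sin_int.
have -> : 2 * pi * (1 / 2) = pi :> R by field.
by rewrite cospi; ring.
Qed.

Lemma petal_fst_ge j t : 1 - cos (2 * pi * t) <= (petal j t).1.
Proof.
have c1 := cos_le1 (2 * pi * t).
have j1 : 1 <= j.+1%:R :> R by rewrite ler1n.
rewrite /petal /=; set r : R := _%:R in j1 *; set c := cos _ in c1 *.
by have -> : r - r * c = r * (1 - c); [ring|rewrite ler_peMl ?subr_ge0].
Qed.

(* [1 - cos (2 * pi * u t)] is a lower bound for the first coordinate of a petal
   point at angle [u t], whatever the petal ([petal_fst_ge]). *)
Lemma lift_endpoint (u : R -> R) :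
  (forall s t, 0 < s -> s < t -> t < 1 -> u s < u t) ->
  (forall a b, 0 < a -> a <= b -> b < 1 -> {within `[a, b], continuous u}) ->
  (forall e, 0 < e -> exists2 d, 0 < d & forall t, 0 < t < 1 -> t < d ->
     1 - cos (2 * pi * u t) < e) ->
  exists m : int, (forall t, 0 < t < 1 -> m%:~R < u t) /\
    (forall y, m%:~R < y -> exists2 t, 0 < t < 1 & u t < y).
Proof.
move=> ui uc lim.
pose S : set R := [set y | exists2 t, 0 < t < 1 & y = u t].
have S0 : S !=set0 by exists (u (1/2)), (1/2) => //; lra.
have Slb : has_lbound S.
  have [d d0 dH] := lim 1 ltr01.
  pose t1 := Num.min (d / 2) (1/2).
  have t1P : 0 < t1 <= 1/2 /\ t1 < d.
    split; first by rewrite lt_min ge_min lexx orbT andbT; apply/andP; split; lra.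
    by rewrite gt_min; apply/orP; left; lra.
  (* A drop of 2 below [u t1] would cross a half-integer, where 1 - cos equals 2, although it is
     below 1 for times less than [d]. *)
  exists (u t1 - 2) => y [t t01 ->]; rewrite leNgt; apply/negP => ut.
  have tt1 : t < t1.
    by rewrite ltNge; apply/negP; rewrite le_eqVlt => /orP[/eqP E|lt];
      [move: ut; rewrite E|have := ui t1 t; rewrite lt]; lra.
  have fb := floor_bounds (u t1 - 1).
  set m := Num.floor _ in fb.
  have [||c ctt uc'] := @IVT_le u t t1 (m%:~R + 1/2) (ltW tt1).
  - by apply: uc; lra.
  - by lra.
  - have := dH c; rewrite uc' cos_half; lra.
have I_le t : 0 < t < 1 -> inf S <= u t by move=> t01; apply: ge_inf => //; exists t.
have I_adh e : 0 < e -> exists2 t, 0 < t < 1 & u t < inf S + e.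
  by move=> e0; have [_ [t t01 ->]] := inf_adherent e0 (conj S0 Slb); exists t.
set I := inf S in I_le I_adh.
have I_lt t : 0 < t < 1 -> I < u t.
  move=> t01; apply: (@le_lt_trans _ _ (u (t / 2))); first by apply: I_le; lra.
  by apply: ui; lra.
(* If 1 - cos were positive at the infimum, it would exceed half that value along [u] near 0, by
   continuity, against [lim]. *)
have : I \is a Num.int.
  apply: cos_eq1; apply/eqP; rewrite eq_le cos_le1 /= leNgt; apply/negP => lt.
  pose e := 1 - cos (2 * pi * I).
  have e0 : 0 < e / 2 by rewrite /e; lra.
  have [d d0 dH] := lim _ e0.
  have pi0 := pi_gt0 R.
  have [|t1 t101 ut1] := I_adh (e / 2 / (2 * pi)).
    by rewrite divr_gt0 // mulr_gt0.
  pose t := Num.min t1 (Num.min (d / 2) (1/2)).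
  have tP : 0 < t by rewrite !lt_min; apply/andP; split; [lra|apply/andP; split; lra].
  have tt1 : t <= t1 by rewrite ge_min lexx.
  have td : t < d by rewrite !gt_min; apply/orP; right; apply/orP; left; lra.
  have utt : u t <= u t1.
    by move: tt1; rewrite le_eqVlt => /orP[/eqP -> //|l]; apply/ltW/ui => //; lra.
  have := dH t; have It : I < u t by apply: I_lt; lra.
  have := cos_lip (2 * pi * u t) (2 * pi * I).
  rewrite -mulrBr [`|2 * pi * _|]ger0_norm; last by rewrite mulr_ge0 //; lra.
  have : u t - I < e / 2 / (2 * pi) by lra.
  rewrite ltr_pdivlMr; last lra.
  rewrite [_ * (2 * pi)]mulrC => h1 h2 h3.
  have : `|cos (2 * pi * u t) - cos (2 * pi * I)| < e / 2 by lra.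
  rewrite ltr_norml => /andP[_ h4].
  have : 1 - cos (2 * pi * u t) < e / 2 by apply: h3; lra.
  by rewrite /e in h4 *; lra.
move=> /intrP[m mE]; exists m; rewrite -mE; split=> // y Iy.
by have [|t t01 ut] := I_adh (y - I); [lra|exists t => //; lra].
Qed.

(** Positivity is given only for 0 < t < 1, so the path is first lifted over the open interval.
    Continuity at the wedge point then forces integer limits [m] and [- M'] of the angle at the two
    ends, and the word consists of the labels of the turns between them. *)
Lemma positive_word k' k f j : positive_map k' k f -> (j < k')%N ->
  exists s h, rose_data k s h /\
    forall t, 0 <= t <= 1 -> f (petal j t) = W (nthw s) (h t).
Proof.
move=> [fc _ _ f0 fpos] jk.
pose c t := f (petal j t).
have pc (t : R) : 0 < t < 1 -> pos_at k c t by move=> t01; case: (fpos (Ordinal jk) t t01).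
have cw (e : R) : 0 < e -> exists2 d, 0 < d & forall t : R, `|t| < d -> `|c t| < e.
  move=> e0; have w0 : Wedge k' wedge_pt by exists (Ordinal jk), 0; rewrite petal0.
  have [d d0 dH] := (within22P _ _).1 fc _ w0 e e0.
  have C0 : 0 < 2 * pi * k'%:R :> R.
    by rewrite !mulr_gt0 // ?pi_gt0 // ltr0n; exact: leq_ltn_trans jk.
  exists (d / (2 * pi * k'%:R)); first by rewrite divr_gt0.
  move=> t; rewrite ltr_pdivlMr // => td.
  rewrite -[c t]subr0 -[0]f0; apply: dH; first exact: Wedge_petal.
  rewrite -(petal0 j); apply: le_lt_trans (petal_lip _ _ jk) _.
  by rewrite subr0 mulrC.
have c1 (t : R) : c (t + 1) = c t by rewrite /c -[1]/(1%:~R) petalDint.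
pose a (n : nat) : R := n.+2%:R^-1.
have a0 n : 0 < a n <= 1/2.
  rewrite /a invr_gt0 ltr0n /=; apply: (@le_trans _ _ (2%:R^-1)); last lra.
  by rewrite lef_pV2 ?posrE ?ltr0n // ler_nat.
have [||//|w [u L]] := @lifted_union k c a (fun n => 1 - a n) (1/2).
- by move=> n; have := a0 n; lra.
- move=> n m nm; rewrite lerD2l lerN2; have : a m <= a n.
    by rewrite /a lef_pV2 ?posrE ?ltr0n // ler_nat !ltnS.
  by lra.
- by move=> n t tn; apply: pc; have := a0 n; lra.
have big (s t : R) : 0 < s -> t < 1 -> exists n, a n <= s /\ t <= 1 - a n.
  move=> s0 t1; pose d := Num.min s (1 - t).
  have d0 : 0 < d by rewrite lt_min s0; lra.
  exists (Num.bound d^-1); have : a (Num.bound d^-1) <= d.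
    rewrite /a -[leRHS]invrK lef_pV2 ?posrE ?ltr0n ?invr_gt0 //.
    apply: ltW; apply: lt_le_trans (archi_boundP _) _; first by rewrite invr_ge0 ltW.
    by rewrite ler_nat -addn2 leq_addr.
  by rewrite /d le_min => /andP[]; lra.
have ui (s t : R) : 0 < s -> s < t -> t < 1 -> u s < u t.
  move=> s0 st t1; have [n [n1 n2]] := big s t s0 t1.
  by have [_ + _ _] := L n; apply.
have uc p q : 0 < p -> p <= q -> q < 1 -> {within `[p, q], continuous u}.
  move=> p0 pq q1; have [n [n1 n2]] := big p q p0 q1.
  by have [_ _ + _] := L n; apply: within_itvW.
have cE (t : R) : 0 < t < 1 -> c t = W w (u t).
  move=> /andP[t0 t1]; have [n [n1 n2]] := big t t t0 t1.
  by have [_ _ _] := L n; apply; rewrite n1.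
have [wk _ _ _] := L 0%N.
have lim (e : R) : 0 < e -> exists2 d, 0 < d & forall t, 0 < t < 1 ->
    t < d \/ 1 - t < d -> 1 - cos (2 * pi * u t) < e.
  move=> e0; have [d d0 dH] := cw e e0; exists d => // t t01 H.
  have : `|c t| < e.
    case: H => H; first by apply: dH; rewrite gtr0_norm; lra.
    by rewrite -[t](subrK 1) c1; apply: dH; rewrite ltr0_norm; lra.
  rewrite prod_norm_lt => /andP[h _]; apply: le_lt_trans h.
  by apply: le_trans (ler_norm _); rewrite cE //; exact: petal_fst_ge.
have [|m [mlt madh]] := @lift_endpoint u ui uc.
  by move=> e /lim[d d0 dH]; exists d => // t t01 td; apply: dH => //; left.
(* The end t = 1 is treated as the end t = 0 of the reversed path, the angle being negated to stay
   increasing. *)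
have [|||M' [Mlt Madh]] := @lift_endpoint (fun t => - u (1 - t)).
- by move=> s t *; rewrite ltrN2; apply: ui; lra.
- move=> p q p0 pq q1.
  have /withinRP H : {within `[1 - q, 1 - p], continuous u} by apply: uc; lra.
  apply/withinRP => x; rewrite /= in_itv /= => xpq e e0.
  have [|d d0 dH] := H (1 - x) _ e e0; first by rewrite /= in_itv/=; lra.
  exists d => // y; rewrite /= in_itv/= => ypq yx; rewrite -opprD normrN; apply: dH.
    by rewrite /= in_itv/=; lra.
  have -> : 1 - y - (1 - x) = - (y - x) by ring.
  by rewrite normrN; exact: yx.
- move=> e /lim[d d0 dH]; exists d => // t t01 td; rewrite mulrN cosN.
  by apply: dH; [|right]; lra.
have um (t : R) : 0 < t < 1 -> m%:~R < u t < - M'%:~R.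
  move=> t01; rewrite mlt //=; have := Mlt (1 - t).
  have -> : 1 - (1 - t) = t by ring.
  by lra.
have Madh' (y : R) : y < - M'%:~R -> exists2 t, 0 < t < 1 & y < u t.
  by move=> yM; have [|t t01 ut] := Madh (- y); [lra|exists (1 - t); lra].
have [n nE] : exists n : nat, n%:R = - M'%:~R - m%:~R :> R.
  exists `|- M' - m|%N; rewrite natr_absz -intrN -intrB gtr0_norm //.
  have : m%:~R < (- M')%:~R :> R by rewrite intrN; have := um (1/2); lra.
  by rewrite ltr_int; lia.
have n0 : 0 < n%:R :> R by rewrite nE; have := um (1/2); lra.
(* Slope one outside [0, 1] extends the shifted angle to a homeomorphism of the line. *)
pose h t := if t <= 0 then t else if t < 1 then u t - m%:~R else t + (n%:R - 1).
exists (segw w m n), h; split; first split.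
- by move=> /(congr1 size); rewrite size_segw /= => n00; rewrite n00 ltxx in n0.
- exact: all_segw.
- split=> [s t st|y].
  + rewrite /h; have [s0|s0] := leP s 0; have [t0|t0] := leP t 0;
      [lra| |lra|]; have [t1|t1] := ltP t 1.
    * by have := um t; lra.
    * by lra.
    * rewrite ifT; last by lra.
      by have : u s < u t; [exact: ui|lra].
    * by have [s1|s1] := ltP s 1; [have := um s|]; lra.
  + have [y0|y0] := leP y 0; first by exists y; rewrite /h y0.
    have [yn|yn] := leP n%:R y.
      exists (y - (n%:R - 1)); rewrite /h ifF; last by apply/negbTE; lra.
      by rewrite ifF; [ring|apply/negbTE; lra].
    have [|t1 t101 ut1] := madh (y + m%:~R); first lra.
    have [|t2 t201 ut2] := Madh' (y + m%:~R); first lra.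
    have t12 : t1 <= t2.
      rewrite leNgt; apply/negP => l; have : u t2 < u t1 by apply: ui; lra.
      by lra.
    have [||z zt uz] := @IVT_le u t1 t2 (y + m%:~R) t12; [by apply: uc; lra|lra|].
    exists z; rewrite /h ifF; last by apply/negbTE; lra.
    by rewrite ifT; [rewrite uz; ring|lra].
- by rewrite /h lexx.
- by rewrite /h size_segw ler10 ltxx; ring.
- move=> t t01; rewrite /h; case: ifP => t0.
    have -> : t = 0 by lra.
    by rewrite petal0 f0 (W_wedge _ _).2 ?int_num0.
  case: ifP => t1.
    have t01' : 0 < t < 1 by move: t0 t1; lra.
    rewrite -[LHS]/(c t) cE // W_segw ?subrK //.
    by have := um t; lra.
  have -> : t = 1 by move: t1; lra.
  rewrite -[1]/(1%:~R) petal_int f0 (W_wedge _ _).2 //.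
  by rewrite rpredD ?rpredB ?rpred1 ?natr_int ?intr_int.
Qed.

Lemma positive_rose k' k f : positive_map k' k f -> exists u, rose k' k f u.
Proof.
move=> fp; have [_ _ _ f0 _] := fp.
have : forall j, exists s, (j < k')%N -> exists2 h, rose_data k s h &
    forall t, 0 <= t <= 1 -> f (petal j t) = W (nthw s) (h t).
  move=> j; have [/(positive_word fp)[s [h [hd hf]]]|_] := boolP (j < k')%N.
    by exists s => _; exists h.
  by exists [::].
by move=> /choice[u uP]; exists u; split.
Qed.

(** * Homotopies of loops in a wedge *)

Lemma finite_min (P : nat -> R -> Prop) (a : nat) :
  (forall j d d', 0 < d' -> d' <= d -> P j d -> P j d') ->
  (forall j, (j < a)%N -> exists2 d, 0 < d & P j d) ->
  exists2 d, 0 < d & forall j, (j < a)%N -> P j d.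
Proof.
move=> Pm; elim: a => [|a IH] H; first by exists 1.
have [|d d0 dH] := IH; first by move=> j ja; apply: H; exact: ltnW.
have [d' d'0 d'H] := H a (ltnSn a).
have m0 : 0 < Num.min d d' by rewrite lt_min d0.
exists (Num.min d d') => // j; rewrite ltnS leq_eqVlt => /orP[/eqP ->|ja].
  by apply: Pm d'H => //; rewrite ge_min lexx orbT.
by apply: Pm (dH j ja) => //; rewrite ge_min lexx.
Qed.

Lemma rose_letters a b F u j i : rose a b F u -> (j < a)%N -> (nthw (u j) i < b)%N.
Proof.
move=> Fu ja; have ub := rose_all Fu ja.
by apply: nthw_lt => //; apply: all_lt_gt0 ub; exact: rose_neq0 Fu ja.
Qed.

Lemma petal_cont j : continuous (petal j).
Proof. by apply: (@W_cont (fun=> j) j.+1) => i; exact: ltnSn. Qed.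

(** The angle is not a continuous function of the point at the wedge point, so the estimate is made
    in each petal, near each angle [t]: either [petal j t] is [z0] and continuity of [h] applies, or
    it is at positive distance and nearby angles give no point close to [z0]. [cousin] merges the
    angles, [finite_min] the petals. *)
Lemma rose_continuous a b F u : rose a b F u -> {within Wedge a, continuous F}.
Proof.
move=> Fu; apply/within22P => z0 z0a e e0.
pose P j d := forall t : R, 0 <= t <= 1 -> `|petal j t - z0| < d -> `|F (petal j t) - F z0| < e.
have [||d d0 dH] := @finite_min P a.
- by move=> j d d' d0 dd H t t01 tz; apply: H => //; exact: lt_le_trans dd.
- move=> j ja; have [h hd hF] := Fu.2 j ja; have [_ _ hi _ _] := hd.
  have Wc := W_cont (fun i => rose_letters i Fu ja).
  pose Q (p q : R) := exists2 d, 0 < d & forall t : R, p <= t <= q -> 0 <= t <= 1 ->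
    `|petal j t - z0| < d -> `|F (petal j t) - F z0| < e.
  have : Q 0 1.
    apply: cousin => //.
    + move=> t t01; have [tz|tz] := pselect (petal j t = z0).
        have [d1 d10 d1H] := (continuousR2P _).1 Wc (h t) e e0.
        have [d2 d20 d2H] := (continuousRP h).1 (ihomeo_continuous hi) t d1 d10.
        exists d2 => // p q pt tq tp qt; exists 1 => // s spq s01 _.
        rewrite -tz !hF //; apply/d1H/d2H; rewrite ltr_norml; lra.
      pose eta := `|petal j t - z0|.
      have eta0 : 0 < eta by rewrite normr_gt0 subr_eq0; apply/eqP.
      have [|d2 d20 d2H] := (continuousR2P (petal j)).1 (@petal_cont j) t (eta / 2); first lra.
      exists d2 => // p q pt tq tp qt; exists (eta / 2); first lra.
      move=> s spq s01 sz; exfalso.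
      have : `|petal j s - petal j t| < eta / 2 by apply: d2H; rewrite ltr_norml; lra.
      have : eta <= `|petal j s - z0| + `|petal j s - petal j t|.
        rewrite addrC (distrC (petal j s)) /eta.
        by have -> : petal j t - z0 = (petal j t - petal j s) + (petal j s - z0);
          [rewrite addrA subrK|exact: ler_normD].
      by lra.
    + move=> p q r pq qr [d d0 dH] [d' d'0 d'H]; exists (Num.min d d').
        by rewrite lt_min d0.
      move=> t tpr t01; rewrite lt_min => /andP[td td'].
      by have [tq|qt] := leP t q; [apply: dH|apply: d'H]; rewrite ?tq //; lra.
  by move=> [d d0 dH]; exists d => // t t01; apply: dH.
exists d => // _ /WedgeP[j ja [t t01 ->]] tz; apply: dH => //; lra.
Qed.

Lemma ihomeo_convex h g s : 0 <= s <= 1 -> ihomeo h -> ihomeo g ->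
  ihomeo (fun t => (1 - s) * h t + s * g t).
Proof.
move=> s01 hi gi; have mono p q : p < q -> (1 - s) * h p + s * g p < (1 - s) * h q + s * g q.
  move=> pq; have hpq := hi.1 p q pq; have gpq := gi.1 p q pq.
  have [->|s0] := eqVneq s 0; first lra.
  have s0' : 0 < s by rewrite lt_neqAle eq_sym s0; lra.
  have : 0 < s * (g q - g p) by rewrite mulr_gt0 // subr_gt0.
  have : 0 <= (1 - s) * (h q - h p) by rewrite mulr_ge0 // subr_ge0; lra.
  by lra.
split=> // y; have [a ha] := hi.2 y; have [b gb] := gi.2 y.
have cont p q : {within `[p, q], continuous (fun t => (1 - s) * h t + s * g t)}.
  have hc k c : ihomeo k -> {within `[p, q], continuous (fun t => c * k t)}.
    move=> ki; apply/within_itv => x; apply: cvgM; first exact: cvg_cst.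
    exact: ihomeo_continuous.
  by apply: withinD; exact: hc.
have [ab|ba] := leP a b.
- have gy : g a <= y by rewrite -gb ihomeo_le.
  have hy : y <= h b by rewrite -ha ihomeo_le.
  have [|c _ cE] := @IVT_le _ a b y ab (cont a b); last by exists c.
  have : 0 <= s * (y - g a) by rewrite mulr_ge0 ?subr_ge0 //; lra.
  have : 0 <= (1 - s) * (h b - y) by rewrite mulr_ge0 ?subr_ge0 //; lra.
  by rewrite ha gb; lra.
- have gy : y <= g a by rewrite -gb ihomeo_le // ltW.
  have hy : h b <= y by rewrite -ha ihomeo_le // ltW.
  have [|c _ cE] := @IVT_le _ b a y (ltW ba) (cont b a); last by exists c.
  have : 0 <= s * (g a - y) by rewrite mulr_ge0 ?subr_ge0 //; lra.
  have : 0 <= (1 - s) * (y - h b) by rewrite mulr_ge0 ?subr_ge0 //; lra.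
  by rewrite ha gb; lra.
Qed.

(* Two rose maps spelling the same words differ by a reparametrization of
   each petal, so interpolating the parameters deforms one into the other. *)
Lemma rose_homotopy a b F G u : rose a b F u -> rose a b G u ->
  exists K : R -> R * R -> R * R,
    [/\ (forall s, 0 <= s <= 1 -> rose a b (K s) u),
        (forall z, Wedge a z -> K 0 z = F z /\ K 1 z = G z) &
        exists2 C, 0 < C & forall s s' z, 0 <= s <= 1 -> 0 <= s' <= 1 -> Wedge a z ->
          `|K s z - K s' z| <= C * `|s - s'|].
Proof.
move=> Fu Gu.
have param H : rose a b H u -> exists h : nat -> R -> R, forall j, (j < a)%N ->
    rose_data b (u j) (h j) /\ forall t, 0 <= t <= 1 -> H (petal j t) = W (nthw (u j)) (h j t).
  move=> Hu; have : forall j, exists h, (j < a)%N -> rose_data b (u j) h /\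
      forall t, 0 <= t <= 1 -> H (petal j t) = W (nthw (u j)) (h t).
    by move=> j; have [/(Hu.2)[h hd hH]|] := boolP (j < a)%N; [exists h|exists id].
  by move=> /choice[h hP]; exists h.
have [h hP] := param F Fu; have [g gP] := param G Gu.
have mix s j : 0 <= s <= 1 -> (j < a)%N ->
    rose_data b (u j) (fun t => (1 - s) * h j t + s * g j t).
  move=> s01 ja; have [[un ub hi h0 h1] _] := hP j ja; have [[_ _ gi g0 g1] _] := gP j ja.
  by split=> //; [exact: ihomeo_convex|rewrite h0 g0; ring|rewrite h1 g1; ring].
have : forall s, exists K, 0 <= s <= 1 -> rose a b K u /\
    forall j t, (j < a)%N -> 0 <= t <= 1 ->
      K (petal j t) = W (nthw (u j)) ((1 - s) * h j t + s * g j t).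
  move=> s; have [s01|_] := boolP (0 <= s <= 1); last by exists id.
  have [K Ku KE] := @rose_exists a b u _ (fun j ja => mix s j s01 ja).
  by exists K.
move=> /choice[K KP]; exists K; split.
- by move=> s /KP[].
- move=> _ /WedgeP[j ja [t t01 ->]].
  have t01' : 0 <= t <= 1 by lra.
  rewrite (KP 0 _).2 ?lexx ?ler01 // (KP 1 _).2 ?lexx ?ler01 //.
  by rewrite (hP j ja).2 // (gP j ja).2 // subr0 subrr !mul0r !mul1r addr0 add0r.
- pose L : R := (\sum_(j < a) size (u j))%N%:R.
  have pi0 := pi_gt0 R.
  have b0 : 0 <= 2 * pi * b%:R :> R by rewrite !mulr_ge0 // ltW.
  exists (2 * pi * b%:R * L + 1); first by rewrite ltr_wpDl // mulr_ge0 // ler0n.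
  move=> s s' _ s01 s'01 /WedgeP[j ja [t t01 ->]].
  have t01' : 0 <= t <= 1 by lra.
  rewrite (KP s s01).2 // (KP s' s'01).2 //.
  apply: le_trans (W_lip _ _ (fun i => rose_letters i Fu ja)) _.
  have -> : (1 - s) * h j t + s * g j t - ((1 - s') * h j t + s' * g j t) =
    (s - s') * (g j t - h j t) by ring.
  have hj := rose_data_itv (hP j ja).1 t01'; have gj := rose_data_itv (gP j ja).1 t01'.
  have sL : (size (u j))%:R <= L.
    by rewrite ler_nat (bigD1 (Ordinal ja)) //= leq_addr.
  have hg : `|g j t - h j t| <= L by rewrite ler_norml; lra.
  rewrite normrM; set p := 2 * pi * b%:R in b0 *.
  have : p * (`|s - s'| * `|g j t - h j t|) <= p * (`|s - s'| * L) by rewrite !ler_wpM2l.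
  by have := normr_ge0 (s - s'); lra.
Qed.

Lemma whtp_refl k c : wloop k c -> whtp k c c.
Proof.
move=> [/withinR2P cc cW c0 c1]; exists (fun _ => c); split=> //.
- apply/within22P => -[s t] [/= s01 t01] e e0; have [d d0 dH] := cc t t01 e e0.
  exists d => // -[s' t'] [/= s'01 t'01]; rewrite prod_norm_lt /= => /andP[_ ?].
  exact: dH.
- by move=> s t _; exact: cW.
Qed.

Lemma whtp_ext k c1 c2 c1' c2' : (forall t, unit_I t -> c1 t = c1' t) ->
  (forall t, unit_I t -> c2 t = c2' t) -> whtp k c1 c2 -> whtp k c1' c2'.
Proof.
move=> e1 e2 [H [Hc HW H01 Hw]]; exists H; split=> // t t01.
by rewrite -e1 // -e2 //; exact: H01.
Qed.

Lemma rose_wloop a b F u c : rose a b F u -> wloop a c -> wloop b (F \o c).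
Proof.
move=> Fu [/withinR2P cc cW c0 c1]; have [F0 _] := Fu; split.
- apply/withinR2P => t t01 e e0.
  have [d d0 dH] := (within22P _ _).1 (rose_continuous Fu) (c t) (cW t t01) e e0.
  have [d' d'0 d'H] := cc t t01 d d0.
  by exists d' => // s s01 st; apply: dH; [exact: cW|exact: d'H].
- by move=> t t01; apply: rose_Wedge Fu _; exact: cW.
- by rewrite /= c0.
- by rewrite /= c1.
Qed.

Lemma whtp_post a b F u c1 c2 : rose a b F u -> whtp a c1 c2 ->
  whtp b (F \o c1) (F \o c2).
Proof.
move=> Fu [H [/within22P Hc HW H01 Hw]]; exists (fun s t => F (H s t)); split.
- apply/within22P => -[s t] [/= s01 t01] e e0.
  have [d d0 dH] := (within22P _ _).1 (rose_continuous Fu) (H s t) (HW s t s01 t01) e e0.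
  have [//|d' d'0 d'H] := Hc (s, t) _ d d0.
  exists d' => // -[s' t'] [/= s'01 t'01] st'; apply: dH; first exact: HW.
  by apply: (d'H (s', t')).
- by move=> s t s01 t01; apply: rose_Wedge Fu _; exact: HW.
- by move=> t t01 /=; have [-> ->] := H01 t t01.
- by move=> s s01; have [-> ->] := Hw s s01; rewrite Fu.1.
Qed.

(** Joint continuity of the homotopy combines continuity of each [K s] on the wedge with the
    Lipschitz bound in [s], uniform over the wedge. *)
Lemma whtp_rose a b F G u c : rose a b F u -> rose a b G u -> wloop a c ->
  whtp b (F \o c) (G \o c).
Proof.
move=> Fu Gu [/withinR2P cc cW c0 c1].
have [K [Ku KE [C C0 KC]]] := rose_homotopy Fu Gu.
exists (fun s t => K s (c t)); split.
- apply/within22P => -[s t] [/= s01 t01] e e0.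
  have e20 : 0 < e / 2 by lra.
  have [d d0 dH] := (within22P _ _).1 (rose_continuous (Ku s s01)) (c t) (cW t t01) _ e20.
  have [d' d'0 d'H] := cc t t01 d d0.
  exists (Num.min d' (e / 2 / C)); first by rewrite lt_min d'0 divr_gt0.
  move=> [s' t'] [/= s'01 t'01]; rewrite prod_norm_lt /= !lt_min.
  move=> /andP[/andP[_ h1] /andP[h2 _]].
  have -> : K s' (c t') - K s (c t) = (K s' (c t') - K s (c t')) + (K s (c t') - K s (c t)).
    by rewrite addrA subrK.
  have k1 := KC s' s (c t') s'01 s01 (cW t' t'01).
  have k2 : `|K s (c t') - K s (c t)| < e / 2 by apply: dH; [exact: cW|exact: d'H].
  rewrite ltr_pdivlMr // mulrC in h1.
  by apply: le_lt_trans (ler_normD _ _) _; lra.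
- by move=> s t s01 t01; apply: rose_Wedge (Ku s s01) _; exact: cW.
- by move=> t t01; exact: KE (cW t t01).
- by move=> s s01; rewrite c0 c1 (Ku s s01).1.
Qed.

(** * Word loops and positive homomorphisms *)

Lemma wgen_wloop k j : (j < k)%N -> wloop k (wgen j).
Proof.
move=> jk; split.
- by apply: continuous_subspaceT; exact: petal_cont.
- by move=> t _; exact: Wedge_petal.
- exact: petal0.
- by rewrite /wgen -[1]/(1%:~R) petal_int.
Qed.

(** A path spelling a word is the image of the generator of a one-circle wedge under a rose map, so
    this is an instance of [whtp_rose]. *)
Lemma whtp_word b s h h' c c' : rose_data b s h -> rose_data b s h' ->
  (forall t, unit_I t -> c t = W (nthw s) (h t)) ->
  (forall t, unit_I t -> c' t = W (nthw s) (h' t)) -> whtp b c c'.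
Proof.
move=> hd hd' cE cE'.
have [F Fu FE] := @rose_exists 1 b (fun=> s) (fun=> h) (fun _ _ => hd).
have [G Gu GE] := @rose_exists 1 b (fun=> s) (fun=> h') (fun _ _ => hd').
apply: whtp_ext (whtp_rose Fu Gu (wgen_wloop (ltnSn 0))) => t t01 /=.
- by rewrite cE // FE.
- by rewrite cE' // GE.
Qed.

Lemma word_loop_data b j s : (j < b)%N -> all (ltn^~ b) s ->
  exists2 h, rose_data b (j :: s) h &
    forall t, 0 <= t <= 1 -> word_loop j s t = W (nthw (j :: s)) (h t).
Proof.
elim: s j => [|i s IH] j jb /= => [_|/andP[ib sb]].
  exists id; first by split=> //=; [rewrite jb|exact: ihomeo_id].
  by move=> t t01; rewrite (@W_petal _ _ 0) ?mulr0z //; lra.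
have [h [hn hb hi h0 h1] hE] := IH i ib sb.
exists (fun t => if t <= 2^-1 then 2 * t + 0 else h (2 * t + (-1)) + 1).
  split=> //.
  - by rewrite /= jb ib.
  - apply: ihomeo_glue.
    + by apply: ihomeo_affine; lra.
    + have -> : (fun t => h (2 * t + -1) + 1) = (fun t => h (t + 0) + 1) \o (fun t => 2 * t + -1).
        by apply/funext => t /=; rewrite addr0.
      by apply: ihomeo_comp; [exact: ihomeo_shift|apply: ihomeo_affine; lra].
    + have -> : 2 * 2^-1 + -1 = 0 :> R by field.
      by rewrite h0; field.
  - by rewrite ifT; [ring|lra].
  - rewrite ifF; last by apply/negbTE; lra.
    by have -> : 2 * 1 + -1 = 1 :> R by [ring]; rewrite h1 natr1.
move=> t t01; rewrite /= /lconcat; case: ifP => t2.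
  by rewrite (@W_petal _ _ 0) ?mulr0z ?addr0 //; lra.
rewrite hE; last by move: t2; lra.
rewrite -(@W_catr [:: j] (i :: s)) //.
by rewrite -h0 ihomeo_le //; move: t2; lra.
Qed.

Lemma word_loop_wloop b j s : (j < b)%N -> all (ltn^~ b) s -> wloop b (word_loop j s).
Proof.
move=> jb sb; have [h hd hE] := word_loop_data jb sb.
have [F Fu FE] := @rose_exists 1 b (fun=> j :: s) (fun=> h) (fun _ _ => hd).
have [Fc FW F0 F1] := rose_wloop Fu (wgen_wloop (ltnSn 0)).
have E t : unit_I t -> (F \o wgen 0) t = word_loop j s t by move=> t01; rewrite /= FE // hE.
have u0 : unit_I 0 by rewrite /unit_I /= lexx ler01.
have u1 : unit_I 1 by rewrite /unit_I /= lexx ler01.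
split; rewrite -?E //; last by move=> t t01; rewrite -E //; exact: FW.
apply: subspace_eq_continuous Fc => t; rewrite inE; exact: E.
Qed.

Lemma whtp_trans k c1 c2 c3 : whtp k c1 c2 -> whtp k c2 c3 -> whtp k c1 c3.
Proof.
move=> [H [Hc HW H01 Hw]] [H' [Hc' HW' H01' Hw']].
have h1 (s : R) : unit_I s -> s <= 2^-1 -> unit_I (2 * s) by rewrite /unit_I /=; lra.
have h2 (s : R) : unit_I s -> 2^-1 <= s -> unit_I (2 * s - 1) by rewrite /unit_I /=; lra.
exists (fun s t => if s <= 2^-1 then H (2 * s) t else H' (2 * s - 1) t); split.
- apply/within22P => -[s t] [/= s01 t01] e e0.
  have e20 : 0 < e / 2 by lra.
  have loc1 : s <= 2^-1 -> exists2 d, 0 < d & forall s' t', unit_I s' -> unit_I t' ->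
      s' <= 2^-1 -> `|s' - s| < d -> `|t' - t| < d -> `|H (2 * s') t' - H (2 * s) t| < e.
    move=> s2; have [//|d d0 dH] := (within22P _ _).1 Hc (2 * s, t) _ e e0.
      by split=> //=; exact: h1.
    exists (d / 2); first lra.
    move=> s' t' s'01 t'01 s'2 ss tt.
    apply: (dH (2 * s', t')); first by split=> //=; exact: h1.
    by rewrite prod_norm_lt /= -mulrBr normrM gtr0_norm //; apply/andP; split; lra.
  have loc2 : 2^-1 <= s -> exists2 d, 0 < d & forall s' t', unit_I s' -> unit_I t' ->
      2^-1 <= s' -> `|s' - s| < d -> `|t' - t| < d -> `|H' (2 * s' - 1) t' - H' (2 * s - 1) t| < e.
    move=> s2; have [//|d d0 dH] := (within22P _ _).1 Hc' (2 * s - 1, t) _ e e0.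
      by split=> //=; exact: h2.
    exists (d / 2); first lra.
    move=> s' t' s'01 t'01 s'2 ss tt.
    apply: (dH (2 * s' - 1, t')); first by split=> //=; exact: h2.
    have -> : (2 * s' - 1, t') - (2 * s - 1, t) = (2 * (s' - s), t' - t).
      by congr pair; rewrite /=; ring.
    by rewrite prod_norm_lt /= normrM gtr0_norm //; apply/andP; split; lra.
  have mid : H 1 t = H' 0 t by rewrite (H01 t t01).2 (H01' t t01).1.
  have [s2|s2|s2] := ltgtP s 2^-1.
  + have [|d d0 dH] := loc1; first exact: ltW.
    exists (Num.min d (2^-1 - s)); first by rewrite lt_min d0; lra.
    move=> [s' t'] [/= s'01 t'01]; rewrite prod_norm_lt /= !lt_min.
    move=> /andP[/andP[k1 k2] /andP[k3 _]].
    have s'2 : s' <= 2^-1 by move: k2; rewrite ltr_norml; lra.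
    by rewrite s'2; exact: dH.
  + have [|d d0 dH] := loc2; first exact: ltW.
    exists (Num.min d (s - 2^-1)); first by rewrite lt_min d0; lra.
    move=> [s' t'] [/= s'01 t'01]; rewrite prod_norm_lt /= !lt_min.
    move=> /andP[/andP[k1 k2] /andP[k3 _]].
    have s'2 : 2^-1 < s' by move: k2; rewrite ltr_norml; lra.
    by rewrite leNgt s'2 /=; apply: dH => //; exact: ltW.
  + have [|d d0 dH] := loc1; first by rewrite s2.
    have [|d' d'0 d'H] := loc2; first by rewrite s2.
    exists (Num.min d d'); first by rewrite lt_min d0.
    move=> [s' t'] [/= s'01 t'01]; rewrite prod_norm_lt /= !lt_min.
    move=> /andP[/andP[k1 k2] /andP[k3 k4]].
    case: (leP s' 2^-1) => s'2; first exact: dH.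
    have -> : H (2 * s) t = H' (2 * s - 1) t.
      have -> : 2 * s = 1 by rewrite s2; field.
      by rewrite subrr mid.
    by apply: d'H => //; exact: ltW.
- by move=> s t s01 t01; case: ifP => s2; [apply: HW => //; exact: h1|
    apply: HW' => //; apply: h2 => //; apply/ltW; rewrite ltNge s2].
- move=> t t01; split.
  + by rewrite ifT ?mulr0; [exact: (H01 t t01).1|lra].
  + rewrite ifF; last by apply/negbTE; lra.
    have -> : 2 * 1 - 1 = 1 :> R by ring.
    exact: (H01' t t01).2.
- by move=> s s01; case: ifP => s2; [apply: Hw; exact: h1|
    apply: Hw'; apply: h2 => //; apply/ltW; rewrite ltNge s2].
Qed.

Lemma lconcat_wloop k c1 c2 : wloop k c1 -> wloop k c2 -> wloop k (lconcat c1 c2).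
Proof.
move=> [/withinR2P cc1 W1 c10 c11] [/withinR2P cc2 W2 c20 c21]; split.
- apply: (@within_glue _ (fun t => c1 (2 * t)) (fun t => c2 (2 * t - 1)) 0 2^-1 1).
  + lra.
  + lra.
  + apply/withinR2P => t; rewrite /= in_itv /= => t01 e e0.
    have [|d d0 dH] := cc1 (2 * t) _ e e0; first by rewrite /unit_I /=; lra.
    exists (d / 2); first lra.
    move=> s; rewrite /= in_itv /= => s01 st; apply: dH.
      by rewrite /unit_I /=; lra.
    by rewrite -mulrBr normrM gtr0_norm //; lra.
  + apply/withinR2P => t; rewrite /= in_itv /= => t01 e e0.
    have [|d d0 dH] := cc2 (2 * t - 1) _ e e0; first by rewrite /unit_I /=; lra.
    exists (d / 2); first lra.
    move=> s; rewrite /= in_itv /= => s01 st; apply: dH.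
      by rewrite /unit_I /=; lra.
    have -> : 2 * s - 1 - (2 * t - 1) = 2 * (s - t) by ring.
    by rewrite normrM gtr0_norm //; lra.
  + by rewrite divff // c11 subrr c20.
- move=> t; rewrite /unit_I /= => t01; rewrite /lconcat; case: ifP => t2.
    by apply: W1; rewrite /unit_I /=; lra.
  by apply: W2; rewrite /unit_I /=; move: t2; lra.
- by rewrite /lconcat ifT ?mulr0 //; lra.
- rewrite /lconcat ifF; last by apply/negbTE; lra.
  have -> : 2 * 1 - 1 = 1 :> R by ring.
  exact: c21.
Qed.

Lemma rose_spell a b F u s h c : rose a b F u -> rose_data a s h ->
  (forall t, unit_I t -> c t = W (nthw s) (h t)) ->
  exists2 h', rose_data b (substw u s) h' &
    forall t, unit_I t -> F (c t) = W (nthw (substw u s)) (h' t).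
Proof.
move=> Fu hd cE; have [sn sa hi h0 h1] := hd.
have [g [gi g0 g1 gF]] := rose_word Fu sa.
exists (g \o h).
  split; [| |exact: ihomeo_comp|by rewrite /= h0|by rewrite /= h1].
  - case: s sn sa {hd h1 cE g1 gF} => //= i s _ /andP[ia _]; rewrite /substw /=.
    by have := rose_neq0 Fu ia; case: (u i).
  - by apply: all_substw sa => i; exact: rose_all Fu.
by move=> t t01 /=; rewrite cE // gF //; exact: rose_data_itv hd _.
Qed.

Lemma all_ord b s : all (ltn^~ b) s -> exists s' : seq 'I_b, [seq nat_of_ord i | i <- s'] = s.
Proof.
elim: s => [_|i s IH /= /andP[ib /IH[s' <-]]]; first by exists [::].
by exists (Ordinal ib :: s').
Qed.

Lemma all_ord_map b (s : seq 'I_b) : all (ltn^~ b) [seq nat_of_ord i | i <- s].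
Proof. by apply/allP => _ /mapP[i _ ->]; exact: ltn_ord. Qed.

Lemma rose_pos_hom a b F u : rose a b F u -> is_pos_hom a b (fun c => F \o c).
Proof.
move=> Fu; split; first split.
- by move=> c; exact: rose_wloop Fu.
- by move=> c1 c2 _ _; exact: whtp_post Fu.
- move=> c1 c2 l1 l2.
  have := whtp_refl (rose_wloop Fu (lconcat_wloop l1 l2)); apply: whtp_ext => //.
  by move=> t _; rewrite /lconcat /=; case: ifP.
- move=> c _ [j [s cjs]].
  have [h hd hE] := word_loop_data (ltn_ord j) (all_ord_map s).
  have [h' hd' hE'] := rose_spell Fu hd hE.
  case E : (substw u (nat_of_ord j :: [seq nat_of_ord i | i <- s])) hd' hE' => [|i s'] hd' hE'.
    by have [] := hd'.
  have [_ /= /andP[ib sb] _ _ _] := hd'.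
  have [s'' sE] := all_ord sb.
  exists (Ordinal ib), s''; rewrite sE /=.
  apply: whtp_trans (whtp_post Fu cjs) _.
  have [g gd gE] := word_loop_data ib sb.
  exact: whtp_word hd' gd hE' gE.
Qed.

(* [d k j] and [u k j] are the words of the images of the [j]-th generators under
   the homomorphisms [d k] and [u k] of [Pi_isomorphic]. *)
Definition word_iso (kx : nat -> nat) (f : nat -> R * R -> R * R)
    (ky : nat -> nat) (g : nat -> R * R -> R * R)
    (m n : nat -> nat) (d u : nat -> nat -> seq nat) :=
  [/\ (forall k, (m k < m k.+1)%N) /\ (forall k, (n k < n k.+1)%N),
      (forall k j, (j < kx (m k))%N -> d k j <> [::] /\ all (ltn^~ (ky (n k))) (d k j)),
      (forall k j, (j < ky (n k.+1))%N -> u k j <> [::] /\ all (ltn^~ (kx (m k))) (u k j)),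
      (forall k, rose (kx (m k.+1)) (kx (m k)) (fcomp f (m k) (m k.+1 - m k))
         (fun j => substw (u k) (d k.+1 j))) &
      (forall k, rose (ky (n k.+1)) (ky (n k)) (fcomp g (n k) (n k.+1 - n k))
         (fun j => substw (d k) (u k j)))].

Lemma rose_words a b (u : nat -> seq nat) :
  (forall j, (j < a)%N -> u j <> [::] /\ all (ltn^~ b) (u j)) -> exists F, rose a b F u.
Proof.
move=> ub; have [|F Fu _] := @rose_exists a b u (fun j t => (size (u j))%:R * t + 0).
  move=> j /ub[un ub']; split=> //.
  - by apply: ihomeo_affine; rewrite ltr0n lt0n size_eq0; apply/eqP.
  - by rewrite mulr0 addr0.
  - by rewrite mulr1 addr0.
by exists F.
Qed.

Lemma word_iso_Pi kx f ky g m n d u : word_iso kx f ky g m n d u ->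
  Pi_isomorphic kx f ky g.
Proof.
move=> [mn db ub fE gE].
have /choice[D DP] k := rose_words (db k).
have /choice[U UP] k := rose_words (ub k).
exists m, n, (fun k c => D k \o c), (fun k c => U k \o c); split=> //.
- by move=> k; exact: rose_pos_hom (DP k).
- by move=> k; exact: rose_pos_hom (UP k).
- by move=> k c; apply: whtp_rose (rose_comp (DP k.+1) (UP k)) (fE k).
- by move=> k c; apply: whtp_rose (rose_comp (UP k) (DP k)) (gE k).
Qed.

(** * A homotopy invariant reading positive words *)

Lemma compact_unif_continuous (V U : normedModType R) (A : set V) (f : V -> U) e :
  compact A -> {within A, continuous f} -> 0 < e ->
  exists2 d, 0 < d & forall x y, A x -> A y -> `|x - y| < d -> `|f x - f y| < e.
Proof.
move=> /compact_near_coveringP cA /within_epsdelta cf e0.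
have := cA R (0^'+) (fun d x => A x -> forall y, A y -> `|x - y| < d -> `|f x - f y| < e) _.
case.
  move=> x Ax; have [|d d0 dH] := cf x Ax (e / 2); first lra.
  exists (ball x (d / 2), [set r | r < d / 2]) => /=.
    split; first by apply: nbhsx_ballx; lra.
    by apply: nbhs_right_lt; lra.
  move=> [x' r] /= [xx' rd] Ax' y Ay x'y.
  rewrite -ball_normE /= in xx'.
  have h1 : `|f x' - f x| < e / 2 by apply: dH => //; rewrite distrC; lra.
  have h2 : `|f y - f x| < e / 2.
    apply: dH => //; have -> : y - x = - (x' - y) + - (x - x').
      by rewrite !opprB addrA subrK.
    by apply: le_lt_trans (ler_normD _ _) _; rewrite !normrN; lra.
  have -> : f x' - f y = (f x' - f x) + - (f y - f x) by rewrite opprB addrA subrK.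
  by apply: le_lt_trans (ler_normD _ _) _; rewrite normrN; lra.
move=> d0 /= d00 H.
exists (d0 / 2); first lra.
move=> x y Ax Ay xy; apply: (H (d0 / 2)) => //=; last lra.
by rewrite sub0r normrN gtr0_norm; lra.
Qed.

Definition affw (b : R) (s : seq nat) (x : R) : R :=
  foldr (fun j y => b * y + j.+1%:R) x s.

Lemma affw_cat b s1 s2 x : affw b (s1 ++ s2) x = affw b s1 (affw b s2 x).
Proof. by rewrite /affw foldr_cat. Qed.

(* The value at [0] is a numeral in base [k.+1] with digits [j.+1] in [1 .. k]. *)
Lemma affw_inj (k : nat) s s' : all (ltn^~ k) s -> all (ltn^~ k) s' ->
  affw k.+1%:R s 0 = affw k.+1%:R s' 0 -> s = s'.
Proof.
pose code s := foldr (fun j y => (k.+1 * y + j.+1)%N) 0%N s.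
have codeE s0 : affw k.+1%:R s0 0 = (code s0)%:R.
  by elim: s0 => //= j s0; rewrite /affw /= => ->; rewrite natrD natrM.
rewrite !codeE => + + /eqP; rewrite eqr_nat => + + /eqP.
elim: s s' => [|j s IH] [|j' s'] //=.
- by move=> _ _ /eqP; rewrite addnS.
- by move=> _ _ /eqP; rewrite addnS.
move=> /andP[jk sk] /andP[jk' sk'] E.
have jj : j = j'.
  have : (k.+1 * code s + j.+1 = k.+1 * code s' + j'.+1 %[mod k.+1])%N by rewrite E.
  by rewrite ![(k.+1 * _)%N]mulnC !modnMDl !modn_small // => -[].
by rewrite jj; congr cons; apply: IH => //; move: E; rewrite jj; nia.
Qed.

(** Solving x^2 + y^2 = 2 r x for r: the radius of the circle of the wedge through [z], which is
    [j.+1] on the [j]-th petal. *)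
Definition label (z : R * R) : R := (z.1 ^+ 2 + z.2 ^+ 2) / (2 * z.1).

(* The contribution of a short jump from [z] to [z']: the affine map of the
   letter [j] when the midpoint of the [j]-th petal is crossed forwards, its
   inverse when it is crossed backwards. *)
Definition jump (b : R) (z z' : R * R) (x : R) : R :=
  if 1/2 <= z.1 then
    if (0 < z.2) && (z'.2 <= 0) then b * x + label z else
    if (z.2 <= 0) && (0 < z'.2) then (x - label z') / b else x
  else x.

Definition near8 (z z' : R * R) := `|z - z'| < 1/8.

Lemma petal_circle j t (z := petal j t) : z.1 * (2 * j.+1%:R - z.1) = z.2 ^+ 2 /\ 0 <= z.1.
Proof.
rewrite /z /petal /=; set r : R := _%:R; have := cos2Dsin2 (2 * pi * t).
have c1 := cos_le1 (2 * pi * t); have r0 : 0 <= r by rewrite ler0n.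
set c := cos _ in c1 *; set d := sin _ => E; split.
  have -> : (r * d) ^+ 2 = r ^+ 2 * (d ^+ 2) by ring.
  by have -> : d ^+ 2 = 1 - c ^+ 2; [lra|ring].
have -> : r - r * c = r * (1 - c) by ring.
by rewrite mulr_ge0 // subr_ge0.
Qed.

Lemma label_petal j t : 0 < (petal j t).1 -> label (petal j t) = j.+1%:R.
Proof.
have [E _] := petal_circle j t; rewrite /label -E; set x := (petal j t).1 => x0.
by field; rewrite gt_eqF.
Qed.

(** On the circle of radius r, x (2 r - x) = y^2 < 1/64. Hence x >= 1/4 forces 2 r - x to be below
    1/16: a point close to the axis is close either to the wedge point or to the midpoint of its
    petal. *)
Lemma wedge_label k z : Wedge k z -> exists2 r : nat, 0 < z.1 -> label z = r%:R &
  `|z.2| < 1/8 -> z.1 < 1/4 \/ 2 * r%:R - 1/16 < z.1 <= 2 * r%:R /\ (0 < r)%N.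
Proof.
move=> [j [t ->]]; exists j.+1; first exact: label_petal.
have [E x0] := petal_circle j t; set x := (petal j t).1 in E x0 *.
set y := (petal j t).2 in E *; rewrite ltr_norml => y8.
have y2 : y ^+ 2 < 1/64 by nra.
have [x4|x4] := ltP x (1/4); [by left|right]; split=> //.
have r0 : 0 <= 2 * j.+1%:R - x by rewrite -(pmulr_rge0 _ (_ : 0 < x)) ?E ?sqr_ge0 //; lra.
apply/andP; split; nra.
Qed.

Lemma natr_close (r r' : nat) (x x' : R) : 2 * r%:R - 1/16 < x <= 2 * r%:R ->
  2 * r'%:R - 1/16 < x' <= 2 * r'%:R -> -(1/8) < x - x' < 1/8 -> r = r'.
Proof.
move=> h h' xx; have : `|r%:R - r'%:R| < 1 :> R by rewrite ltr_norml; lra.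
by rewrite -(intrB R r r') -intr_norm -[1]/(1%:~R) ltr_int; clear; lia.
Qed.

Lemma small_sign_change (y1 y2 y3 : R) : -(1/8) < y1 - y2 < 1/8 ->
  -(1/8) < y2 - y3 < 1/8 -> -(1/8) < y1 - y3 < 1/8 ->
  [/\ 0 < y1, 0 < y2 & 0 < y3] \/ [/\ y1 <= 0, y2 <= 0 & y3 <= 0] \/
  [/\ `|y1| < 1/8, `|y2| < 1/8 & `|y3| < 1/8].
Proof.
move=> h12 h23 h13; rewrite !ltr_norml.
have [p1|p1] := ltP 0 y1; have [p2|p2] := ltP 0 y2; have [p3|p3] := ltP 0 y3;
  try (by left); try (by right; left); by right; right; split; lra.
Qed.

(** If the second coordinates have a common sign, no jump acts. Otherwise all three points are in
    the strip of [wedge_label]. The gap from 1/4 to 2 - 1/16 contains the threshold 1/2 and is too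
    wide for a jump shorter than 1/8, so the points are all near the wedge point, where jumps are
    trivial, or all near the same midpoint, where crossings in opposite directions cancel. *)
Lemma jump_cocycle k b z1 z2 z3 x : 0 < b -> Wedge k z1 -> Wedge k z2 -> Wedge k z3 ->
  near8 z1 z2 -> near8 z2 z3 -> near8 z1 z3 ->
  jump b z1 z2 (jump b z2 z3 x) = jump b z1 z3 x.
Proof.
move=> b0 /wedge_label[r1 l1 f1] /wedge_label[r2 l2 f2] /wedge_label[r3 l3 f3].
have b0' : b != 0 by rewrite gt_eqF.
rewrite /near8 !prod_norm_lt !ltr_norml /jump.
case: z1 z2 z3 => [x1 y1] [x2 y2] [x3 y3] /= in l1 f1 l2 f2 l3 f3 *.
move=> /andP[x12 y12] /andP[x23 y23] /andP[x13 y13].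
have [[p1 p2 p3]|[[p1 p2 p3]|[s1 s2 s3]]] := small_sign_change y12 y23 y13.
- by rewrite !(leNgt _ 0) p1 p2 p3 /=; case: ifP; case: ifP.
- by rewrite !(ltNge 0) p1 p2 p3 /=; case: ifP; case: ifP.
have ge1 (r : nat) : (0 < r)%N -> 1 <= r%:R :> R by rewrite ler1n.
have {}f1 := f1 s1; have {}f2 := f2 s2; have {}f3 := f3 s3.
clear y12 y23 y13 s1 s2 s3.
have [far|close] := leP (1/2) x1; last first.
  have -> // : (1/2 <= x2) = false.
  by apply/negbTE; rewrite -ltNge; case: f2 => [|[+ /ge1]]; clear -close x12; lra.
case: f1 => [|[g1 /ge1 h1]]; first by clear -far; lra.
case: f2 => [|[g2 /ge1 h2]]; first by clear -x12 g1 h1; lra.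
case: f3 => [|[g3 /ge1 h3]]; first by clear -x13 g1 h1; lra.
have far2 : 1/2 <= x2 by clear -g2 h2; lra.
have r12 := natr_close g1 g2 x12; have r13 := natr_close g1 g3 x13.
have {}l1 : label (x1, y1) = r1%:R by apply: l1; clear -far; lra.
have {}l2 : label (x2, y2) = r1%:R by rewrite r12; apply: l2; clear -far2; lra.
have {}l3 : label (x3, y3) = r1%:R by rewrite r13; apply: l3; clear -g3 h3; lra.
rewrite far2 l1 l2 l3; clear -b0'.
by case: (ltP 0 y1) => p1; case: (ltP 0 y2) => p2; case: (ltP 0 y3) => p3 //=; field.
Qed.

(** * Holonomy along dyadic subdivisions and its homotopy invariance *)

(** The product of the jumps over the 2^n dyadic steps of the unit interval. The first half acts
    last, as the first letter does in [affw]; recursion by halving matches the parametrization of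
    [lconcat]. *)
Fixpoint hol (b : R) (n : nat) (c : R -> R * R) (x : R) : R :=
  if n is n'.+1 then
    hol b n' (fun t => c (t / 2)) (hol b n' (fun t => c ((t + 1) / 2)) x)
  else jump b (c 0) (c 1) x.

Definition fine (n : nat) (c c' : R -> R * R) :=
  forall s t, 0 <= s <= 1 -> 0 <= t <= 1 -> `|s - t| <= 2^-1 ^+ n -> near8 (c s) (c' t).

Lemma fine_half1 n c c' : fine n.+1 c c' -> fine n (fun t => c (t / 2)) (fun t => c' (t / 2)).
Proof.
move=> H s t s01 t01 st; apply: H; [lra|lra|].
rewrite -mulrBl normrM exprS mulrC (@gtr0_norm _ (2^-1)) //; lra.
Qed.

Lemma fine_half2 n c c' : fine n.+1 c c' ->
  fine n (fun t => c ((t + 1) / 2)) (fun t => c' ((t + 1) / 2)).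
Proof.
move=> H s t s01 t01 st; apply: H; [lra|lra|].
have -> : (s + 1) / 2 - (t + 1) / 2 = 2^-1 * (s - t) by field.
by rewrite normrM exprS (@gtr0_norm _ (2^-1)) //; lra.
Qed.

Lemma hol_ext b n c c' x : (forall t, 0 <= t <= 1 -> c t = c' t) -> hol b n c x = hol b n c' x.
Proof.
elim: n c c' x => [|n IH] c c' x cc /=; first by rewrite !cc ?lexx ?ler01.
rewrite (IH (fun t => c ((t + 1) / 2)) (fun t => c' ((t + 1) / 2))) => [|t t01]; last by apply: cc; lra.
by apply: IH => t t01; apply: cc; lra.
Qed.

(** Flatness of the holonomy: over one dyadic step, both sides equal the jump along the diagonal
    from [c 0] to [c' 1], by the cocycle property on two triangles. Induction on [n] pastes the
    squares. *)
Lemma hol_strip k b n c c' x : 0 < b ->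
  (forall t, 0 <= t <= 1 -> Wedge k (c t)) -> (forall t, 0 <= t <= 1 -> Wedge k (c' t)) ->
  fine n c c -> fine n c c' -> fine n c' c' ->
  jump b (c 0) (c' 0) (hol b n c' x) = hol b n c (jump b (c 1) (c' 1) x).
Proof.
move=> b0; elim: n c c' x => [|n IH] c c' x cW cW' f11 f12 f22.
  have u0 : 0 <= (0 : R) <= 1 by rewrite lexx ler01.
  have u1 : 0 <= (1 : R) <= 1 by rewrite lexx ler01.
  have d (s t : R) : 0 <= s <= 1 -> 0 <= t <= 1 -> `|s - t| <= 2^-1 ^+ 0.
    by move=> *; rewrite expr0 ler_norml; lra.
  rewrite /= (jump_cocycle (k := k)) ?(jump_cocycle (k := k)) //;
    by [exact: cW|exact: cW'|apply: f12; auto|apply: f11; auto|apply: f22; auto].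
have E0 : (0 : R) / 2 = 0 by rewrite mul0r.
have E1 : ((1 : R) + 1) / 2 = 1 by field.
have E2 : ((0 : R) + 1) / 2 = 1 / 2 by field.
have h1 := IH (fun t => c (t / 2)) (fun t => c' (t / 2)).
have h2 := IH (fun t => c ((t + 1) / 2)) (fun t => c' ((t + 1) / 2)).
rewrite /= E0 in h1; rewrite /= E1 E2 in h2.
rewrite /= h1 ?h2 //; try exact: fine_half1; try exact: fine_half2.
all: by move=> t t01; first [apply: cW; lra|apply: cW'; lra].
Qed.

Lemma half_pow_small (d : R) : 0 < d -> exists N : nat, forall n, (N <= n)%N -> 2^-1 ^+ n < d.
Proof.
move=> d0; exists (Num.bound d^-1) => n Nn.
have h : d^-1 < n%:R.
  apply: lt_le_trans (archi_boundP _) _; first by rewrite invr_ge0 ltW.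
  by rewrite ler_nat.
have n0 : 0 < n%:R :> R by apply: lt_trans h; rewrite invr_gt0.
rewrite exprVn -[ltRHS]invrK ltf_pV2 ?posrE ?exprn_gt0 ?invr_gt0 //.
by apply: lt_trans h _; rewrite -natrX ltr_nat ltn_expl.
Qed.

(** No limit is taken: the product of jumps has to be the same for all sufficiently fine
    subdivisions. *)
Definition Hol (b : R) (c : R -> R * R) (phi : R -> R) :=
  exists N : nat, forall n, (N <= n)%N -> forall x, hol b n c x = phi x.

Lemma Hol_unique b c phi phi' x : Hol b c phi -> Hol b c phi' -> phi x = phi' x.
Proof.
move=> [N H] [N' H']; rewrite -(H (maxn N N')) ?leq_maxl //.
by rewrite H' // leq_maxr.
Qed.

Lemma jump_wedge b x : jump b wedge_pt wedge_pt x = x.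
Proof. by rewrite /jump /= ifF //; apply/negbTE; rewrite -ltNge; lra. Qed.

(** The homotopy is cut into 2^n rows, with the mesh also used for time, so one modulus of uniform
    continuity serves both directions. [hol_strip] passes from each row to the next; its end jumps
    are trivial because every row starts and ends at the wedge point. *)
Lemma Hol_whtp k b c1 c2 phi : 0 < b -> whtp k c1 c2 -> Hol b c2 phi -> Hol b c1 phi.
Proof.
move=> b0 [H [Hc HW H01 Hw]] [N2 H2].
have cI : compact (unit_I `*` unit_I : set (R^o * R^o)).
  have := @segment_compact R 0 1; have -> : `[0, 1]%classic = unit_I by [].
  by move=> cu; apply: compact_setX.
have [|d d0 dH] := @compact_unif_continuous (R^o * R^o)%type (R^o * R^o)%type _ _ (1/8) cI Hc.
  by lra.
have [N NH] := half_pow_small d0.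
exists (maxn N N2) => n; rewrite geq_max => /andP[/NH small /H2 E] x; rewrite -E.
have near s s' t t' : unit_I s -> unit_I s' -> unit_I t -> unit_I t' ->
    `|s - s'| <= 2^-1 ^+ n -> `|t - t'| <= 2^-1 ^+ n -> near8 (H s t) (H s' t').
  move=> us us' ut ut' ss tt; apply: (dH (s, t) (s', t')) => //.
  by rewrite prod_norm_lt /=; apply/andP; split; [apply: le_lt_trans ss _|apply: le_lt_trans tt _].
pose p : R := 2^-1 ^+ n.
have p0 : 0 < p by rewrite exprn_gt0.
have pn : p * (2 ^ n)%:R = 1 by rewrite natrX -exprMn mulVf // expr1n.
have row i : (i <= 2 ^ n)%N -> unit_I (p * i%:R).
  move=> i2; rewrite /unit_I /= mulr_ge0 ?ler0n // ?(ltW p0) //=.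
  have : p * i%:R <= p * (2 ^ n)%:R by rewrite ler_pM2l // ler_nat.
  by rewrite pn.
have u0 : unit_I 0 by rewrite /unit_I /= lexx ler01.
have u1 : unit_I 1 by rewrite /unit_I /= lexx ler01.
have rows i : (i <= 2 ^ n)%N -> hol b n (H 0) x = hol b n (H (p * i%:R)) x.
  elim: i => [|i IH] i2; first by rewrite mulr0.
  rewrite IH; last exact: ltnW.
  have ri := row i (ltnW i2); have ri' := row i.+1 i2.
  have dd : `|p * i%:R - p * i.+1%:R| <= 2^-1 ^+ n.
    by rewrite -mulrBr -natr1 opprD addrA subrr sub0r mulrN1 normrN gtr0_norm.
  have := @hol_strip k b n (H (p * i%:R)) (H (p * i.+1%:R)) x b0.
  rewrite !(Hw _ ri).1 !(Hw _ ri').1 !(Hw _ ri).2 !(Hw _ ri').2 !jump_wedge => -> //.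
  - by move=> t t01; exact: HW.
  - by move=> t t01; exact: HW.
  - by move=> s t s01 t01 st; apply: near => //; rewrite subrr normr0 ltW.
  - by move=> s t s01 t01 st; exact: near.
  - by move=> s t s01 t01 st; apply: near => //; rewrite subrr normr0 ltW.
have := rows (2 ^ n)%N (leqnn _); rewrite pn.
rewrite (@hol_ext _ _ (H 0) c1) ?(@hol_ext _ _ (H 1) c2) //.
  by move=> t t01; exact: (H01 t t01).2.
by move=> t t01; exact: (H01 t t01).1.
Qed.

(** * Holonomy of a lifted path *)

(** Midpoints of petals sit at half-integer angles, exactly where the nearest integer changes.
    Rounding a half up counts a midpoint as crossed once it is reached, in agreement with the sign
    conditions of [jump]. *)
Definition rnd (r : R) : int := Num.floor (r + 1/2).

(* The letters whose midpoints are crossed between the parameters [a] and [b]. *)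
Definition btw (w : int -> nat) (a b : R) : seq nat := segw w (rnd a) `|rnd b - rnd a|%N.

Lemma rnd_bounds (r : R) : (rnd r)%:~R - 1/2 <= r < (rnd r)%:~R + 1/2.
Proof. by have := floor_bounds (r + 1/2); rewrite /rnd; lra. Qed.

Lemma rnd_eq (r : R) (m : int) : m%:~R - 1/2 <= r < m%:~R + 1/2 -> rnd r = m.
Proof. by move=> H; apply: floor_eqP; lra. Qed.

Lemma rnd_le (a b : R) : a <= b -> rnd a <= rnd b.
Proof. by move=> ab; apply: le_floor; rewrite lerD2r. Qed.

Lemma rnd_int (m : int) : rnd m%:~R = m.
Proof. by apply: rnd_eq; lra. Qed.

Lemma btw_cat w a b c : a <= b -> b <= c -> btw w a c = btw w a b ++ btw w b c.
Proof.
move=> /rnd_le ab /rnd_le bc; rewrite /btw.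
have -> : `|rnd c - rnd a|%N = (`|rnd b - rnd a| + `|rnd c - rnd b|)%N by lia.
by rewrite segw_add; congr (_ ++ segw w _ _); lia.
Qed.

Lemma petal_snd_gt0 j t (m : int) : m%:~R < t < m%:~R + 1/2 -> 0 < (petal j t).2.
Proof.
move=> tm; have pi0 := pi_gt0 R; rewrite -[t](subrK m%:~R) petalDint /petal /=.
rewrite mulr_gt0 ?ltr0n //; apply: sin_gt0_pi; set s := t - _.
have s01 : 0 < s < 1/2 by rewrite /s; lra.
apply/andP; split; first by rewrite !mulr_gt0 //; lra.
have : 0 < pi * (1/2 - s) by rewrite mulr_gt0 // subr_gt0; lra.
by lra.
Qed.

Lemma petal_snd_le0 j t (m : int) : m%:~R - 1/2 <= t <= m%:~R -> (petal j t).2 <= 0.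
Proof.
move=> tm; have pi0 := pi_gt0 R; rewrite -[t](subrK m%:~R) petalDint /petal /=.
rewrite mulr_ge0_le0 ?ler0n // -oppr_ge0 -sinN; apply: sin_ge0_pi; set s := t - _.
have s01 : 0 <= - s <= 1/2 by rewrite /s; lra.
have : 0 <= pi * (1/2 - - s) by apply: mulr_ge0; lra.
have : 0 <= pi * - s by apply: mulr_ge0; lra.
by lra.
Qed.

Lemma near8_fst z z' : near8 z z' -> `|z.1 - z'.1| < 1/8.
Proof. by rewrite /near8 prod_norm_lt => /andP[]. Qed.

(** As 2 pi k >= 4, the step is shorter than 1/32 of a turn and crosses at most one midpoint. If it
    crosses none, the second coordinate can change sign only at the wedge point, where the condition
    on the first coordinate in [jump] makes the jump trivial. *)
Lemma jump_lift k b w (x0 x1 y : R) : 0 < b -> (forall i, (w i < k)%N) -> x0 <= x1 ->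
  2 * pi * k%:R * (x1 - x0) < 1/8 -> jump b (W w x0) (W w x1) y = affw b (btw w x0 x1) y.
Proof.
move=> b0 wk x01 small; have pi2 := pi_ge2 R.
have k1 : 1 <= k%:R :> R by rewrite ler1n; exact: leq_ltn_trans (wk 0).
have C4 : 4 <= 2 * pi * k%:R :> R by nra.
have small' : x1 - x0 < 1/32.
  by have : 4 * (x1 - x0) <= 2 * pi * k%:R * (x1 - x0) by [rewrite ler_wpM2r ?subr_ge0]; lra.
have lip (z : R) : x0 <= z <= x1 -> near8 (W w x0) (W w z).
  rewrite /near8 => xz; apply: le_lt_trans (W_lip _ _ wk) _; apply: le_lt_trans small.
  by rewrite ler_wpM2l //; [lra|rewrite distrC ger0_norm; lra].
have B0 := rnd_bounds x0; have B1 := rnd_bounds x1.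
have [E|NE] := eqVneq (rnd x0) (rnd x1).
  rewrite /btw E subrr /= /jump; case: ifP => // far.
  set K := rnd x1 in E B1; rewrite E in B0.
  have le0 (z : R) : K%:~R - 1/2 <= z < K%:~R + 1/2 -> z <= K%:~R -> (W w z).2 <= 0.
    move=> zK zK'; rewrite (@W_petal w z (K - 1)) ?intrB; last lra.
    by apply: (@petal_snd_le0 _ _ K); lra.
  have gt0 (z : R) : K%:~R - 1/2 <= z < K%:~R + 1/2 -> K%:~R < z -> 0 < (W w z).2.
    move=> zK zK'; rewrite (@W_petal w z K); last lra.
    by apply: (@petal_snd_gt0 _ _ K); lra.
  have [c0|c0] := leP x0 K%:~R; last first.
    have y1 : 0 < (W w x1).2 by apply: gt0 => //; lra.
    have y0 : 0 < (W w x0).2 by apply: gt0.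
    by rewrite !leNgt y0 y1.
  have y0 : (W w x0).2 <= 0 by apply: le0.
  have [c1|c1] := leP x1 K%:~R.
    have y1 : (W w x1).2 <= 0 by apply: le0.
    by rewrite !ltNge y0 y1.
  have /near8_fst : near8 (W w x0) (W w K%:~R) by apply: lip; lra.
  have -> : (W w K%:~R).1 = 0 by rewrite (W_wedge w K%:~R).2 ?intr_int.
  by rewrite subr0 ltr_norml; move: far; lra.
have rlt : rnd x0 + 1 <= rnd x1 by rewrite lezD1 lt_neqAle NE rnd_le.
set K := rnd x1 in rlt B1 NE *.
have rlt' : (rnd x0)%:~R + 1 <= K%:~R :> R by rewrite -(intrD R _ 1) ler_int.
have E0 : rnd x0 = K - 1 by apply: rnd_eq; rewrite intrB; lra.
rewrite /btw E0; have -> : absz (rnd x1 - (K - 1))%R = 1%N by rewrite -/K opprB addrCA subrr.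
rewrite /segw /= addr0 /jump.
have P0 : W w x0 = petal (w (K - 1)) x0 by apply: W_petal; rewrite intrB; lra.
have mid : W w (K%:~R - 1/2) = petal (w (K - 1)) (K%:~R - 1/2).
  by apply: W_petal; rewrite intrB; lra.
have far : 1/2 <= (W w x0).1.
  have /near8_fst : near8 (W w x0) (W w (K%:~R - 1/2)).
    by apply: lip; rewrite E0 intrB in B0; lra.
  rewrite mid ltr_norml; have := petal_fst_ge (w (K - 1)) (K%:~R - 1/2).
  have -> : K%:~R - 1/2 = (K - 1)%:~R + 1/2 :> R by rewrite intrB; field.
  by rewrite cos_half; lra.
rewrite far.
have y0 : 0 < (W w x0).2.
  by rewrite P0; apply: (@petal_snd_gt0 _ _ (K - 1)); rewrite intrB; rewrite E0 intrB in B0; lra.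
have y1 : (W w x1).2 <= 0.
  rewrite (@W_petal w x1 (K - 1)) ?intrB; last by rewrite E0 intrB in B0; lra.
  by apply: (@petal_snd_le0 _ _ K); rewrite E0 intrB in B0; lra.
rewrite y0 y1 /= P0 label_petal //; rewrite -P0; lra.
Qed.

Lemma hol_lift k b n w (u : R -> R) c x : 0 < b -> (forall i, (w i < k)%N) ->
  (forall s t, 0 <= s -> s <= t -> t <= 1 -> u s <= u t) ->
  (forall s t, 0 <= s -> s <= t -> t <= 1 -> t - s <= 2^-1 ^+ n ->
     2 * pi * k%:R * (u t - u s) < 1/8) ->
  (forall t, 0 <= t <= 1 -> c t = W w (u t)) ->
  hol b n c x = affw b (btw w (u 0) (u 1)) x.
Proof.
move=> b0 wk; elim: n u c x => [|n IH] u c x um us cE /=.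
  rewrite !cE ?lexx ?ler01 //; apply: (jump_lift _ b0 wk); first exact: um.
  by apply: us => //; rewrite expr0 subr0.
rewrite (IH (fun t => u (t / 2))) ?(IH (fun t => u ((t + 1) / 2))) /=; first last.
- by move=> t t01; apply: cE; lra.
- move=> s t s0 st t1 d; apply: us; try lra.
  by rewrite (_ : _ - _ = 2^-1 * (t - s)); [rewrite exprS ler_wpM2l|field].
- by move=> s t *; apply: um; lra.
- by move=> t t01; apply: cE; lra.
- move=> s t s0 st t1 d; apply: us; try lra.
  by rewrite (_ : _ - _ = 2^-1 * (t - s)); [rewrite exprS ler_wpM2l|field].
- by move=> s t *; apply: um; lra.
have -> : (0 : R) / 2 = 0 by rewrite mul0r.
have -> : ((1 : R) + 1) / 2 = 1 by field.
have -> : ((0 : R) + 1) / 2 = 1 / 2 by field.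
by rewrite -affw_cat -btw_cat //; apply: um; lra.
Qed.

Lemma Hol_lift k b w (u : R -> R) c : 0 < b -> (forall i, (w i < k)%N) ->
  (forall s t, 0 <= s -> s <= t -> t <= 1 -> u s <= u t) ->
  {within `[0, 1], continuous u} ->
  (forall t, 0 <= t <= 1 -> c t = W w (u t)) ->
  Hol b c (affw b (btw w (u 0) (u 1))).
Proof.
move=> b0 wk um uc cE; have pi0 := pi_gt0 R.
have k1 : 0 < k%:R :> R by rewrite ltr0n; exact: leq_ltn_trans (wk 0).
have C0 : 0 < 2 * pi * k%:R :> R by rewrite !mulr_gt0.
have [|d d0 dH] := @compact_unif_continuous R^o R^o _ u (1/8 / (2 * pi * k%:R))
    (@segment_compact R 0 1) uc.
  by rewrite divr_gt0.
have [N NH] := half_pow_small d0.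
exists N => n /NH small x; apply: (@hol_lift k) => // s t s0 st t1 ts.
rewrite mulrC -ltr_pdivlMr //; apply: le_lt_trans (ler_norm _) _.
apply: dH; rewrite /= ?in_itv /=; try lra.
by rewrite ger0_norm ?subr_ge0 //; apply: le_lt_trans ts _.
Qed.

Lemma btw_nthw s : btw (nthw s) 0 (size s)%:R = s.
Proof.
rewrite /btw -[0]/(0%:~R) -[(size s)%:R]/((size s)%:~R) !rnd_int subr0 /=.
by rewrite /segw -[RHS](mkseq_nth 0%N); apply: eq_mkseq => i; rewrite add0r.
Qed.

Lemma Hol_spell b k s h c : 0 < b -> rose_data k s h ->
  (forall t, unit_I t -> c t = W (nthw s) (h t)) -> Hol b c (affw b s).
Proof.
move=> b0 [sn sk hi h0 h1] cE.
rewrite -(btw_nthw s) -h0 -h1; apply: (@Hol_lift k) => //.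
- by move=> i; apply: nthw_lt => //; exact: all_lt_gt0 sn sk.
- by move=> s' t *; rewrite ihomeo_le.
- exact/within_itv/ihomeo_continuous.
Qed.

Lemma Hol_lconcat b k c1 c2 phi1 phi2 : wloop k c1 -> wloop k c2 ->
  Hol b c1 phi1 -> Hol b c2 phi2 -> Hol b (lconcat c1 c2) (phi1 \o phi2).
Proof.
move=> [_ _ c10 c11] [_ _ c20 c21] [N1 H1] [N2 H2]; exists (maxn N1 N2).+1 => -[//|n].
rewrite ltnS geq_max => /andP[/H1 E1 /H2 E2] x /=.
rewrite -E1 -E2; rewrite (@hol_ext _ _ (fun t => lconcat c1 c2 ((t + 1) / 2)) c2); last first.
  (* At time 1/2 [lconcat] still follows the first loop; both loops are at the wedge point there. *)
  move=> t t01; rewrite /lconcat; case: ifP => t2.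
    have -> : t = 0 by lra.
    by rewrite add0r mul1r mulfV // c11 c20.
  by congr c2; field.
apply: hol_ext => t t01; rewrite /lconcat ifT; last lra.
by congr c1; field.
Qed.

(** * From homomorphisms to words *)

Lemma hom_Hol B a b D v : is_pi1_hom a b D -> 0 < B ->
  (forall j, (j < a)%N -> Hol B (D (wgen j)) (affw B (v j))) ->
  forall j s, (j < a)%N -> all (ltn^~ a) s ->
  Hol B (D (word_loop j s)) (affw B (substw v (j :: s))).
Proof.
move=> [Dl _ Dc] B0 Dv j s; elim: s j => [|i s IH] j ja /=.
  by move=> _; rewrite /substw /= cats0; exact: Dv.
move=> /andP[ia sa].
have l1 := wgen_wloop ja; have l2 := word_loop_wloop ia sa.
apply: Hol_whtp (Dc _ _ l1 l2) _ => //.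
have := Hol_lconcat (Dl _ l1) (Dl _ l2) (Dv j ja) (IH i ia sa).
by move=> [N H]; exists N => n /H E x; rewrite E /= -affw_cat.
Qed.

Lemma rose_ext a b F u u' : rose a b F u -> (forall j, (j < a)%N -> u j = u' j) ->
  rose a b F u'.
Proof. by move=> [F0 Fu] uu; split=> // j ja; rewrite -uu //; exact: Fu. Qed.

Lemma hom_words a b D : is_pos_hom a b D -> exists v : nat -> seq nat,
  forall j, (j < a)%N -> [/\ v j <> [::], all (ltn^~ b) (v j) &
    exists i s, [/\ v j = i :: s & whtp b (D (wgen j)) (word_loop i s)]].
Proof.
move=> [_ Dp]; suff /choice[v vP] : forall j, exists w, (j < a)%N ->
    [/\ w <> [::], all (ltn^~ b) w &
    exists i s, [/\ w = i :: s & whtp b (D (wgen j)) (word_loop i s)]] by exists v.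
move=> j; have [ja|] := boolP (j < a)%N; last by exists [::].
have [|i [s ps]] := Dp _ (wgen_wloop ja).
  by exists (Ordinal ja), [::]; apply: whtp_refl; exact: wgen_wloop.
exists (nat_of_ord i :: [seq nat_of_ord i | i <- s]) => _; split=> //=.
  by rewrite ltn_ord all_ord_map.
by exists i, [seq nat_of_ord i | i <- s].
Qed.

(** The holonomy in base c + 1 of [U (D (wgen j))] is computed twice: through the homotopy with [F]
    it is that of [uF j], through the homomorphism property that of [substw u (d j)]. The numeral
    determines the word. *)
Lemma comp_words a b c D U F uF d u :
  is_pos_hom a b D -> is_pos_hom b c U -> rose a c F uF ->
  (forall l, wloop a l -> whtp c (U (D l)) (F \o l)) ->
  (forall j, (j < a)%N -> [/\ d j <> [::], all (ltn^~ b) (d j) &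
    exists i s, [/\ d j = i :: s & whtp b (D (wgen j)) (word_loop i s)]]) ->
  (forall j, (j < b)%N -> [/\ u j <> [::], all (ltn^~ c) (u j) &
    exists i s, [/\ u j = i :: s & whtp c (U (wgen j)) (word_loop i s)]]) ->
  rose a c F (fun j => substw u (d j)).
Proof.
move=> Dh Uh Fu UD dP uP; apply: rose_ext (Fu) _ => j ja.
have B0 : 0 < c.+1%:R :> R by rewrite ltr0n.
have [_ dall [i [s [dE Ds]]]] := dP j ja.
rewrite dE in dall *; have /andP[/= ib sb] := dall.
have uH l : (l < b)%N -> Hol c.+1%:R (U (wgen l)) (affw c.+1%:R (u l)).
  move=> lb; have [_ uall [i' [s' [uE Us]]]] := uP l lb.
  apply: Hol_whtp Us _ => //; rewrite uE in uall *; have /andP[/= ic sc] := uall.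
  by have [h hd hE] := word_loop_data ic sc; exact: Hol_spell hd hE.
have [h hd hE] := Fu.2 j ja.
have gl := wgen_wloop ja.
have H1 : Hol c.+1%:R (U (D (wgen j))) (affw c.+1%:R (uF j)).
  by apply: Hol_whtp (UD _ gl) _ => //; apply: Hol_spell hd _.
have [[Dl _ _] _] := Dh; have [[_ Uw _] _] := Uh.
have H2 : Hol c.+1%:R (U (D (wgen j))) (affw c.+1%:R (substw u (i :: s))).
  apply: Hol_whtp (Uw _ _ (Dl _ gl) (word_loop_wloop ib sb) Ds) _ => //.
  exact: hom_Hol Uh.1 B0 uH _ _ ib sb.
apply: (@affw_inj c); last exact: Hol_unique H1 H2.
- exact: rose_all Fu ja.
- by apply: all_substw dall => l /uP[].
Qed.

Lemma Pi_word_iso kx f ky g fw gw : 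
  (forall i, rose (kx i.+1) (kx i) (f i) (fw i)) ->
  (forall i, rose (ky i.+1) (ky i) (g i) (gw i)) ->
  Pi_isomorphic kx f ky g -> exists m n d u, word_iso kx f ky g m n d u.
Proof.
move=> fP gP [m [n [D [U [mn Dh Uh fE gE]]]]].
have /choice[d dP] k := hom_words (Dh k).
have /choice[u uP] k := hom_words (Uh k).
exists m, n, d, u; split=> //.
- by move=> k j /dP[].
- by move=> k j /uP[].
- move=> k; have := rose_fcomp (m k) (m k.+1 - m k) fP.
  rewrite subnKC; last exact: ltnW (mn.1 k).
  by move=> Fr; apply: comp_words (Dh k.+1) (Uh k) Fr (fE k) (dP k.+1) (uP k).
- move=> k; have := rose_fcomp (n k) (n k.+1 - n k) gP.
  rewrite subnKC; last exact: ltnW (mn.2 k).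
  by move=> Fr; apply: comp_words (Uh k) (Dh k) Fr (gE k) (uP k) (dP k).
Qed.

(** * Towers of wedges over a flow *)

Lemma near_continuous (X : topologicalType) (P : X -> R * R) x e :
  continuous P -> 0 < e -> \forall y \near x, `|P y - P x| < e.
Proof.
move=> cP e0; have h : nbhs x [set y | ball (P x) e (P y)] := cP x _ (nbhsx_ballx _ _ e0).
apply: (filterS _ h) => y [/= h1 h2]; rewrite prod_norm_lt /=.
by move: h1 h2; rewrite /ball /= => h1 h2; rewrite distrC h1 distrC h2.
Qed.

Lemma flow_continuous (X : topologicalType) (phi : R -> X -> X) t :
  is_flow phi -> continuous (phi t).
Proof.
move=> [_ _ fc] x U Ux; have [[A B] /= [At Bx] AB] := fc (t, x) U Ux.
have : nbhs x (phi t @^-1` U); last by [].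
apply: (filterS _ Bx) => y By; apply: (AB (t, y)); split=> //=; exact: nbhs_singleton At.
Qed.

Lemma pos_at_shift k c t : pos_at k (fun s => c (s + t)) 0 -> pos_at k c t.
Proof.
move=> [e e0 [j1 [j2 [th1 [th2 [c1 c2 /withinRP h1 /withinRP h2 [m1 m2]]]]]]].
exists e => //; exists j1, j2, (fun s => th1 (s - t)), (fun s => th2 (s - t)); split.
- by move=> s st; rewrite -c1 ?subrK //; lra.
- by move=> s st; rewrite -c2 ?subrK //; lra.
- apply/withinRP => s /= st eps eps0; have [|d d0 dH] := h1 (s - t) _ eps eps0; first by rewrite /=; lra.
  exists d => // y /= yt ys; apply: dH; first by rewrite /=; lra.
  by have -> : y - t - (s - t) = y - s by ring.
- apply/withinRP => s /= st eps eps0; have [|d d0 dH] := h2 (s - t) _ eps eps0; first by rewrite /=; lra.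
  exists d => // y /= yt ys; apply: dH; first by rewrite /=; lra.
  by have -> : y - t - (s - t) = y - s by ring.
- by split=> s1 s2 *; [apply: m1|apply: m2]; lra.
Qed.

(* By compactness every orbit moves by a definite amount within one unit of
   time, so the lifted angle of an orbit is onto. *)
Lemma orbit_lift (X : topologicalType) (phi : R -> X -> X) (P : X -> R * R) k :
  compact [set: X] -> is_flow phi -> continuous P ->
  (forall x, pos_at k (fun t => P (phi t x)) 0) ->
  forall x, exists w u, [/\ (forall i, (w i < k)%N), ihomeo u &
    (forall t, P (phi t x) = W w (u t))].
Proof.
move=> cX fl cP pos; have [phi0 phiD _] := fl.
have lift x : exists w u, [/\ (forall i, (w i < k)%N), (forall s t, s < t -> u s < u t),
    continuous u & (forall t, P (phi t x) = W w (u t))].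
  apply: (@pos_at_lift k (fun t => P (phi t x))) => t; apply: pos_at_shift.
  have -> : (fun s => P (phi (s + t) x)) = (fun s => P (phi s (phi t x))).
    by apply/funext => s; rewrite phiD.
  exact: pos.
have [eps eps0 epsH] : exists2 e, 0 < e & forall x, exists2 t, 0 <= t <= 1 &
    e <= `|P (phi t x) - P x|.
  have := (@compact_near_coveringP X setT).1 cX R (0^'+)
    (fun e x => exists2 t, 0 <= t <= 1 & e <= `|P (phi t x) - P x|) _.
  case.
    move=> x _; have [w [u [wk ui uc uE]]] := lift x.
    have [t [t0 t1 Pt]] : exists t, [/\ 0 < t, t <= 1 & P (phi t x) <> P x].
      have [d d0 dH] := (continuousRP u).1 uc 0 1 ltr01.
      exists (Num.min 1 (d / 2)); set t := Num.min _ _.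
      have t0 : 0 < t by rewrite lt_min ltr01; lra.
      have t1 : t <= 1 by rewrite ge_min lexx.
      have td : t < d by rewrite gt_min; apply/orP; right; lra.
      split=> //; rewrite -{2}(phi0 x) !uE => /W_eq[+ _]; apply/negP.
      apply: (@between_int _ 0); rewrite mulr0z add0r; have := ui 0 t t0.
      have : `|u t - u 0| < 1 by apply: dH; rewrite subr0 gtr0_norm.
      by rewrite ltr_norml; lra.
    pose eta := `|P (phi t x) - P x|.
    have eta0 : 0 < eta by rewrite normr_gt0 subr_eq0; apply/eqP.
    have eta4 : 0 < eta / 4 by lra.
    have cPt : continuous (P \o phi t).
      by move=> y; apply: continuous_comp; [exact: flow_continuous|exact: cP].
    exists ([set y | `|P y - P x| < eta / 4] `&` [set y | `|(P \o phi t) y - (P \o phi t) x| < eta / 4],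
      [set r | r < eta / 2]) => /=.
      split; last by apply: nbhs_right_lt; lra.
      by apply: filterI; exact: near_continuous.
    move=> [y r] /= [[y1 y2] r2]; exists t; first lra.
    have : eta <= `|P (phi t y) - P y| + `|P y - P x| + `|P (phi t y) - P (phi t x)|.
      rewrite /eta; have -> : P (phi t x) - P x = (P (phi t y) - P y) + (P y - P x)
          + (P (phi t x) - P (phi t y)).
        by rewrite subrKA [RHS]addrC subrKA.
      apply: le_trans (ler_normD _ _) _; rewrite (distrC (P (phi t x))) lerD2r.
      exact: ler_normD.
    by lra.
  move=> d0 /= d00 H; exists (d0 / 2); first lra.
  move=> x; apply: (H (d0 / 2)) => //=; last lra.
  by rewrite sub0r normrN gtr0_norm; lra.
move=> x; have [w [u [wk ui uc uE]]] := lift x; exists w, u; split=> //.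
have pi0 := pi_gt0 R.
have k0 : 0 < k%:R :> R by rewrite ltr0n; exact: leq_ltn_trans (wk 0).
pose C := 2 * pi * k%:R : R.
have C0 : 0 < C by rewrite !mulr_gt0.
(* The Lipschitz constant [C] of [W] turns a displacement of at least [eps] into an advance of the
   angle by at least [del] per unit of time. *)
pose del := eps / C.
have del0 : 0 < del by rewrite divr_gt0.
have adv s : u s + del <= u (s + 1).
  have [t t01 tE] := epsH (phi s x).
  have ust : u s <= u (t + s).
    by have [<-|t0] := eqVneq 0 t; [rewrite add0r|apply/ltW/ui; move/eqP: t0; lra].
  have ust1 : u (t + s) <= u (s + 1).
    by have [->|t1] := eqVneq t 1; [rewrite addrC|apply/ltW/ui; move/eqP: t1; lra].
  have : eps <= C * (u (t + s) - u s).
    apply: le_trans tE _; rewrite -phiD !uE; apply: le_trans (W_lip _ _ wk) _.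
    by rewrite ger0_norm // subr_ge0.
  by rewrite mulrC -ler_pdivrMr // -/del; lra.
have up n : u 0 + n%:R * del <= u n%:R.
  elim: n => [|n IH]; first by rewrite mul0r addr0.
  by rewrite -natr1; apply: le_trans (adv _); lra.
have dn n : u (- n%:R) <= u 0 - n%:R * del.
  elim: n => [|n IH]; first by rewrite mul0r oppr0 addr0.
  have := adv (- n.+1%:R); rewrite -natr1 (_ : - (n%:R + 1) + 1 = - n%:R); last ring.
  by lra.
have big M : exists n : nat, M < n%:R * del.
  exists (Num.bound (`|M| / del)); rewrite -ltr_pdivrMr //.
  apply: le_lt_trans (archi_boundP _); last by rewrite divr_ge0 // ltW.
  by rewrite ler_pM2r ?invr_gt0 // ler_norm.
apply: ihomeo_of_unbounded => // M.
- by have [n nP] := big (M - u 0); exists n%:R; have := up n; lra.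
- by have [n nP] := big (u 0 - M); exists (- n%:R); have := dn n; lra.
Qed.

(* The levels of an expansion, seen from a space with a flow.  If [h] is a flow
   equivalence, both [p i] and [q i \o h] are towers over the flow of [X]. *)
Record tower (X : topologicalType) (phi : R -> X -> X) (xb : X)
    (kk : nat -> nat) (f : nat -> R * R -> R * R) (P : nat -> X -> R * R) : Prop := Tower {
  tw_cont : forall i, continuous (P i);
  tw_lift : forall i x, exists w u, [/\ (forall j, (w j < kk i)%N), ihomeo u &
    (forall t, P i (phi t x) = W w (u t))];
  tw_onto : forall i z, Wedge (kk i) z -> exists x, P i x = z;
  tw_base : forall i, P i xb = wedge_pt;
  tw_comp : forall n m x, (n <= m)%N -> P n x = fcomp f n (m - n) (P m x);
  tw_inj : forall x y, (forall i, P i x = P i y) -> x = y;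
  tw_nbhs : forall x (U : set X), nbhs x U -> exists (N : nat) (e : R), 0 < e /\
    forall y, (forall i, (i <= N)%N -> `|P i y - P i x| < e) -> U y }.

Lemma expansion_rose X phi xb kk f p : @expansion X phi xb kk f p ->
  exists fw, forall i, rose (kk i.+1) (kk i) (f i) (fw i).
Proof.
move=> [fp _ _ _ _].
by have /choice[fw fwP] i := positive_rose (fp i); exists fw.
Qed.

Lemma expansion_tower X phi xb kk f p : flow_space phi -> @expansion X phi xb kk f p ->
  tower phi xb kk f p.
Proof.
move=> [cX _ _ fl _] [fp [pc [pW ponto]] ploc [pb pcomp] [pinj _ pn]]; split=> //.
- by move=> i x; exact: (orbit_lift cX fl (pc i) (fun y => (ploc i y).2) x).
- move=> n m x; rewrite leq_eqVlt => /orP[/eqP ->|]; last exact: pcomp.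
  by rewrite subnn.
- move=> x U /pn[N [e [e0 eH]]]; exists N, e; split=> // y yN; apply: eH => i iN.
  by have := yN i iN; rewrite prod_norm_lt => /andP[].
Qed.

(** * From flow equivalences to words *)

Definition oscillation (X : Type) (P Q : X -> R * R) (e : R) :=
  forall z z', P z = P z' -> `|Q z - Q z'| < e.

(** The first coordinate measures the distance from the wedge point. It is at least 2 at a midpoint,
    so the bound 1 keeps [Q] off all midpoints. *)
Definition controls (X : Type) (P Q : X -> R * R) (e : R) :=
  forall z, (P z).1 < e -> (Q z).1 < 1.

Lemma dist_wedge_fst (z : R * R) e : `|z - wedge_pt| < e -> z.1 < e.
Proof.
rewrite prod_norm_lt => /andP[+ _]; apply: le_lt_trans.
by apply: le_trans (ler_norm _); rewrite [X in _ <= X]/= subr0.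
Qed.

Lemma tower_Wedge X phi xb kk f P i x : is_flow phi ->
  @tower X phi xb kk f P -> Wedge (kk i) (P i x).
Proof.
move=> [phi0 _ _] tP; have [w [u [wk _ uE]]] := tw_lift tP i x.
by rewrite -[x]phi0 uE; exact: Wedge_petal.
Qed.

Lemma wedge_pt_of_fst k z : Wedge k z -> z.1 <= 0 -> z = wedge_pt.
Proof.
move=> [j [t ->]] z0; apply/petal_wedge/cos_eq1; have := petal_fst_ge j t.
by have := cos_le1 (2 * pi * t); lra.
Qed.

(** A neighbourhood of a point is described by levels up to some [N], and these are determined by
    [P m] once m >= N. Compactness makes [N] uniform. *)
Lemma oscillation_small (X : topologicalType) phi xb kk f P (Q : X -> R * R) e : compact [set: X] ->
  @tower X phi xb kk f P -> continuous Q -> 0 < e ->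
  exists M, forall m, (M <= m)%N -> oscillation (P m) Q e.
Proof.
move=> cX tP cQ e0.
have := (@compact_near_coveringP X setT).1 cX nat \oo
    (fun m z => forall z', P m z = P m z' -> `|Q z - Q z'| < e) _.
case.
  move=> x _; have e20 : 0 < e / 2 by lra.
  have [N [d [d0 dH]]] := tw_nbhs tP (near_continuous x cQ e20).
  exists ([set y | forall i, (i <= N)%N -> `|P i y - P i x| < d], [set m | (N <= m)%N]) => /=.
    split; last by exists N.
    elim: N {dH} => [|N IH].
      apply: filterS (near_continuous x (tw_cont tP (i := 0%N)) d0) => y yd i.
      by rewrite leqn0 => /eqP ->.
    apply: filterS (filterI IH (near_continuous x (tw_cont tP (i := N.+1)) d0)).
    move=> y [/= h1 h2] i; rewrite leq_eqVlt => /orP[/eqP -> //|]; exact: h1.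
  move=> [y m] /= [yN Nm] y' E.
  have h1 : `|Q y - Q x| < e / 2 by exact: dH.
  have h2 : `|Q y' - Q x| < e / 2.
    apply: dH => i iN; suff -> : P i y' = P i y by exact: yN.
    have im := leq_trans iN Nm.
    by rewrite (tw_comp tP _ im) (tw_comp tP y im) E.
  have -> : Q y - Q y' = (Q y - Q x) + - (Q y' - Q x) by rewrite opprB addrA subrK.
  by apply: le_lt_trans (ler_normD _ _) _; rewrite normrN; lra.
by move=> M _ H; exists M => m Mm z; exact: (H m Mm z I).
Qed.

(** Near a point where [P] is at the wedge point, the bound 1/2 on [Q] relaxes to 1; near any other
    point a small [e] makes the premise false. Compactness gives one [e], kept below 1/16 because it
    becomes an oscillation bound at the next level. *)
Lemma controls_small (X : topologicalType) (P Q : X -> R * R) k : compact [set: X] ->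
  continuous P -> continuous Q -> (forall x, Wedge k (P x)) ->
  (forall z, P z = wedge_pt -> (Q z).1 < 1/2) ->
  exists2 e, 0 < e <= 1/16 & controls P Q e.
Proof.
move=> cX cP cQ PW H.
have := (@compact_near_coveringP X setT).1 cX R (0^'+)
  (fun e z => (P z).1 < e -> (Q z).1 < 1) _.
case.
  move=> x _; have [px|px] := ltP 0 (P x).1.
    exists ([set y | `|P y - P x| < (P x).1 / 2], [set r | r < (P x).1 / 2]) => /=.
      split; first by apply: near_continuous => //; lra.
      by apply: nbhs_right_lt; lra.
    move=> [y r] /= [yx rx] yr; exfalso; move: yx.
    by rewrite prod_norm_lt ltr_norml => /andP[+ _] /=; lra.
  have Q1 := H x (wedge_pt_of_fst (PW x) px).
  exists ([set y | `|Q y - Q x| < 1/2], setT) => /=.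
    by split; [apply: near_continuous => //; lra|exact: filterT].
  move=> [y r] /= [yx _] _; move: yx.
  by rewrite prod_norm_lt ltr_norml => /andP[+ _] /=; lra.
move=> d0 /= d00 K; pose e := Num.min (1/16) (d0 / 2).
have e0 : 0 < e by rewrite lt_min; lra.
have ed : e < d0 by rewrite gt_min; apply/orP; right; lra.
exists e; first by rewrite e0 ge_min lexx.
by move=> z; apply: (K e) => //=; rewrite sub0r normrN gtr0_norm.
Qed.

(** Time steps along which each path moves by less than 1/16, together with the distance 1/16
    between the paths, stay within the 1/8 of [near8], so [hol_strip] applies. Its end jumps are
    trivial since the first path starts and ends with first coordinate below 1/2: the ends need only
    be near the wedge point. *)
Lemma close_paths k w1 u1 w2 u2 :
  (forall i, (w1 i < k)%N) -> (forall i, (w2 i < k)%N) -> ihomeo u1 -> ihomeo u2 ->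
  (forall t, 0 <= t <= 1 -> `|W w1 (u1 t) - W w2 (u2 t)| < 1/16) ->
  (W w1 (u1 0)).1 < 1/2 -> (W w1 (u1 1)).1 < 1/2 ->
  btw w1 (u1 0) (u1 1) = btw w2 (u2 0) (u2 1).
Proof.
move=> wk1 wk2 h1 h2 close s0 s1.
pose c1 t := W w1 (u1 t); pose c2 t := W w2 (u2 t).
have b0 : 0 < k.+1%:R :> R by rewrite ltr0n.
have mono u : ihomeo u -> forall s t : R, 0 <= s -> s <= t -> t <= 1 -> u s <= u t.
  by move=> ui s t *; rewrite ihomeo_le.
have [N1 H1] := @Hol_lift k _ w1 u1 c1 b0 wk1 (mono _ h1)
  (within_itv (ihomeo_continuous h1)) (fun _ _ => erefl).
have [N2 H2] := @Hol_lift k _ w2 u2 c2 b0 wk2 (mono _ h2)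
  (within_itv (ihomeo_continuous h2)) (fun _ _ => erefl).
have unif w u : (forall i, (w i < k)%N) -> ihomeo u -> exists N : nat, forall n, (N <= n)%N ->
    forall s t : R, 0 <= s <= 1 -> 0 <= t <= 1 -> `|s - t| <= 2^-1 ^+ n ->
    `|W w (u s) - W w (u t)| < 1/16.
  move=> wk ui.
  have cc : {within `[0, 1], continuous (W w \o u)}.
    apply: continuous_subspaceT => x; apply: continuous_comp; first exact: ihomeo_continuous.
    exact: W_cont wk _.
  have [|d d0 dH] := @compact_unif_continuous R^o (R^o * R^o)%type _ _ (1/16)
    (@segment_compact R 0 1) cc; first lra.
  have [N NH] := half_pow_small d0.
  exists N => n /NH nd s t s01 t01 st; apply: dH; rewrite /= ?in_itv //=.
  exact: le_lt_trans st nd.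
have [M1 K1] := unif _ _ wk1 h1; have [M2 K2] := unif _ _ wk2 h2.
pose n := maxn (maxn N1 N2) (maxn M1 M2).
have nN1 : (N1 <= n)%N by rewrite /n; lia.
have nN2 : (N2 <= n)%N by rewrite /n; lia.
have nM1 : (M1 <= n)%N by rewrite /n; lia.
have nM2 : (M2 <= n)%N by rewrite /n; lia.
apply: (@affw_inj k); [exact: all_segw|exact: all_segw|].
rewrite -(H1 n nN1) -(H2 n nN2).
have jid z z' x : z.1 < 1/2 -> jump k.+1%:R z z' x = x.
  by move=> z2; rewrite /jump leNgt z2.
have := @hol_strip k k.+1%:R n c1 c2 0 b0.
rewrite !jid // => -> //.
- by move=> t _; exact: Wedge_petal.
- by move=> t _; exact: Wedge_petal.
- by move=> s t s01 t01 st; have := K1 n nM1 s t s01 t01 st; rewrite /near8 /c1; lra.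
- move=> s t s01 t01 st; rewrite /near8 -(subrK (c1 t) (c1 s)) -addrA.
  apply: le_lt_trans (ler_normD _ _) _.
  by have := K1 n nM1 s t s01 t01 st; have := close t t01; rewrite /c1 /c2; lra.
- by move=> s t s01 t01 st; have := K2 n nM2 s t s01 t01 st; rewrite /near8 /c2; lra.
Qed.

Definition orbit_lifted (X : Type) (phi : R -> X -> X) (k : nat) (P : X -> R * R) x w u :=
  [/\ (forall i, (w i < k)%N), ihomeo u & (forall t, P (phi t x) = W w (u t))].

(* [d j] is the word read by [Q] along any passage of [P] through the [j]-th petal. *)
Definition reads (X : Type) (phi : R -> X -> X) kP (P : X -> R * R) kQ (Q : X -> R * R)
    (d : nat -> seq nat) :=
  forall x w u w' u' t0 t1 (a : int),
    orbit_lifted phi kP P x w u -> orbit_lifted phi kQ Q x w' u' ->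
    u t0 = a%:~R -> u t1 = a%:~R + 1 -> btw w' (u' t0) (u' t1) = d (w a).

Lemma ihomeo_window u (a : R) : ihomeo u -> exists g, [/\ ihomeo g, (forall s, u (g s) = a + s) &
  forall t s, u t = a + s -> g s = t].
Proof.
move=> ui; have [g [gi ug gu]] := ihomeo_inv ui; exists (fun s => g (s + a) + 0); split.
- exact: ihomeo_shift.
- by move=> s; rewrite addr0 gu addrC.
- by move=> t s E; rewrite addr0 addrC -E ug.
Qed.

Lemma reads_exists (X : Type) (phi : R -> X -> X) kP (P : X -> R * R) kQ (Q : X -> R * R) xb :
  (forall x, exists w u, orbit_lifted phi kP P x w u) ->
  (forall x, exists w u, orbit_lifted phi kQ Q x w u) ->
  P xb = wedge_pt -> Q xb = wedge_pt ->
  oscillation P Q (1/16) -> exists2 d, reads phi kP P kQ Q d & forall j, all (ltn^~ kQ) (d j).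
Proof.
move=> liftP liftQ Pb Qb osc.
pose arc j s := exists x w u w' u' t0 t1 (a : int), [/\ orbit_lifted phi kP P x w u,
  orbit_lifted phi kQ Q x w' u', u t0 = a%:~R /\ u t1 = a%:~R + 1, w a = j &
  s = btw w' (u' t0) (u' t1)].
have arc_unique j s s' : arc j s -> arc j s' -> s = s'.
  move=> [x [w [u [w' [u' [t0 [t1 [a [[wk ui uE] [wk' ui' uE'] [ut0 ut1] wa ->]]]]]]]]].
  move=> [y [v [r [v' [r' [p0 [p1 [b [[vk ri rE] [vk' ri' rE'] [rp0 rp1] vb ->]]]]]]]]].
  (* Reparametrized so that the angle of [P] advances at unit speed, the two passages have the same
     [P] at each time, hence nearly the same [Q]. *)
  have [g [gi ug gE]] := ihomeo_window a%:~R ui.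
  have [h [hi rh hE]] := ihomeo_window b%:~R ri.
  have g0 : g 0 = t0 by apply: gE; rewrite addr0.
  have g1 : g 1 = t1 by apply: gE.
  have h0 : h 0 = p0 by apply: hE; rewrite addr0.
  have h1 : h 1 = p1 by apply: hE.
  have small t : 0 <= t <= 1 -> P (phi (g t) x) = P (phi (h t) y).
    move=> t01; rewrite uE rE ug rh (@W_petal _ _ a); last lra.
    rewrite (@W_petal v _ b); last lra.
    by rewrite wa vb ![_ + t]addrC !petalDint.
  have far t : P (phi t x) = wedge_pt -> (W w' (u' t)).1 < 1/2.
    by rewrite -Pb => /osc; rewrite Qb uE' => /dist_wedge_fst; lra.
  rewrite -g0 -g1 -h0 -h1.
  apply: (@close_paths kQ w' (u' \o g) v' (r' \o h)) => //.
  - exact: ihomeo_comp.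
  - exact: ihomeo_comp.
  - by move=> t t01 /=; rewrite -uE' -rE'; apply: osc; exact: small.
  - by apply: far; rewrite uE /= ug addr0 (W_wedge _ _).2 ?intr_int.
  - by apply: far; rewrite uE /= ug (W_wedge _ _).2 // rpredD ?intr_int ?rpred1.
have /choice[d dP] : forall j, exists s, (forall s', arc j s' -> s' = s) /\ all (ltn^~ kQ) s.
  move=> j; have [[s sj]|none] := pselect (exists s, arc j s).
    exists s; split; first by move=> s' s'j; exact: arc_unique s'j sj.
    by case: sj => x [w [u [w' [u' [t0 [t1 [a [_ [wk' _ _] _ _ ->]]]]]]]]; exact: all_segw.
  by exists [::]; split=> // s sj; case: none; exists s.
exists d; last by move=> j; exact: (dP j).2.
move=> x w u w' u' t0 t1 a L L' e0 e1; apply: (dP (w a)).1.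
by exists x, w, u, w', u', t0, t1, a.
Qed.

(** The first coordinate is the radius times 1 - cos, which grows with the distance of the angle to
    [A] up to half a turn; between [r0] and [A] the petal does not change. *)
Lemma W_fst_mono w (A : int) r r0 : `|r0 - A%:~R| <= 1/2 ->
  Num.min r0 A%:~R <= r <= Num.max r0 A%:~R -> (W w r).1 <= (W w r0).1.
Proof.
have pi0 := pi_gt0 R.
have main (j : nat) (a b : R) : 0 <= a -> a <= b -> b <= 1/2 ->
    j.+1%:R - j.+1%:R * cos (2 * pi * a) <= j.+1%:R - j.+1%:R * cos (2 * pi * b).
  move=> a0; rewrite le_eqVlt => /orP[/eqP -> //|ab b2].
  rewrite lerD2l lerN2 ler_pM2l ?ltr0n //; apply: ltW.
  have bpi : pi * b <= pi * (1/2) by rewrite ler_wpM2l // ltW.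
  have api : 0 <= pi * a by rewrite mulr_ge0 // ltW.
  have abpi : pi * a < pi * b by rewrite ltr_pM2l.
  by rewrite ltr_cos ?in_itv /=; lra.
rewrite ler_norml => rA; have [rA0|rA0] := leP r0 A%:~R => rr.
- rewrite (@W_petal w r (A - 1)) ?intrB; last lra.
  rewrite (@W_petal w r0 (A - 1)) ?intrB; last lra.
  have -> : r = - (A%:~R - r) + A%:~R by ring.
  have -> : r0 = - (A%:~R - r0) + A%:~R by ring.
  by rewrite !petalDint /petal /= !mulrN !cosN; apply: main; lra.
- rewrite (@W_petal w r A); last lra.
  rewrite (@W_petal w r0 A); last lra.
  have -> : r = (r - A%:~R) + A%:~R by ring.
  have -> : r0 = (r0 - A%:~R) + A%:~R by ring.
  by rewrite !petalDint /petal /=; apply: main; lra.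
Qed.

(* From [t] to [s] the first coordinate of [Q] only decreases ([W_fst_mono]), so
   [P] stays off the midpoints in between. *)
Lemma controls_rnd (X : Type) (phi : R -> X -> X) kP (P : X -> R * R) kQ (Q : X -> R * R) e
    x w u w' u' t s :
  orbit_lifted phi kP P x w u -> orbit_lifted phi kQ Q x w' u' -> controls Q P e ->
  (Q (phi t x)).1 < e -> u' s = (rnd (u' t))%:~R -> rnd (u t) = rnd (u s).
Proof.
move=> [wk ui uE] [wk' ui' uE'] ctl Qt us.
have B := rnd_bounds (u' t).
have mid r : Num.min t s <= r <= Num.max t s -> u r + 1/2 \isn't a Num.int.
  move=> rts; have Qr : (Q (phi r x)).1 < e.
    apply: le_lt_trans Qt; rewrite !uE'; apply: (@W_fst_mono _ (rnd (u' t))).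
      by rewrite ler_norml; lra.
    rewrite -us; move: rts; have [ts|st] := leP t s => rts.
    - have : u' t <= u' r by rewrite ihomeo_le //; lra.
      have : u' r <= u' s by rewrite ihomeo_le //; lra.
      have : u' t <= u' s by rewrite ihomeo_le.
      by move=> h1 h2 h3; rewrite (min_idPl h1) (max_idPr h1) h3 h2.
    - have : u' r <= u' t by rewrite ihomeo_le //; lra.
      have : u' s <= u' r by rewrite ihomeo_le //; lra.
      have : u' s <= u' t by rewrite ihomeo_le // ltW.
      by move=> h1 h2 h3; rewrite (min_idPr h1) (max_idPl h1) h3 h2.
  apply/negP => /intrP[m mE]; have := ctl _ Qr; rewrite uE.
  have -> : u r = (m - 1)%:~R + 1/2 by rewrite intrB -mE; field.
  have := petal_fst_ge (w (Num.floor ((m - 1)%:~R + 1/2 : R))) ((m - 1)%:~R + 1/2).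
  by rewrite cos_half /W; lra.
have cu a b : {within `[a, b], continuous (fun r => u r + 1/2)}.
  apply: within_itv; have := ihomeo_continuous (@ihomeo_shift u 0 (1/2) ui).
  by under eq_fun do rewrite addr0.
rewrite /rnd; have [ts|st] := leP t s.
  apply: (@floor_const (fun r => u r + 1/2) t s) => // r rts.
  by apply: mid; rewrite (min_idPl ts) (max_idPr ts).
apply/esym; apply: (@floor_const (fun r => u r + 1/2) s t) => //; first exact: ltW.
by move=> r rts; apply: mid; rewrite (min_idPr (ltW st)) (max_idPl (ltW st)).
Qed.

(** Along one passage of [P1] through the [j]-th petal, the word of [P3] is [uF j] by comparison
    with [F]. It is also the concatenation of the words that [P3] reads during the successive turns
    of [P2]. *)
Lemma reads_comp (X : Type) (phi : R -> X -> X) k1 (P1 : X -> R * R) k2 (P2 : X -> R * R)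
    k3 (P3 : X -> R * R) F uF d v xb e :
  (forall x, exists w u, orbit_lifted phi k1 P1 x w u) ->
  (forall x, exists w u, orbit_lifted phi k2 P2 x w u) ->
  (forall x, exists w u, orbit_lifted phi k3 P3 x w u) ->
  (forall x, phi 0 x = x) -> (forall z, Wedge k1 z -> exists x, P1 x = z) ->
  P1 xb = wedge_pt -> P2 xb = wedge_pt -> rose k1 k3 F uF -> (forall x, P3 x = F (P1 x)) ->
  reads phi k1 P1 k2 P2 d -> reads phi k2 P2 k3 P3 v ->
  oscillation P1 P2 e -> controls P2 P3 e ->
  rose k1 k3 F (fun j => substw v (d j)).
Proof.
move=> lift1 lift2 lift3 phi0 onto b1 b2 Fu FE rd rv osc ctl.
apply: rose_ext (Fu) _ => j jk.
(* An orbit through the midpoint of the [j]-th petal; the turn of [u1] containing time 0 is the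
   passage to be read. *)
have [x xE] := onto _ (Wedge_petal (1/2) jk).
have [w1 [u1 L1]] := lift1 x; have [w2 [u2 L2]] := lift2 x; have [w3 [u3 L3]] := lift3 x.
have [wk1 ui1 uE1] := L1; have [wk2 ui2 uE2] := L2; have [wk3 ui3 uE3] := L3.
pose a := Num.floor (u1 0).
have [t0 t0E] := ui1.2 a%:~R; have [t1 t1E] := ui1.2 (a%:~R + 1).
have waj : w1 a = j.
  have E : W w1 (u1 0) = petal j (1/2) by rewrite -uE1 phi0.
  have [dI lab] := petal_eq E; apply: lab; apply/negP => uI.
  have : u1 0 - (u1 0 - 1/2) \is a Num.int by rewrite rpredB.
  rewrite opprB addrCA subrr addr0; apply/negP.
  by apply: (@between_int _ 0); rewrite mulr0z; lra.
have near t : P1 (phi t x) = wedge_pt -> (P2 (phi t x)).1 < e.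
  by rewrite -b1 => /osc; rewrite b2; exact: dist_wedge_fst.
have near0 : (P2 (phi t0 x)).1 < e.
  by apply: near; rewrite uE1 t0E (W_wedge _ _).2 ?intr_int.
have near1 : (P2 (phi t1 x)).1 < e.
  by apply: near; rewrite uE1 t1E (W_wedge _ _).2 // rpredD ?intr_int ?rpred1.
have t01 : t0 <= t1 by rewrite -(ihomeo_le _ _ ui1) t0E t1E; lra.
have FjE : uF j = btw w3 (u3 t0) (u3 t1).
  have [g [gi ug gE]] := ihomeo_window a%:~R ui1.
  have g0 : g 0 = t0 by apply: gE; rewrite addr0.
  have g1 : g 1 = t1 by apply: gE.
  have [h hd hF] := Fu.2 j jk; have [_ _ hi h0 h1] := hd.
  have -> : uF j = btw (nthw (uF j)) (h 0) (h 1) by rewrite h0 h1 btw_nthw.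
  rewrite -g0 -g1.
  have wend t : t \is a Num.int -> (W (nthw (uF j)) t).1 < 1/2.
    by move=> tI; rewrite (W_wedge _ _).2 //=; lra.
  apply: (@close_paths k3 _ h _ (u3 \o g)) => //.
  - by move=> i; exact: rose_letters Fu jk.
  - exact: ihomeo_comp.
  - move=> t t01' /=; rewrite -uE3 FE uE1 ug (@W_petal w1 _ a); last lra.
    by rewrite waj [_ + t]addrC petalDint hF // subrr normr0; lra.
  - by rewrite h0; apply: wend; exact: int_num0.
  - by rewrite h1; apply: wend; exact: natr_int.
rewrite FjE -waj -(rd _ _ _ _ _ _ _ _ L1 L2 t0E t1E).
(* At [t0] and [t1], [P2] is only near the wedge point. The times [s i] are those at which it is
   exactly there, and by [controls_rnd] replacing [t0] by [s 0] and [t1] by [s n] crosses no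
   midpoint of [P3]. *)
pose A := rnd (u2 t0); pose n := `|rnd (u2 t1) - A|%N.
have /choice[s sP] : forall i : nat, exists t, u2 t = (A + i%:Z)%:~R.
  by move=> i; exact: ui2.2.
have An : A + n%:Z = rnd (u2 t1).
  have : A <= rnd (u2 t1) by apply: rnd_le; rewrite ihomeo_le.
  by rewrite /n; lia.
have r0 : rnd (u3 t0) = rnd (u3 (s 0%N)).
  by apply: (controls_rnd L3 L2 ctl near0); rewrite sP addr0.
have r1 : rnd (u3 t1) = rnd (u3 (s n)).
  by apply: (controls_rnd L3 L2 ctl near1); rewrite sP An.
rewrite [LHS]/btw r0 r1 -/(btw w3 (u3 (s 0%N)) (u3 (s n))) /btw -/A -/n.
have smono i : s 0%N <= s i by rewrite -(ihomeo_le _ _ ui2) !sP ler_int; lia.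
elim: (n) => [|i IH]; first by rewrite subrr.
have si : s i <= s i.+1 by rewrite -(ihomeo_le _ _ ui2) !sP ler_int; lia.
rewrite -[LHS]/(btw w3 (u3 (s 0%N)) (u3 (s i.+1))).
rewrite (@btw_cat _ _ (u3 (s i))) ?ihomeo_le // -addn1 segw_add substw_cat; congr (_ ++ _).
  exact: IH.
have -> : segw w2 (A + i%:Z) 1 = [:: w2 (A + i%:Z)] by congr [:: w2 _]; exact: addr0.
rewrite /substw /= cats0.
apply: rv L2 L3 _ _; first exact: sP.
rewrite sP -(intrD R _ 1); congr (_%:~R); clear; lia.
Qed.

Lemma dependent_choice_from (S : Type) (good : S -> Prop) (T : S -> S -> Prop) s0 :
  good s0 -> (forall s, good s -> exists2 s', good s' & T s s') ->
  exists2 q : nat -> S, q 0%N = s0 & forall k, good (q k) /\ T (q k) (q k.+1).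
Proof.
move=> g0 step.
have /choice[h hP] : forall s, exists s', good s -> good s' /\ T s s'.
  move=> s; have [/step[s' gs' ss']|ns] := pselect (good s); first by exists s'.
  by exists s.
have gk k : good (iter k h s0) by elim: k => //= k /hP[].
by exists (fun k => iter k h s0) => // k; split=> //=; exact: (hP _ (gk k)).2.
Qed.

Lemma tower_step (X : topologicalType) phi xb kx f P ky g Q n e M : compact [set: X] -> is_flow phi ->
  @tower X phi xb kx f P -> @tower X phi xb ky g Q -> 0 < e <= 1/16 ->
  exists m e', [/\ (M <= m)%N, 0 < e' <= 1/16, oscillation (P m) (Q n) e &
    controls (P m) (Q n) e'].
Proof.
move=> cX fl tP tQ /andP[e0 e1].
have [N NH] := oscillation_small cX tP (tw_cont tQ (i := n)) e0.
have osc := NH (maxn M N) (leq_maxr _ _).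
have [||e' e'P ctl] := @controls_small X (P (maxn M N)) (Q n) (kx (maxn M N)) cX (tw_cont tP (i := _))
    (tw_cont tQ (i := n)).
- by move=> x; exact: tower_Wedge fl tP.
- move=> z; rewrite -(tw_base tP (maxn M N)) => /osc; rewrite (tw_base tQ).
  by move=> /dist_wedge_fst; lra.
by exists (maxn M N), e'; split=> //; exact: leq_maxl.
Qed.

Lemma towers_word_iso (X : topologicalType) phi xb kx f fw P ky g gw Q : compact [set: X] -> is_flow phi ->
  (forall i, rose (kx i.+1) (kx i) (f i) (fw i)) ->
  (forall i, rose (ky i.+1) (ky i) (g i) (gw i)) ->
  @tower X phi xb kx f P -> @tower X phi xb ky g Q ->
  exists m n d u, word_iso kx f ky g m n d u.
Proof.
move=> cX fl fP gP tP tQ.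
(* A state holds a level and a tolerance on each side. The tolerance for which a level controls the
   coarser one is the oscillation bound demanded of the next level on the other side, as
   [reads_comp] requires. *)
pose S := (nat * R * (nat * R))%type.
pose good (s : S) := [/\ 0 < s.1.2 <= 1/16, 0 < s.2.2 <= 1/16,
  oscillation (P s.1.1) (Q s.2.1) s.2.2 & controls (P s.1.1) (Q s.2.1) s.1.2].
pose T (s s' : S) := [/\ (s.1.1 < s'.1.1)%N, (s.2.1 < s'.2.1)%N,
  oscillation (Q s'.2.1) (P s.1.1) s.1.2 & controls (Q s'.2.1) (P s.1.1) s'.2.2].
have [s0 g0] : exists s0, good s0.
  have [|m [e [_ e0 osc ctl]]] := @tower_step X phi xb kx f P ky g Q 0%N (1/16) 0%N cX fl tP tQ.
    by lra.
  by exists ((m, e), (0%N, 1/16)); split=> //=; lra.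
have [|q _ qP] := @dependent_choice_from S good T s0 g0.
  move=> [[m em] [n en]] [/= em0 en0 osc ctl].
  have [n' [en' [nn' en'0 osc1 ctl1]]] := tower_step m n.+1 cX fl tQ tP em0.
  have [m' [em' [mm' em'0 osc2 ctl2]]] := tower_step n' m.+1 cX fl tP tQ en'0.
  by exists ((m', em'), (n', en')).
pose m k := (q k).1.1; pose n k := (q k).2.1.
have weaken (A B : X -> R * R) e : 0 < e <= 1/16 -> oscillation A B e -> oscillation A B (1/16).
  by move=> e0 H z z' /H; lra.
have liftP i x : exists w u, orbit_lifted phi (kx i) (P i) x w u by exact: tw_lift tP i x.
have liftQ i x : exists w u, orbit_lifted phi (ky i) (Q i) x w u by exact: tw_lift tQ i x.
have bP := tw_base tP; have bQ := tw_base tQ.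
have /choice[d dP] k : exists d, reads phi (kx (m k)) (P (m k)) (ky (n k)) (Q (n k)) d /\
    forall j, all (ltn^~ (ky (n k))) (d j).
  have [[_ e0 osc _] _] := qP k.
  have [d d1 d2] := reads_exists (liftP (m k)) (liftQ (n k)) (bP _) (bQ _) (weaken _ _ _ e0 osc).
  by exists d.
have /choice[u uP] k : exists u, reads phi (ky (n k.+1)) (Q (n k.+1)) (kx (m k)) (P (m k)) u /\
    forall j, all (ltn^~ (kx (m k))) (u j).
  have [[e0 _ _ _] [_ _ osc _]] := qP k.
  have [d' d1 d2] := reads_exists (liftQ (n k.+1)) (liftP (m k)) (bQ _) (bP _) (weaken _ _ _ e0 osc).
  by exists d'.
have mm k : (m k < m k.+1)%N by have [_ []] := qP k.
have nn k : (n k < n k.+1)%N by have [_ []] := qP k.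
have phi0 x : phi 0 x = x by case: fl.
have fE k : rose (kx (m k.+1)) (kx (m k)) (fcomp f (m k) (m k.+1 - m k))
    (fun j => substw (u k) (d k.+1 j)).
  have Fr := rose_fcomp (m k) (m k.+1 - m k) fP.
  rewrite subnKC in Fr; last exact: ltnW.
  have [[_ _ osc _] _] := qP k.+1; have [_ [_ _ _ ctl]] := qP k.
  apply: (reads_comp (liftP _) (liftQ _) (liftP _) phi0 (tw_onto tP (i := _)) (bP _) (bQ _) Fr
    _ (dP k.+1).1 (uP k).1 osc ctl).
  by move=> x; apply: tw_comp tP _ _ _ _; exact: ltnW.
have gE k : rose (ky (n k.+1)) (ky (n k)) (fcomp g (n k) (n k.+1 - n k))
    (fun j => substw (d k) (u k j)).
  have Gr := rose_fcomp (n k) (n k.+1 - n k) gP.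
  rewrite subnKC in Gr; last exact: ltnW.
  have [[_ _ _ ctl] [_ _ osc _]] := qP k.
  apply: (reads_comp (liftQ _) (liftP _) (liftQ _) phi0 (tw_onto tQ (i := _)) (bQ _) (bP _) Gr
    _ (uP k).1 (dP k).1 osc ctl).
  by move=> x; apply: tw_comp tQ _ _ _ _; exact: ltnW.
(* Indices are shifted because a word is shown nonempty through a composite beginning with it, and
   no such composite begins with [d 0]. *)
exists (fun k => m k.+1), (fun k => n k.+1), (fun k => d k.+1), (fun k => u k.+1); split=> //.
- move=> k j jk; split; last exact: (dP _).2.
  by move=> dj; apply: (rose_neq0 (fE k) jk); rewrite dj.
- move=> k j jk; split; last exact: (uP _).2.
  by move=> uj; apply: (rose_neq0 (gE k.+1) jk); rewrite uj.
Qed.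

(** * From words to homeomorphisms *)

(** To the right of [t] the turns of source and image are given by the floor of the angle, to the
    left by the ceiling minus one; at the wedge point the two sides may thus use different petals,
    as [pos_at] allows. *)
Lemma rose_pos_at a b F u w v t : rose a b F u -> (forall i, (w i < a)%N) -> ihomeo v ->
  pos_at b (fun s => F (W w (v s))) t.
Proof.
move=> Fu wa vi.
have letter j i : (j < a)%N -> (nthw (u j) i < b)%N by exact: rose_letters Fu.
have [tR [jR [hR [tR1 jRb hRi hRE]]]] : exists t1 j h, [/\ t < t1, (j < b)%N, ihomeo h &
    forall s, t <= s <= t1 -> F (W w (v s)) = petal j (h s)].
  pose K := Num.floor (v t); have KB := floor_bounds (v t); rewrite -/K in KB.
  have [h hd hF] := Fu.2 _ (wa K); have [_ _ hi h0 h1] := hd.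
  pose M := Num.floor (h (v t - K%:~R)); have MB := floor_bounds (h (v t - K%:~R)).
  rewrite -/M in MB.
  have hL : h (v t - K%:~R) < (size (u (w K)))%:R by rewrite -h1 ihomeo_lt //; lra.
  have ML : M%:~R + 1 <= (size (u (w K)))%:R :> R.
    apply: int_lt_gap; [exact: intr_int|exact: natr_int|lra].
  have [th1 th1E] := hi.2 (M%:~R + 1).
  have th11 : th1 <= 1 by rewrite -(ihomeo_le _ _ hi) th1E h1.
  have th1v : v t - K%:~R < th1 by rewrite -(ihomeo_lt _ _ hi) th1E; lra.
  have [t1 t1E] := vi.2 (th1 + K%:~R).
  exists t1, (nthw (u (w K)) M), (fun s => h (v s - K%:~R)); split.
  - by rewrite -(ihomeo_lt _ _ vi) t1E; lra.
  - exact: letter.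
  - by apply: (ihomeo_comp hi); have := @ihomeo_shift v 0 (- K%:~R) vi; under eq_fun do rewrite addr0.
  - move=> s st; have v1 : v t <= v s by rewrite ihomeo_le //; lra.
    have v2 : v s <= v t1 by rewrite ihomeo_le //; lra.
    rewrite (@W_petal w (v s) K); last lra.
    rewrite -{1}(subrK K%:~R (v s)) petalDint hF; last lra.
    have h2 : h (v t - K%:~R) <= h (v s - K%:~R) by rewrite ihomeo_le //; lra.
    have h3 : h (v s - K%:~R) <= h th1 by rewrite ihomeo_le //; lra.
    by apply: W_petal; lra.
have [tL [jL [hL [tL1 jLb hLi hLE]]]] : exists t1 j h, [/\ t1 < t, (j < b)%N, ihomeo h &
    forall s, t1 <= s <= t -> F (W w (v s)) = petal j (h s)].
  pose K := Num.ceil (v t) - 1.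
  have KB : K%:~R < v t <= K%:~R + 1.
    rewrite /K intrB subrK ceil_ge andbT; have := ceilB1_lt (v t); rewrite intrB; lra.
  have [h hd hF] := Fu.2 _ (wa K); have [_ _ hi h0 h1] := hd.
  pose M := Num.ceil (h (v t - K%:~R)) - 1.
  have MB : M%:~R < h (v t - K%:~R) <= M%:~R + 1.
    rewrite /M intrB subrK ceil_ge andbT; have := ceilB1_lt (h (v t - K%:~R)); rewrite intrB; lra.
  have hL : 0 < h (v t - K%:~R) by rewrite -h0 ihomeo_lt //; lra.
  have M0 : 0 <= M%:~R :> R.
    have : (0 < M + 1)%R by rewrite -(ltr_int R) intrD; lra.
    by rewrite ler0z; lia.
  have [th1 th1E] := hi.2 M%:~R.
  have th10 : 0 <= th1 by rewrite -(ihomeo_le _ _ hi) th1E h0.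
  have th1v : th1 < v t - K%:~R by rewrite -(ihomeo_lt _ _ hi) th1E; lra.
  have [t1 t1E] := vi.2 (th1 + K%:~R).
  exists t1, (nthw (u (w K)) M), (fun s => h (v s - K%:~R)); split.
  - by rewrite -(ihomeo_lt _ _ vi) t1E; lra.
  - exact: letter.
  - by apply: (ihomeo_comp hi); have := @ihomeo_shift v 0 (- K%:~R) vi; under eq_fun do rewrite addr0.
  - move=> s st; have v1 : v t1 <= v s by rewrite ihomeo_le //; lra.
    have v2 : v s <= v t by rewrite ihomeo_le //; lra.
    rewrite (@W_petal w (v s) K); last lra.
    rewrite -{1}(subrK K%:~R (v s)) petalDint hF; last lra.
    have h2 : h th1 <= h (v s - K%:~R) by rewrite ihomeo_le //; lra.
    have h3 : h (v s - K%:~R) <= h (v t - K%:~R) by rewrite ihomeo_le //; lra.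
    by apply: W_petal; lra.
exists (Num.min (tR - t) (t - tL)); first by rewrite lt_min; lra.
set e := Num.min _ _.
have eR : e <= tR - t by rewrite ge_min lexx.
have eL : e <= t - tL by rewrite ge_min lexx orbT.
exists (Ordinal jLb), (Ordinal jRb), hL, hR; split.
- by move=> s st; rewrite hLE //; lra.
- by move=> s st; rewrite hRE //; lra.
- exact/continuous_subspaceT/ihomeo_continuous.
- exact/continuous_subspaceT/ihomeo_continuous.
- by split=> s1 s2 _ s12 _; [exact: hLi.1|exact: hRi.1].
Qed.

Definition complete (X : Type) (kk : nat -> nat) (f : nat -> R * R -> R * R) (P : nat -> X -> R * R) :=
  forall z : nat -> R * R, (forall i, Wedge (kk i) (z i)) ->
    (forall i, z i = f i (z i.+1)) -> exists x, forall i, P i x = z i.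

Lemma increasing_ge (m : nat -> nat) : (forall k, (m k < m k.+1)%N) -> forall k, (k <= m k)%N.
Proof. by move=> mm; elim=> // k IH; exact: leq_ltn_trans (mm k). Qed.

Lemma increasing_le (m : nat -> nat) : (forall k, (m k < m k.+1)%N) ->
  forall k l, (k <= l)%N -> (m k <= m l)%N.
Proof.
move=> mm k l; elim: l => [|l IH]; first by rewrite leqn0 => /eqP ->.
by rewrite leq_eqVlt => /orP[/eqP ->|/IH H] //; apply: leq_trans H (ltnW (mm l)).
Qed.

Lemma tower_eq X phi xb kk f P m N x y : @tower X phi xb kk f P ->
  (forall k, (m k < m k.+1)%N) -> (forall k, (N <= k)%N -> P (m k) x = P (m k) y) -> x = y.
Proof.
move=> tP mm H; apply: (tw_inj tP) => i.
have im : (i <= m (maxn N i))%N.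
  by apply: leq_trans (increasing_ge mm _); exact: leq_maxr.
by rewrite (tw_comp tP _ im) (tw_comp tP y im) H // leq_maxl.
Qed.

Lemma complete_cofinal X kk f fw (P : nat -> X -> R * R) m (y : nat -> R * R) :
  complete kk f P -> (forall i, rose (kk i.+1) (kk i) (f i) (fw i)) ->
  (forall k, (m k < m k.+1)%N) -> (forall n l x, (n <= l)%N -> P n x = fcomp f n (l - n) (P l x)) ->
  (forall k, Wedge (kk (m k)) (y k)) ->
  (forall k, y k = fcomp f (m k) (m k.+1 - m k) (y k.+1)) ->
  exists x, forall k, P (m k) x = y k.
Proof.
move=> cP fP mm Pc yW yE.
have yE2 k l : (k <= l)%N -> y k = fcomp f (m k) (m l - m k) (y l).
  elim: l => [|l IH]; first by rewrite leqn0 => /eqP ->; rewrite subnn.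
  rewrite leq_eqVlt => /orP[/eqP ->|]; first by rewrite subnn.
  rewrite ltnS => /[dup] kl /IH ->; rewrite (yE l).
  have h1 := increasing_le mm kl; have h2 := mm l.
  have -> : (m l.+1 - m k = (m l - m k) + (m l.+1 - m l))%N by lia.
  by rewrite fcomp_add subnKC.
(* The missing levels are obtained by pushing down from level [m i], which is at least [i]. *)
pose z i := fcomp f i (m i - i) (y i).
have zE i k : (i <= k)%N -> z i = fcomp f i (m k - i) (y k).
  move=> ik; rewrite /z (yE2 _ _ ik).
  have h1 := increasing_ge mm i; have h2 := increasing_le mm ik.
  have -> : (m k - i = (m i - i) + (m k - m i))%N by lia.
  by rewrite fcomp_add subnKC.
have [||x xE] := cP z.
- move=> i; have h1 := increasing_ge mm i; have := rose_fcomp i (m i - i) fP.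
  by rewrite subnKC // => Fr; apply: rose_Wedge Fr (yW i).
- move=> i; rewrite (zE i i.+1) // /z; have := increasing_ge mm i.+1 => h.
  have -> : (m i.+1 - i = 1 + (m i.+1 - i.+1))%N by lia.
  by rewrite fcomp_add addn1 /= addn0.
exists x => k; have h := increasing_ge mm k.
by rewrite xE (zE _ (m k)) ?subnn //; have := yE2 k (m k) h => ->.
Qed.

(** Only the first map is chosen freely. Each later one is a factor, by [rose_factor], of a bonding
    map through its predecessor, so [U k] and [D k.+1] are built in turn. *)
Lemma exact_ladder kx f ky g m n d u : word_iso kx f ky g m n d u ->
  exists D U : nat -> R * R -> R * R,
    [/\ (forall k, rose (kx (m k)) (ky (n k)) (D k) (d k)),
        (forall k, rose (ky (n k.+1)) (kx (m k)) (U k) (u k)),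
        (forall k z, Wedge (ky (n k.+1)) z ->
           D k (U k z) = fcomp g (n k) (n k.+1 - n k) z) &
        (forall k z, Wedge (kx (m k.+1)) z ->
           U k (D k.+1 z) = fcomp f (m k) (m k.+1 - m k) z)].
Proof.
move=> [mn db ub fE gE].
pose S := (nat * (R * R -> R * R))%type.
pose good (s : S) := rose (kx (m s.1)) (ky (n s.1)) s.2 (d s.1).
pose link (k : nat) (A B U : R * R -> R * R) := [/\ rose (ky (n k.+1)) (kx (m k)) U (u k),
  (forall z, Wedge (ky (n k.+1)) z -> A (U z) = fcomp g (n k) (n k.+1 - n k) z) &
  (forall z, Wedge (kx (m k.+1)) z -> U (B z) = fcomp f (m k) (m k.+1 - m k) z)].
pose T (s s' : S) := s'.1 = s.1.+1 /\ exists U, link s.1 s.2 s'.2 U.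
have [D0 D0P] := rose_words (db 0%N).
have [|q q0 qP] := @dependent_choice_from S good T (0%N, D0) D0P.
  move=> [k A] /= Ad.
  have [U Uu AU] := rose_factor Ad (gE k) (ub k).
  have [B Bd UB] := rose_factor Uu (fE k) (db k.+1).
  by exists (k.+1, B) => //; split=> //; exists U.
have qk k : (q k).1 = k.
  by elim: k => [|k IH]; [rewrite q0|have [_ [-> _]] := qP k; rewrite IH].
have /choice[U UP] k : exists U, link k (q k).2 (q k.+1).2 U.
  by have [_ [_]] := qP k; rewrite qk.
exists (fun k => (q k).2), U; split.
- by move=> k; have [] := qP k; rewrite /good qk.
- by move=> k; have [] := UP k.
- by move=> k; have [] := UP k.
- by move=> k; have [] := UP k.
Qed.

Lemma rose_comp_continuous (X : topologicalType) a b F u (P : X -> R * R) x e :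
  rose a b F u -> continuous P -> (forall y, Wedge a (P y)) -> 0 < e ->
  \forall y \near x, `|F (P y) - F (P x)| < e.
Proof.
move=> Fu cP PW e0.
have [d d0 dH] := (within22P _ _).1 (rose_continuous Fu) _ (PW x) e e0.
by apply: filterS (near_continuous x cP d0) => y; apply: dH.
Qed.

Lemma tower_map_continuous (X Y : topologicalType) phi xb kx f P psi yb ky g gw Q
    (h : X -> Y) m n F v :
  is_flow phi -> @tower X phi xb kx f P -> @tower Y psi yb ky g Q ->
  (forall i, rose (ky i.+1) (ky i) (g i) (gw i)) ->
  (forall k, rose (kx (m k)) (ky (n k)) (F k) (v k)) ->
  (forall k, (n k < n k.+1)%N) -> (forall k x, Q (n k) (h x) = F k (P (m k) x)) ->
  continuous h.
Proof.
move=> fl tP tQ gP Fv nn hE x U /(tw_nbhs tQ)[N [e [e0 eH]]].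
suff : \forall y \near x, forall i, (i <= N)%N -> `|Q i (h y) - Q i (h x)| < e.
  by apply: filterS => y; exact: eH.
have loc i : \forall y \near x, `|Q i (h y) - Q i (h x)| < e.
  have ii := increasing_ge nn i.
  have Gr := rose_fcomp i (n i - i) gP; rewrite subnKC // in Gr.
  have := rose_comp_continuous x (rose_comp (Fv i) Gr) (tw_cont tP (i := m i))
    (fun y => tower_Wedge _ y fl tP) e0.
  by apply: filterS => y; rewrite (tw_comp tQ (h y) ii) (tw_comp tQ (h x) ii) !hE.
elim: N {eH} => [|N IH].
  by apply: filterS (loc 0%N) => y yd i; rewrite leqn0 => /eqP ->.
apply: filterS (filterI IH (loc N.+1)) => y [/= h1 h2] i.
by rewrite leq_eqVlt => /orP[/eqP -> //|]; exact: h1.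
Qed.

Lemma ladder_homeo (X Y : topologicalType) phi xb kx f fw P psi yb ky g gw Q m n d u :
  is_flow phi -> is_flow psi -> @tower X phi xb kx f P -> @tower Y psi yb ky g Q ->
  complete kx f P -> complete ky g Q ->
  (forall i, rose (kx i.+1) (kx i) (f i) (fw i)) ->
  (forall i, rose (ky i.+1) (ky i) (g i) (gw i)) ->
  word_iso kx f ky g m n d u ->
  exists (h : X -> Y) (D : nat -> R * R -> R * R),
    [/\ exists h', [/\ cancel h h', cancel h' h, continuous h & continuous h'],
        h xb = yb, (forall k, rose (kx (m k)) (ky (n k)) (D k) (d k)) &
        (forall k x, Q (n k) (h x) = D k (P (m k) x))].
Proof.
move=> flX flY tP tQ cP cQ fP gP wi; have [[mm nn] _ _ _ _] := wi.
have [D [U [Dd Uu DU UD]]] := exact_ladder wi.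
have PW i x : Wedge (kx i) (P i x) by exact: tower_Wedge flX tP.
have QW i y : Wedge (ky i) (Q i y) by exact: tower_Wedge flY tQ.
have /choice[h hE] x : exists y, forall k, Q (n k) y = D k (P (m k) x).
  apply: complete_cofinal cQ gP nn (@tw_comp _ _ _ _ _ _ tQ) _ _.
  - by move=> k; apply: rose_Wedge (Dd k) _.
  - move=> k; rewrite -DU; last exact: rose_Wedge (Dd k.+1) _.
    by rewrite UD // -(tw_comp tP) // ltnW.
have /choice[h' h'E] y : exists x, forall k, P (m k) x = U k (Q (n k.+1) y).
  apply: complete_cofinal cP fP mm (@tw_comp _ _ _ _ _ _ tP) _ _.
  - by move=> k; apply: rose_Wedge (Uu k) _.
  - move=> k; rewrite -UD; last exact: rose_Wedge (Uu k.+1) _.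
    by rewrite DU // -(tw_comp tQ) // ltnW.
exists h, D; split=> //; first (exists h'; split).
- move=> x; apply: (@tower_eq _ _ _ _ _ _ m 0%N _ _ tP mm) => k _.
  by rewrite h'E hE UD // -(tw_comp tP) // ltnW.
- move=> y; apply: (@tower_eq _ _ _ _ _ _ n 0%N _ _ tQ nn) => k _.
  by rewrite hE h'E DU // -(tw_comp tQ) // ltnW.
- exact: (tower_map_continuous flX tP tQ gP Dd nn (fun k x => hE x k)).
- exact: (tower_map_continuous (n := m) (m := fun k => n k.+1) flY tQ tP fP Uu mm (fun k y => h'E y k)).
- apply: (@tower_eq _ _ _ _ _ _ n 0%N _ _ tQ nn) => k _.
  by rewrite hE (tw_base tP) (tw_base tQ) (Dd k).1.
Qed.

(** * Orbits are determined by one lifted angle *)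

Definition between (a b t : R) := a <= t <= b \/ b <= t <= a.

Lemma lift_unique_between (f g : R -> R) a b : continuous f -> continuous g ->
  (forall t, between a b t -> f t - g t \is a Num.int) -> f b - f a = g b - g a.
Proof.
move=> cf cg H; have [ab|ba] := leP a b.
  by apply: lift_unique => //; [exact: within_itv|exact: within_itv|move=> t tab; apply: H; left].
apply: oppr_inj; rewrite !opprB.
apply: lift_unique; [exact: ltW|exact: within_itv|exact: within_itv|].
by move=> t tab; apply: H; right.
Qed.

Lemma floor_const_between (f : R -> R) a b : continuous f ->
  (forall t, between a b t -> f t \isn't a Num.int) ->
  forall t, between a b t -> (Num.floor (f a))%:~R < f t < (Num.floor (f a))%:~R + 1.
Proof.
move=> cf H t tab.
have -> : Num.floor (f a) = Num.floor (f t).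
  have [at_|ta] := leP a t.
    apply: floor_const => //; first exact: within_itv.
    by move=> s st; apply: H; rewrite /between in tab *; lra.
  apply/esym; apply: floor_const => //; [exact: ltW|exact: within_itv|].
  by move=> s st; apply: H; rewrite /between in tab *; lra.
have B := floor_bounds (f t).
have : f t != (Num.floor (f t))%:~R.
  by apply: contraNneq (H t tab) => ->; exact: intr_int.
by move/eqP; lra.
Qed.

Lemma lift_eq w u w' u' a b : ihomeo u -> ihomeo u' ->
  (forall t, W w (u t) = W w' (u' t)) -> u b - u a = u' b - u' a.
Proof.
move=> ui ui' H; apply: lift_unique_between; [exact: ihomeo_continuous|exact: ihomeo_continuous|].
by move=> t _; have [] := W_eq (H t).
Qed.

(* All lifts of an orbit differ by a constant ([lift_eq]), so the choice of [w] and
   [u] is immaterial. *)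
Definition advance (Y : Type) (psi : R -> Y -> Y) (q : Y -> R * R) y s r :=
  exists w u, [/\ ihomeo u, forall t, q (psi t y) = W w (u t) & u s - u 0 = r].

(** Recording the advance of the angle, and not just membership in an orbit, determines the time
    [s], since lifts are injective. The local times then fit into a single reparametrization, also
    on periodic orbits. *)
Definition same_orbit (Y : Type) (psi : R -> Y -> Y) (q : Y -> R * R) (c : R -> Y) (v : R -> R) a b :=
  exists2 s, c b = psi s (c a) & advance psi q (c a) s (v b - v a).

Lemma same_orbit_sym (Y : topologicalType) (psi : R -> Y -> Y) q c v a b : is_flow psi ->
  same_orbit psi q c v a b -> same_orbit psi q c v b a.
Proof.
move=> [psi0 psiD _] [s cE [w [u [ui uE us]]]]; exists (- s).
  by rewrite cE -psiD addNr psi0.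
exists w, (fun t => u (t + s) + 0); split; first exact: ihomeo_shift.
- by move=> t; rewrite cE -psiD uE addr0.
- by rewrite addNr add0r !addr0 -(opprB (v b)) -us opprB.
Qed.

Lemma same_orbit_trans (Y : topologicalType) (psi : R -> Y -> Y) q c v a b d : is_flow psi ->
  same_orbit psi q c v a b -> same_orbit psi q c v b d -> same_orbit psi q c v a d.
Proof.
move=> [psi0 psiD _] [s cE [w [u [ui uE us]]]] [s' cE' [w' [u' [ui' uE' us']]]].
exists (s' + s); first by rewrite cE' cE -psiD.
exists w, u; split=> //.
have := @lift_eq w (fun t => u (t + s) + 0) w' u' 0 s' (ihomeo_shift s 0 ui) ui'.
rewrite !addr0 add0r us' => H.
have -> : u (s' + s) - u 0 = (u (s' + s) - u s) + (u s - u 0) by ring.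
rewrite H ?us; first by ring.
by move=> t; rewrite addr0 -uE -uE' cE -psiD.
Qed.

Lemma continuous_agree (F G : R -> R * R) t0 b : t0 <> b -> continuous F -> continuous G ->
  (forall t, between t0 b t -> t <> t0 -> F t = G t) -> F t0 = G t0.
Proof.
move=> tb cF cG H; apply/eqP; rewrite -subr_eq0 -normr_eq0.
apply/negPn/negP => nz.
pose e := `|F t0 - G t0|; have e0 : 0 < e / 2 by rewrite divr_gt0 // lt_neqAle eq_sym nz normr_ge0.
have [d d0 dH] := (continuousR2P F).1 cF t0 _ e0.
have [d' d'0 d'H] := (continuousR2P G).1 cG t0 _ e0.
pose r := Num.min (Num.min (d / 2) (d' / 2)) `|b - t0|.
have r0 : 0 < r.
  rewrite !lt_min normr_gt0 subr_eq0; apply/andP; split; first by apply/andP; split; lra.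
  by apply/eqP => E; apply: tb.
have rd : r < d by rewrite !gt_min; apply/orP; left; apply/orP; left; lra.
have rd' : r < d' by rewrite !gt_min; apply/orP; left; apply/orP; right; lra.
have rb : r <= `|b - t0| by rewrite ge_min lexx orbT.
have [t [tb' tt0 tr]] : exists t, [/\ between t0 b t, t <> t0 & `|t - t0| = r].
  have [l|l] := leP t0 b.
    exists (t0 + r); rewrite ger0_norm in rb; last lra.
    split; [left; lra|lra|rewrite addrC addKr gtr0_norm //].
  exists (t0 - r); rewrite ltr0_norm in rb; last lra.
  split; [right; lra|lra|rewrite addrC addKr normrN gtr0_norm //].
have h1 : `|F t - F t0| < e / 2 by apply: dH; rewrite tr.
have h2 : `|G t - G t0| < e / 2 by apply: d'H; rewrite tr.
have : e <= `|F t - F t0| + `|G t - G t0|.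
  rewrite /e -(normrN (F t - F t0)) opprB (H t tb' tt0).
  have -> : F t0 - G t0 = (F t0 - G t) + (G t - G t0) by rewrite addrA subrK.
  exact: ler_normD.
by lra.
Qed.

Definition lifts (c : R -> R * R) w u := ihomeo u /\ forall t, c t = W w (u t).

(* Away from the base point, all levels beyond some [N] stay inside a single
   petal near [t0], so the angle at level [0] determines the point. *)
Lemma same_orbit_local (Y : topologicalType) psi yb ky g gw Q n (c : R -> Y) w0 v0 t0 :
  is_flow psi -> @tower Y psi yb ky g Q ->
  (forall i, rose (ky i.+1) (ky i) (g i) (gw i)) -> (forall k, (n k < n k.+1)%N) ->
  (forall k, exists w v, (forall i, (w i < ky (n k))%N) /\ lifts (fun t => Q (n k) (c t)) w v) ->
  lifts (fun t => Q (n 0%N) (c t)) w0 v0 -> c t0 <> yb ->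
  exists2 e, 0 < e & forall b, `|b - t0| < e -> same_orbit psi (Q (n 0%N)) c v0 t0 b.
Proof.
move=> fl tQ gP nn cl [v0i v0E] cyb; have [psi0 psiD _] := fl.
set y := c t0 in cyb *.
have [r0w [r0 [_ r0i r0E]]] := tw_lift tQ (n 0%N) y.
have [r0' [r0'i r0K r0K']] := ihomeo_inv r0i.
(* The only possible time change: along the orbit of [y] the angle of the first level must advance
   as it does along [c]. *)
pose tau t := r0' (v0 t + (r0 0 - v0 t0)).
have taui : ihomeo tau.
  have := ihomeo_comp r0'i (ihomeo_shift 0 (r0 0 - v0 t0) v0i).
  by rewrite /tau /comp; under eq_fun do rewrite addr0.
have tau0 : tau t0 = 0 by rewrite /tau addrC subrK r0K.
have r0tau t : r0 (tau t) = v0 t + (r0 0 - v0 t0) by rewrite /tau r0K'.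
(* Bonding maps fix the wedge point, so where level [N] is off it, all higher levels are too. The
   window of times chosen at level [N] therefore serves all [k] >= [N] at once. *)
have [N QN] : exists N, Q (n N) y <> wedge_pt.
  apply/existsNP => H; apply: cyb; apply: (tower_eq (N := 0%N) tQ nn) => k _.
  by rewrite H (tw_base tQ).
have cNt0 : Q (n N) (c t0) <> wedge_pt by [].
have [wN [vN [wNk [vNi vNE]]]] := cl N.
have [xN [rN [xNk rNi rNE]]] := tw_lift tQ (n N) y.
have near (F : R -> R) : continuous F -> F t0 \isn't a Num.int ->
    exists2 e, 0 < e & forall b, `|b - t0| < e -> F b \isn't a Num.int.
  move=> cF FI; have B := floor_bounds (F t0); set K := Num.floor _ in B.
  have FK : F t0 != K%:~R by apply: contraNneq FI => ->; exact: intr_int.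
  pose eta := Num.min (F t0 - K%:~R) (K%:~R + 1 - F t0).
  have eta0 : 0 < eta by rewrite lt_min; move/eqP: FK; lra.
  have [d d0 dH] := (continuousRP F).1 cF t0 eta eta0.
  exists d => // b /dH; rewrite ltr_norml !lt_min => Fb; apply: (@between_int _ K).
  move: Fb; have [h1 h2] : eta <= F t0 - K%:~R /\ eta <= K%:~R + 1 - F t0.
    by rewrite /eta !ge_min !lexx orbT.
  lra.
have [|e1 e10 e1H] := near vN (ihomeo_continuous vNi).
  by apply/negP => I; apply: cNt0; rewrite vNE (W_wedge _ _).2.
have [|e2 e20 e2H] := near (rN \o tau) (ihomeo_continuous (ihomeo_comp rNi taui)).
  by rewrite /= tau0; apply/negP => I; apply: QN; rewrite -[y]psi0 rNE (W_wedge _ _).2.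
exists (Num.min e1 e2); first by rewrite lt_min e10.
move=> b; rewrite lt_min => /andP[be1 be2].
have seg t : between t0 b t -> `|t - t0| < e1 /\ `|t - t0| < e2.
  by move: be1 be2; rewrite !ltr_norml /between; lra.
exists (tau b); last first.
  by exists r0w, r0; split=> //; rewrite r0tau; ring.
apply: (tower_eq (N := N) tQ nn) => k Nk.
have nNk := increasing_le nn Nk.
have [w [v [wk [vi vE]]]] := cl k.
have [x [r [xk ri rE]]] := tw_lift tQ (n k) y.
have nonw z : Q (n N) z <> wedge_pt -> Q (n k) z <> wedge_pt.
  move=> zN zk; apply: zN; rewrite (tw_comp tQ z nNk) zk.
  exact: (rose_fcomp (n N) (n k - n N) gP).1.
have vb := @floor_const_between v t0 b (ihomeo_continuous vi).
have rb := @floor_const_between (r \o tau) t0 b (ihomeo_continuous (ihomeo_comp ri taui)).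
set K := Num.floor (v t0) in vb; set K' := Num.floor ((r \o tau) t0) in rb.
have {}vb : forall t, between t0 b t -> K%:~R < v t < K%:~R + 1.
  apply: vb => t /seg[te _]; apply/negP => I; apply: (nonw (c t)).
    by rewrite vNE => /W_wedge J; have := e1H t te; rewrite J.
  by rewrite vE (W_wedge _ _).2.
have {}rb : forall t, between t0 b t -> K'%:~R < r (tau t) < K'%:~R + 1.
  apply: rb => t /seg[_ te]; apply/negP => I; apply: (nonw (psi (tau t) y)).
    by rewrite rNE => /W_wedge J; have := e2H t te; rewrite /= J.
  by rewrite rE (W_wedge _ _).2.
have bt0 : between t0 b t0 by rewrite /between; lra.
have bb : between t0 b b by rewrite /between; lra.
pose j := w K.
have wv t : between t0 b t -> W w (v t) = petal j (v t - K%:~R).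
  move=> /vb vt; rewrite (@W_petal w _ K); last lra.
  by rewrite -{1}(subrK K%:~R (v t)) petalDint.
have xr t : between t0 b t -> W x (r (tau t)) = petal (x K') (r (tau t) - K'%:~R).
  move=> /rb rt; rewrite (@W_petal x _ K'); last lra.
  by rewrite -{1}(subrK K'%:~R (r (tau t))) petalDint.
have start : petal j (v t0 - K%:~R) = petal (x K') (r (tau t0) - K'%:~R).
  by rewrite -wv // -xr // -vE -rE tau0 psi0.
have v1 := vb t0 bt0; have r1 := rb t0 bt0.
have [dI lab] := petal_eq start.
have xj : x K' = j.
  by apply/esym/lab/(@between_int _ 0); rewrite mulr0z; lra.
have vr0 : v t0 - K%:~R = r (tau t0) - K'%:~R.
  apply/eqP; rewrite -subr_eq0; apply/negPn/negP => nz.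
  set dd := _ - _ in dI nz.
  have [l|l] := ltP 0 dd.
    by have := int_lt_gap (int_num0 _) dI l; rewrite /dd; lra.
  have : dd < 0 by rewrite lt_neqAle nz l.
  by move=> /(int_lt_gap dI (int_num0 _)); rewrite /dd; lra.
have n0k := increasing_le nn (leq0n k).
have Gr := rose_fcomp (n 0%N) (n k - n 0%N) gP; rewrite subnKC // in Gr.
have [h [_ _ hi _ _] hG] := Gr.2 j (wk K).
have shiftK (F : R -> R) (A : int) : ihomeo F -> ihomeo (fun t => h (F t - A%:~R)).
  move=> Fi; have := ihomeo_comp hi (ihomeo_shift 0 (- A%:~R) Fi).
  by rewrite /comp; under eq_fun do rewrite addr0.
(* Both angles at level [k] are carried to the first level by the same injective [h], and there they
   advance equally by the choice of [tau]; so they agree at level [k]. *)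
have eq1 : h (v b - K%:~R) - h (v t0 - K%:~R) = v0 b - v0 t0.
  apply: (@lift_unique_between (fun t => h (v t - K%:~R)) v0).
  - exact/ihomeo_continuous/shiftK.
  - exact: ihomeo_continuous.
  move=> t tb; apply: (W_eq (w := nthw _) (w' := w0) _).1; last first.
    rewrite -v0E (tw_comp tQ _ n0k) vE wv // hG //; have := vb t tb; lra.
have eq2 : h (r (tau b) - K'%:~R) - h (r (tau t0) - K'%:~R) = r0 (tau b) - r0 (tau t0).
  apply: (@lift_unique_between (fun t => h (r (tau t) - K'%:~R)) (r0 \o tau)).
  - exact/ihomeo_continuous/(shiftK (r \o tau))/ihomeo_comp.
  - exact/ihomeo_continuous/ihomeo_comp.
  move=> t tb; apply: (W_eq (w := nthw _) (w' := r0w) _).1; last first.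
    rewrite /= -r0E (tw_comp tQ _ n0k) rE xr // xj hG //; have := rb t tb; lra.
have fin : v b - K%:~R = r (tau b) - K'%:~R.
  apply: (ihomeo_inj hi); move: eq1 eq2; rewrite !r0tau vr0; lra.
by rewrite vE rE wv // xr // fin xj.
Qed.

Lemma chain_between (E : R -> R -> Prop) a b :
  (forall x y, E x y -> E y x) -> (forall x y z, E x y -> E y z -> E x z) ->
  (forall t, between a b t -> exists2 e, 0 < e & forall s, `|s - t| < e -> E t s) ->
  E a b.
Proof.
move=> Es Et; wlog ab : a b / a <= b.
  move=> H loc; have [/H|/ltW/H] := leP a b; first exact.
  by move=> H'; apply/Es/H' => t [] tab; apply: loc; [right|left].
move=> loc; apply: cousin => //; last by move=> u v w _ _; exact: Et.
move=> t tab; have [e e0 H] := loc t (or_introl tab).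
exists e => // u v ut tv eu ve; apply: (Et _ t).
  by apply/Es/H; rewrite ltr_norml; lra.
by apply: H; rewrite ltr_norml; lra.
Qed.

Lemma same_orbit_time (Y : Type) (psi : R -> Y -> Y) q c v w r r' a b :
  ihomeo r -> cancel r r' -> (forall t, q (psi t (c a)) = W w (r t)) ->
  same_orbit psi q c v a b -> c b = psi (r' (v b + (r 0 - v a))) (c a).
Proof.
move=> ri rK rE [s -> [x [u [ui uE us]]]].
have := @lift_eq w r x u 0 s ri ui (fun t => etrans (esym (rE t)) (uE t)).
by rewrite us => H; have -> : v b + (r 0 - v a) = r s by [lra]; rewrite rK.
Qed.

Lemma orbit_reparam (Y : topologicalType) psi yb ky g gw Q n (c : R -> Y) :
  is_flow psi -> @tower Y psi yb ky g Q ->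
  (forall i, rose (ky i.+1) (ky i) (g i) (gw i)) -> (forall k, (n k < n k.+1)%N) ->
  (forall k, exists w v, (forall i, (w i < ky (n k))%N) /\ lifts (fun t => Q (n k) (c t)) w v) ->
  exists2 tau, ihomeo tau & forall t, c t = psi (tau t) (c 0).
Proof.
move=> fl tQ gP nn cl; have [psi0 psiD _] := fl.
have [w0 [v0 [_ [v0i v0E]]]] := cl 0%N.
pose E := same_orbit psi (Q (n 0%N)) c v0.
have Esym x y : E x y -> E y x by exact: same_orbit_sym.
have Etrans x y z : E x y -> E y z -> E x z by exact: same_orbit_trans.
have tauP a : exists tau r w, [/\ ihomeo tau, ihomeo r,
    forall t, Q (n 0%N) (psi t (c a)) = W w (r t), forall t, r (tau t) - r 0 = v0 t - v0 a &
    forall b, E a b -> c b = psi (tau b) (c a)].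
  have [w [r [_ ri rE]]] := tw_lift tQ (n 0%N) (c a).
  have [r' [r'i rK r'K]] := ihomeo_inv ri.
  exists (fun t => r' (v0 t + (r 0 - v0 a))), r, w; split=> //.
  - have := ihomeo_comp r'i (ihomeo_shift 0 (r 0 - v0 a) v0i).
    by rewrite /comp; under eq_fun do rewrite addr0.
  - by move=> t; rewrite r'K; ring.
  - by move=> b; exact: same_orbit_time rK rE.
have loc t0 : c t0 <> yb -> exists2 e, 0 < e & forall s, `|s - t0| < e -> E t0 s.
  exact: (same_orbit_local fl tQ gP nn cl (conj v0i v0E)).
have locb t0 : exists2 e, 0 < e & forall s, `|s - t0| < e -> E t0 s.
  (* At the base point the levels do not determine the petal: [t0] is reached as a
     limit of times on the side of [b], along the orbit of [c b]; the lifted angle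
     [tau] keeps the time needed finite. *)
  have [cb|/loc//] := pselect (c t0 = yb).
  (* The curve can be at [yb] only when [v0] is an integer, so [t0] is the only such time while [v0]
     moves by less than 1. *)
  have [e e0 eH] := (continuousRP v0).1 (ihomeo_continuous v0i) t0 1 ltr01.
  have v0I : v0 t0 \is a Num.int.
    by apply/(W_wedge w0); rewrite -v0E cb (tw_base tQ).
  have isol s : `|s - t0| < e -> s <> t0 -> c s <> yb.
    move=> /eH; rewrite ltr_norml => vs st cs.
    have sI : v0 s \is a Num.int by apply/(W_wedge w0); rewrite -v0E cs (tw_base tQ).
    have [l|l] := leP s t0.
      have : v0 s < v0 t0 by rewrite ihomeo_lt //; lra.
      by move/(int_lt_gap sI v0I); lra.
    have : v0 t0 < v0 s by rewrite ihomeo_lt.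
    by move/(int_lt_gap v0I sI); lra.
  exists e => // b be; apply/Esym.
  have [tau [r [w [taui ri rE tauE tauc]]]] := tauP b.
  suff cE : c t0 = psi (tau t0) (c b) by exists (tau t0) => //; exists w, r.
  have [<-|/eqP bt] := eqVneq b t0.
    apply: tauc; exists 0; first by rewrite psi0.
    by exists w, r; rewrite !subrr.
  have near t : between t0 b t -> t <> t0 -> c t = psi (tau t) (c b).
    move=> tb tt0; apply/tauc/Esym/(chain_between Esym Etrans).
    move=> s sb; apply: loc; apply: isol.
      by move: be; rewrite !ltr_norml; rewrite /between in tb sb; lra.
    by rewrite /between in tb sb; lra.
  apply: (tower_eq (N := 0%N) tQ nn) => k _.
  have [w1 [v1 [w1k [v1i v1E]]]] := cl k.
  have [x [u [xk ui uE]]] := tw_lift tQ (n k) (c b).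
  apply: (@continuous_agree (fun t => Q (n k) (c t)) (fun t => Q (n k) (psi (tau t) (c b))) t0 b).
  - by move=> tb; apply: bt.
  - rewrite (_ : (fun t => Q (n k) (c t)) = W w1 \o v1); last by apply/funext => t; rewrite v1E.
    by move=> t; apply: continuous_comp; [exact: ihomeo_continuous|exact: W_cont w1k _].
  - rewrite (_ : (fun t => Q (n k) (psi (tau t) (c b))) = W x \o (u \o tau)).
      move=> t; apply: continuous_comp; last exact: W_cont xk _.
      exact/ihomeo_continuous/ihomeo_comp.
    by apply/funext => t; rewrite uE.
  - by move=> t tb tt0; rewrite near.
have [tau [_ [_ [taui _ _ _ tauc]]]] := tauP 0.
exists tau => // t; apply: tauc; apply: (chain_between Esym Etrans).
by move=> s _; exact: locb.
Qed.

(** Pulling the levels of [Y] back to [X] puts both towers over one flow; the reparametrization of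
    orbits is absorbed into the lifts. *)
Lemma tower_transport (X Y : topologicalType) phi psi xb yb ky g q (h : X -> Y) :
  flow_equivalence phi psi h -> h xb = yb -> @tower Y psi yb ky g q ->
  @tower X phi xb ky g (fun i x => q i (h x)).
Proof.
move=> [[h' [hK h'K hc h'c]] orb] hb tq; split.
- move=> i x; apply: continuous_comp; [exact: hc|exact: tw_cont tq _ _].
- move=> i x; have [tau [_ ti ts tauE]] := orb x.
  have [w [u [wk ui uE]]] := tw_lift tq i (h x).
  exists w, (u \o tau); split=> //; first by apply: ihomeo_comp.
  by move=> t; rewrite tauE uE.
- by move=> i z /(tw_onto tq)[y <-]; exists (h' y); rewrite h'K.
- by move=> i; rewrite hb (tw_base tq).
- by move=> n m x nm; exact: (tw_comp tq (h x) nm).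
- by move=> x y H; apply: (can_inj hK); apply: (tw_inj tq).
- move=> x U xU; have : nbhs (h x) (h' @^-1` U).
    by apply: h'c; rewrite hK.
  move=> /(tw_nbhs tq)[N [e [e0 eH]]]; exists N, e; split=> // y yN.
  by have := eH (h y) yN; rewrite /= hK.
Qed.

Theorem theorem6p4
  (X Y : topologicalType) (phi : R -> X -> X) (psi : R -> Y -> Y)
  (xb : X) (yb : Y)
  (kx : nat -> nat) (f : nat -> R * R -> R * R) (p : nat -> X -> R * R)
  (ky : nat -> nat) (g : nat -> R * R -> R * R) (q : nat -> Y -> R * R) :
  flow_space phi -> flow_space psi ->
  expansion phi xb kx f p -> expansion psi yb ky g q ->
  (exists h : X -> Y, flow_equivalence phi psi h /\ h xb = yb) <->
  Pi_isomorphic kx f ky g.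
Proof.
move=> fX fY ef eg.
have [fw fP] := expansion_rose ef; have [gw gP] := expansion_rose eg.
have tP := expansion_tower fX ef; have tQ := expansion_tower fY eg.
have [cX _ _ flX _] := fX; have [_ _ _ flY _] := fY.
split.
  move=> [h [he hb]].
  have [m [n [d [u wi]]]] := towers_word_iso cX flX fP gP tP (tower_transport he hb tQ).
  exact: word_iso_Pi wi.
move=> /(Pi_word_iso fP gP)[m [n [d [u wi]]]].
have cP : complete kx f p by case: ef => _ _ _ _ [_ H _].
have cQ : complete ky g q by case: eg => _ _ _ _ [_ H _].
have [h [D [hh hb Dd hE]]] := ladder_homeo flX flY tP tQ cP cQ fP gP wi.
exists h; split=> //; split=> // x.
have [[_ nn] _ _ _ _] := wi; have [_ [_ _ hc _]] := hh.
(* The image under [h] of an orbit has lifted angles before it is known to lie in an orbit of [Y]: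
   at level [n k] it is [D k] applied to a lifted path, hence positive, and [orbit_lift] is used
   over the flow of [X]. *)
have [|tau [ti ts] tauE] := orbit_reparam (c := fun t => h (phi t x)) flY tQ gP nn.
  move=> k; have [||w [v [wk vi vE]]] := @orbit_lift X phi (fun z => q (n k) (h z)) (ky (n k)) cX flX _ _ x.
  - by move=> z; apply: continuous_comp; [exact: hc|exact: tw_cont tQ _ _].
  - move=> z; have [w [v [wk vi vE]]] := tw_lift tP (m k) z.
    have -> : (fun t => q (n k) (h (phi t z))) = (fun t => D k (W w (v t))).
      by apply/funext => t; rewrite hE vE.
    exact: rose_pos_at (Dd k) wk vi.
  - by exists w, v.
have phi0 z : phi 0 z = z by case: flX.
exists tau; split=> //; first exact: ihomeo_continuous.
by move=> t; have := tauE t; rewrite /= phi0.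
Qed.
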